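(* Let $k_1,k_2,k_3$ be the continuous solution on $\mathbb{T}=\{(x,\xi)\in\mathbb{R}^2:0\le\xi\le x\le1\}$ of the controller kernel equations given in the context. Consider the system $$\partial_t u_1+\gamma_1\partial_x u_1=\sigma_{11}u_1+\sigma_{12}u_2+\alpha(x)w,$$ $$\partial_t u_2+\gamma_2\partial_x u_2=\sigma_{21}u_1+\sigma_{22}u_2+\alpha(x)w,$$ $$\partial_t w-\mu\partial_x w=\theta_1(x)u_1+\theta_2(x)u_2,$$ for $t>0$, $x\in(0,1)$, with boundary and initial conditions $$u_i(t,0)=q_iw(t,0)\ (i=1,2),\qquad w(t,1)=\rho_1u_1(t,1)+\rho_2u_2(t,1)+U(t),$$ $$u_i(0,x)=u_i^0(x)\ (i=1,2),\qquad w(0,x)=w^0(x),$$ and the control law $$U(t)=-\rho_1u_1(t,1)-\rho_2u_2(t,1)+\int_0^1\big[k_1(1,\xi)u_1(t,\xi)+k_2(1,\xi)u_2(t,\xi)+k_3(1,\xi)w(t,\xi)\big]\,d\xi .$$ Then, for initial data $(u_1^0,u_2^0,w^0)\in(L^2([0,1]))^3$, the origin of this closed-loop system is exponentially stable in the $L^2$ sense.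
   Context: Coefficients. Let $g,a,C_f,H^*,V^*>0$ be physical constants (gravity, sediment parameter, friction, steady water depth and velocity), with Froude number $Fr=V^*/\sqrt{gH^*}$ either $<1$ (subcritical) or $>1$ (supercritical). Let $\lambda_1<0<\lambda_2<\lambda_3$ be the eigenvalues of $$\begin{pmatrix}V^*&H^*&0\\ g&V^*&g\\ 0&aV^{*2}&0\end{pmatrix}.$$ For $\{i,j,k\}=\{1,2,3\}$ put $r_k=C_f\frac{V^*}{H^*}\frac{\lambda_k}{(\lambda_k-\lambda_i)(\lambda_k-\lambda_j)}$ and $\alpha_k=(3V^*-2\lambda_k)r_k$. Set $\mu=-\lambda_1>0$, $\gamma_1=\lambda_2>0$, $\gamma_2=\lambda_3>0$, $\sigma_{11}=\sigma_{21}=\alpha_2$, $\sigma_{12}=\sigma_{22}=\alpha_3$, and, for $x\in[0,1]$, $\alpha(x)=\alpha_1e^{\alpha_1x/\mu}$, $\theta_j(x)=\alpha_{j+1}e^{\alpha_1x/\mu}$ for $j=1,2$. The numbers $q_1,q_2,\rho_1,\rho_2$ are real constants, and $U(t)$ is a scalar boundary control. (The system is the Saint-Venant-Exner model linearized around a steady state, in characteristic coordinates on a channel of unit length.) Controller kernel equations, on $\mathbb{T}$: $$\mu\partial_xk_1-\gamma_1\partial_\xi k_1=\sigma_{11}k_1+\sigma_{21}k_2+\theta_1(\xi)k_3,$$ $$\mu\partial_xk_2-\gamma_2\partial_\xi k_2=\sigma_{12}k_1+\sigma_{22}k_2+\theta_2(\xi)k_3,$$ $$\mu\partial_xk_3+\mu\partial_\xi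 k_3=\alpha(\xi)k_1+\alpha(\xi)k_2,$$ with $k_1(x,x)=-\frac{\theta_1(x)}{\gamma_1+\mu}$, $k_2(x,x)=-\frac{\theta_2(x)}{\gamma_2+\mu}$, $\mu k_3(x,0)=q_1\gamma_1k_1(x,0)+q_2\gamma_2k_2(x,0)$. Existence, uniqueness and continuity of the solution (understood along characteristics) are known. Exponential stability of the origin in the $L^2$ sense: there exist $C,\nu>0$, independent of the initial data, such that the $L^2([0,1])$ norm of the full state at time $t\ge0$ is at most $Ce^{-\nu t}$ times its norm at time $0$. Solutions are weak ($L^2$) solutions. *)

(* Defs.v *)
(* MathComp-Analysis, over an arbitrary [R : realType]. *)
From HB Require Import structures.
From mathcomp Require Import all_boot all_order all_algebra.
From mathcomp Require Import all_classical all_reals all_analysis.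
Import Order.TTheory GRing.Theory Num.Theory.
Import numFieldNormedType.Exports.

Set Implicit Arguments.
Unset Strict Implicit.
Unset Printing Implicit Defensive.

Local Open Scope classical_set_scope.
Local Open Scope ring_scope.

Section Coefficients.
Context {R : realType}.

Definition froude (g H V : R) : R := V / Num.sqrt (g * H).

Definition sve_matrix (g a H V : R) : 'M[R]_3 :=
  \matrix_(i < 3, j < 3)
    nth 0 (nth [::] [:: [:: V; H; 0]; [:: g; V; g]; [:: 0; a * V ^+ 2; 0]] i) j.

(* [r_coef Cf H V lk li lj] is r_k for {i, j, k} = {1, 2, 3}; it is symmetric
   in [li] and [lj]. *)
Definition r_coef (Cf H V lk li lj : R) : R :=
  Cf * (V / H) * (lk / ((lk - li) * (lk - lj))).

Definition alpha_coef (Cf H V lk li lj : R) : R :=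
  (3 * V - 2 * lk) * r_coef Cf H V lk li lj.

Record coeffs := Coeffs {
  mu : R;
  gamma1 : R;
  gamma2 : R;
  sigma11 : R;
  sigma12 : R;
  sigma21 : R;
  sigma22 : R;
  alpha : R -> R;
  theta1 : R -> R;
  theta2 : R -> R }.

(* Saint-Venant-Exner model linearized around the steady state (H, V), in
   characteristic coordinates. *)
Definition sve_coeffs (Cf H V l1 l2 l3 : R) : coeffs :=
  let mu := - l1 in
  let a1 := alpha_coef Cf H V l1 l2 l3 in
  let a2 := alpha_coef Cf H V l2 l1 l3 in
  let a3 := alpha_coef Cf H V l3 l1 l2 in
  {| mu := mu;
     gamma1 := l2;
     gamma2 := l3;
     sigma11 := a2;
     sigma12 := a3;
     sigma21 := a2;
     sigma22 := a3;
     alpha := fun x => a1 * expR (a1 * x / mu);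
     theta1 := fun x => a2 * expR (a1 * x / mu);
     theta2 := fun x => a3 * expR (a1 * x / mu) |}.

End Coefficients.

Arguments coeffs : clear implicits.

Section Kernels.
Context {R : realType}.
Implicit Types (k f : R -> R -> R).

Definition triangle : set (R * R) :=
  [set p | 0 <= p.2 /\ p.2 <= p.1 /\ p.1 <= 1].

(* a * d_x k + b * d_xi k = f on the triangle, in integrated form along the
   characteristics s |-> (x + a s, xi + b s).  The triangle is convex, so the
   segment of integration stays inside it as soon as its end points do. *)
Definition holds_along_characteristics (a b : R) k f : Prop :=
  forall x xi s : R, 0 <= s ->
    triangle (x, xi) -> triangle (x + a * s, xi + b * s) ->
    k (x + a * s) (xi + b * s) - k x xi =
    \int[lebesgue_measure]_(r in `[0, s]) f (x + a * r) (xi + b * r).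

Definition continuous_on_triangle k : Prop :=
  {within triangle, continuous (fun p : R * R => k p.1 p.2)}.

Definition kernel_equations (c : coeffs R) k1 k2 k3 : Prop :=
  [/\ holds_along_characteristics (mu c) (- gamma1 c) k1
        (fun x xi => sigma11 c * k1 x xi + sigma21 c * k2 x xi
                     + theta1 c xi * k3 x xi),
      holds_along_characteristics (mu c) (- gamma2 c) k2
        (fun x xi => sigma12 c * k1 x xi + sigma22 c * k2 x xi
                     + theta2 c xi * k3 x xi)
    & holds_along_characteristics (mu c) (mu c) k3
        (fun x xi => alpha c xi * k1 x xi + alpha c xi * k2 x xi)].

Definition kernel_boundary_conditions (c : coeffs R) (q1 q2 : R) k1 k2 k3 :
    Prop :=
  forall x, 0 <= x <= 1 ->
  [/\ k1 x x = - (theta1 c x / (gamma1 c + mu c)),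
      k2 x x = - (theta2 c x / (gamma2 c + mu c))
    & mu c * k3 x 0 = q1 * gamma1 c * k1 x 0 + q2 * gamma2 c * k2 x 0].

Definition kernel_solution (c : coeffs R) (q1 q2 : R) k1 k2 k3 : Prop :=
  [/\ continuous_on_triangle k1,
      continuous_on_triangle k2,
      continuous_on_triangle k3,
      kernel_equations c k1 k2 k3
    & kernel_boundary_conditions c q1 q2 k1 k2 k3].

End Kernels.

Section WeakSolutions.
Context {R : realType}.
Implicit Types (u f phi : R -> R -> R) (v : R -> R).

Definition square_integrable (D : set R) v : Prop :=
  measurable_fun D (v : measurableTypeR R -> R) /\
  lebesgue_measure.-integrable D (fun x => (v x ^+ 2)%:E).

Definition L2 v : Prop := square_integrable `[0, 1] v.

Definition L2loc v : Prop := forall T, 0 < T -> square_integrable `[0, T] v.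

Definition L2norm v : R :=
  Num.sqrt (\int[lebesgue_measure]_(x in `[0, 1]) v x ^+ 2).

Definition state_norm (v1 v2 v3 : R -> R) : R :=
  Num.sqrt (L2norm v1 ^+ 2 + L2norm v2 ^+ 2 + L2norm v3 ^+ 2).

(* u belongs to C([0, +oo); L^2(0, 1)), where [u t] is the state at time t. *)
Definition continuous_in_L2 u : Prop :=
  (forall t, 0 <= t -> L2 (u t)) /\
  (forall t0, 0 <= t0 ->
    L2norm (fun x => u t x - u t0 x)
      @[t --> within [set t | 0 <= t] (nbhs t0)] --> (0 : R)).

Definition dt phi (t x : R) : R := derive1 (fun s => phi s x) t.
Definition dx phi (t x : R) : R := derive1 (phi t) x.

Definition C1 phi : Prop :=
  [/\ forall t x, derivable (fun s => phi s x) t 1,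
      forall t x, derivable (phi t) x 1,
      continuous (fun p : R * R => dt phi p.1 p.2)
    & continuous (fun p : R * R => dx phi p.1 p.2)].

(* u is a weak L^2 solution of d_t u + c d_x u = f on (0, +oo) x (0, 1), with
   boundary traces v0 = u(., 0) and v1 = u(., 1).  An element of
   C([0, +oo); L^2) has no pointwise boundary values: for c != 0 the traces
   are determined (almost everywhere) by Green's formula below, in which the
   test functions are unconstrained on the boundary. *)
Definition weak_transport (c : R) u f (v0 v1 : R -> R) : Prop :=
  [/\ continuous_in_L2 u, L2loc v0, L2loc v1
    & forall phi, C1 phi -> forall T, 0 < T ->
      \int[lebesgue_measure]_(x in `[0, 1]) (phi T x * u T x)
      - \int[lebesgue_measure]_(x in `[0, 1]) (phi 0 x * u 0 x) =
      \int[lebesgue_measure]_(t in `[0, T])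
        \int[lebesgue_measure]_(x in `[0, 1])
          ((dt phi t x + c * dx phi t x) * u t x + phi t x * f t x)
      - c * \int[lebesgue_measure]_(t in `[0, T])
              (phi t 1 * v1 t - phi t 0 * v0 t)].

(* The system with boundary input U; [y1] and [y2] are the traces at x = 1 of
   u1 and u2. *)
Definition open_loop_solution (c : coeffs R) (q1 q2 rho1 rho2 : R)
    (U : R -> R) (u10 u20 w0 : R -> R) u1 u2 w (y1 y2 : R -> R) : Prop :=
  exists z1 z2 z y : R -> R,
  [/\ [/\ weak_transport (gamma1 c) u1
            (fun t x => sigma11 c * u1 t x + sigma12 c * u2 t x
                        + alpha c x * w t x) z1 y1,
          weak_transport (gamma2 c) u2
            (fun t x => sigma21 c * u1 t x + sigma22 c * u2 t x
                        + alpha c x * w t x) z2 y2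
        & weak_transport (- mu c) w
            (fun t x => theta1 c x * u1 t x + theta2 c x * u2 t x) z y],
      {ae lebesgue_measure, forall t : R, 0 < t ->
        [/\ z1 t = q1 * z t, z2 t = q2 * z t
          & y t = rho1 * y1 t + rho2 * y2 t + U t]}
    & {ae lebesgue_measure, forall x : R, 0 <= x <= 1 ->
        [/\ u1 0 x = u10 x, u2 0 x = u20 x & w 0 x = w0 x]}].

Definition closed_loop_solution (c : coeffs R) (q1 q2 rho1 rho2 : R)
    (k1 k2 k3 : R -> R -> R) (u10 u20 w0 : R -> R) u1 u2 w : Prop :=
  exists U y1 y2 : R -> R,
  open_loop_solution c q1 q2 rho1 rho2 U u10 u20 w0 u1 u2 w y1 y2 /\
  {ae lebesgue_measure, forall t : R, 0 < t ->
    U t = - rho1 * y1 t - rho2 * y2 t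
          + \int[lebesgue_measure]_(xi in `[0, 1])
              (k1 1 xi * u1 t xi + k2 1 xi * u2 t xi + k3 1 xi * w t xi)}.

Definition exponentially_stable (c : coeffs R) (q1 q2 rho1 rho2 : R)
    (k1 k2 k3 : R -> R -> R) : Prop :=
  exists C nu : R, [/\ 0 < C, 0 < nu
    & forall u10 u20 w0 : R -> R, L2 u10 -> L2 u20 -> L2 w0 ->
      forall u1 u2 w : R -> R -> R,
      closed_loop_solution c q1 q2 rho1 rho2 k1 k2 k3 u10 u20 w0 u1 u2 w ->
      forall t, 0 <= t ->
      state_norm (u1 t) (u2 t) (w t)
        <= C * expR (- nu * t) * state_norm u10 u20 w0].

End WeakSolutions.

(* Main.v *)
Require Import Defs.
From HB Require Import structures.
From mathcomp Require Import all_boot all_order all_algebra.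
From mathcomp Require Import all_classical all_reals all_analysis.
From mathcomp Require Import measurable_realfun.
From mathcomp Require Import ring lra.
Import Order.TTheory GRing.Theory Num.Theory.
Import numFieldNormedType.Exports.
Set Implicit Arguments.
Unset Strict Implicit.
Unset Printing Implicit Defensive.
Local Open Scope classical_set_scope.
Local Open Scope ring_scope.

(** Set
      beta(t, x) = w(t, x) - int_0^x (k1(x, .) u1 + k2(x, .) u2 + k3(x, .) w).
    The kernels are made so that beta solves dt beta - mu dx beta = 0 with
    beta(t, 1) = 0: it travels to the left and nothing enters, so that it has
    left the channel at time 1 / mu.  Since beta and w agree at x = 0, the
    variables u1 and u2 receive there q1 beta(t, 0) and q2 beta(t, 0), a signal
    whose energy is controlled by beta(0, .), and they carry it to the right.
    It remains to bound the effect of the couplings inside the domain.  In the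
    norm weighted by exp(- delta x), transport to the right at speed gamma
    contracts at the rate delta gamma, whereas a Volterra operator has a norm of
    order delta^(-1/2).  So for large delta one can solve for w in terms of
    beta, u1 and u2 with constants that do not depend on delta
    ([nrm_wgt_of_backstepping]), the couplings are bounded by constants that do
    not depend on delta either, and they lose against the contraction rate as
    soon as delta is large ([transport_decay], [gronwall], [solution_decay]).

    Solutions are only continuous in time with values in L2 and the kernels are
    only continuous, so nothing can be differentiated.  Instead, every estimate
    tests the solution with continuous functions, which determine the L2 norm
    ([duality]).  A test function psi(x - c t) is annihilated by dt + c dx; it
    is admissible for continuous psi by density of the C1 functions
    ([transport_test]), and so are superpositions in time of such functions
    ([superposition]), hence all solutions phi of an adjoint problem
    dt phi + c dx phi = g, phi(t, 1) = 0, with g continuous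
    ([duhamel_test]).

    Testing beta with psi(x + mu t) amounts, after exchanging the integrals, to
    testing u1, u2, w with the functions
      int_xi^1 psi(x + mu t) k(x, xi) dx
    for k = k1, k2, k3.  The kernel equations, integrated along the
    characteristics, say precisely that these functions solve such adjoint
    problems ([dual_test_right], [dual_test_left]).  Adding up the tested
    equations, the couplings inside the domain cancel, the feedback law cancels
    what is left at x = 1 and the boundary condition of k3 cancels the inflow of
    u1 and u2, which proves that beta is transported
    ([backstepping_transport]). *)

Notation leb := lebesgue_measure.

(** * Integration on segments *)

Section OneVariable.
Context {R : realType}.
Implicit Types (f g F : R -> R) (a b c : R).

Definition itgb a b f := leb.-integrable `[a, b] (EFin \o f).

Lemma itgb_continuous a b f : continuous f -> itgb a b f.
Proof.
move=> cf; apply: continuous_compact_integrable; first exact: segment_compact.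
by apply: continuous_subspaceT.
Qed.

Lemma itgb_sub a b a' b' f : a <= a' -> b' <= b -> itgb a b f -> itgb a' b' f.
Proof.
move=> aa bb; apply: integrableS => //.
by apply: subset_itv; rewrite bnd_simp.
Qed.

Lemma itgbD a b f g : itgb a b f -> itgb a b g -> itgb a b (fun x => f x + g x).
Proof. by move=> hf hg; exact: (integrableD _ hf hg). Qed.

Lemma itgbN a b f : itgb a b f -> itgb a b (fun x => - f x).
Proof. by move=> hf; exact: (integrableN hf). Qed.

Lemma itgbB a b f g : itgb a b f -> itgb a b g -> itgb a b (fun x => f x - g x).
Proof. by move=> hf hg; exact: (integrableB _ hf hg). Qed.

Lemma itgbZ a b k f : itgb a b f -> itgb a b (fun x => k * f x).
Proof. by move=> hf; exact: (integrableZl _ k hf). Qed.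

Lemma itgb_measurable a b f : itgb a b f -> measurable_fun `[a, b] f.
Proof. by move=> /measurable_int /measurable_EFinP. Qed.

Lemma continuous_measurable D f : measurable D -> continuous f ->
  measurable_fun D f.
Proof.
by move=> mD cf; apply: measurable_funTS; exact: continuous_measurable_fun.
Qed.

Lemma continuous_bounded_itv a b f : continuous f ->
  exists M, 0 <= M /\ forall x, a <= x <= b -> `|f x| <= M.
Proof.
move=> cf.
have /compact_bounded[M [_ hM]] := @continuous_compact _ _ f `[a, b]
  (continuous_subspaceT cf) (@segment_compact R a b).
exists (`|M| + 1); split; first by rewrite addr_ge0.
move=> x hx; apply: (hM (`|M| + 1)).
  by rewrite (le_lt_trans (ler_norm _))// ltrDl.
by exists x => //=; rewrite in_itv/=.
Qed.

Lemma itgbM_continuous a b f g : continuous f -> itgb a b g ->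
  itgb a b (fun x => f x * g x).
Proof.
move=> cf hg; have [M [_ hM]] := continuous_bounded_itv a b cf.
suff : leb.-integrable `[a, b] ((EFin \o f) \* (EFin \o g))%E by [].
apply: integrableMr hg => //; first exact: continuous_measurable.
exists M; split; first exact: num_real.
by move=> M' MM' x /=; rewrite in_itv/= => /hM /le_trans; apply; exact: ltW.
Qed.

Lemma intgD a b f g : itgb a b f -> itgb a b g ->
  \int[leb]_(x in `[a, b]) (f x + g x) =
  \int[leb]_(x in `[a, b]) f x + \int[leb]_(x in `[a, b]) g x.
Proof. by move=> hf hg; rewrite RintegralD. Qed.

Lemma intgB a b f g : itgb a b f -> itgb a b g ->
  \int[leb]_(x in `[a, b]) (f x - g x) =
  \int[leb]_(x in `[a, b]) f x - \int[leb]_(x in `[a, b]) g x.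
Proof. by move=> hf hg; rewrite RintegralB. Qed.

Lemma intgZ a b k f : itgb a b f ->
  \int[leb]_(x in `[a, b]) (k * f x) = k * \int[leb]_(x in `[a, b]) f x.
Proof. by move=> hf; rewrite RintegralZl. Qed.

Lemma intgN a b f : itgb a b f ->
  \int[leb]_(x in `[a, b]) (- f x) = - \int[leb]_(x in `[a, b]) f x.
Proof.
move=> hf; rewrite -mulN1r -intgZ//.
by apply: eq_Rintegral => x _; rewrite mulN1r.
Qed.

Lemma eq_intg a b f g : (forall x, a <= x <= b -> f x = g x) ->
  \int[leb]_(x in `[a, b]) f x = \int[leb]_(x in `[a, b]) g x.
Proof.
by move=> fg; apply: eq_Rintegral => x; rewrite inE/= in_itv/=; exact: fg.
Qed.

Lemma eq_itgb a b f g : (forall x, a <= x <= b -> f x = g x) ->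
  itgb a b f -> itgb a b g.
Proof.
move=> fg; apply: eq_integrable => // x; rewrite inE/= in_itv/= => /fg.
by move=> ->.
Qed.

Lemma le_intg a b f g : itgb a b f -> itgb a b g ->
  (forall x, a <= x <= b -> f x <= g x) ->
  \int[leb]_(x in `[a, b]) f x <= \int[leb]_(x in `[a, b]) g x.
Proof.
move=> hf hg fg; apply: le_Rintegral => //.
Qed.

Lemma intg_ge0 a b f : (forall x, a <= x <= b -> 0 <= f x) ->
  0 <= \int[leb]_(x in `[a, b]) f x.
Proof. by move=> f0; apply: Rintegral_ge0 => x /=; rewrite in_itv/=; exact: f0. Qed.

Lemma itgb_norm a b f : itgb a b f -> itgb a b (fun x => `|f x|).
Proof. by move=> hf; exact: (integrable_norm hf). Qed.

Lemma normr_intg a b f : itgb a b f ->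
  `|\int[leb]_(x in `[a, b]) f x| <= \int[leb]_(x in `[a, b]) `|f x|.
Proof. by move=> hf; exact: le_normr_Rintegral. Qed.

Lemma intg_cst a b k : a <= b -> \int[leb]_(x in `[a, b]) k = k * (b - a).
Proof.
move=> ab; rewrite Rintegral_cst//= lebesgue_measure_itv/= lte_fin.
case: ltP => [//|ba].
have -> : a = b by apply/eqP; rewrite eq_le ab ba.
by rewrite subrr.
Qed.

Lemma intg_point a f : \int[leb]_(x in `[a, a]) f x = 0.
Proof. by rewrite set_itv1 Rintegral_set1. Qed.

Lemma intg_cat a b c f : a <= b -> b <= c -> itgb a c f ->
  \int[leb]_(x in `[a, c]) f x =
  \int[leb]_(x in `[a, b]) f x + \int[leb]_(x in `[b, c]) f x.
Proof.
move=> ab bc hf.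
have := @Rintegral_itvB R f (BLeft a) (BRight c) b hf.
rewrite !bnd_simp ab => /(_ isT); rewrite bc => /(_ isT) hB.
rewrite -(Rintegral_itv_obnd_cbnd (r := b)).
  by rewrite -hB addrC subrK.
apply: integrableS hf => //.
by apply: subset_itv; rewrite bnd_simp.
Qed.

(** The fundamental theorem of calculus gives a primitive to the right of a
    starting point only.  Letting the starting point depend on [x] reaches the
    whole line; subtracting the value at [0] makes these primitives agree. *)
Lemma continuous_primitive f : continuous f ->
  exists F, forall x : R, is_derive x 1 F (f x).
Proof.
move=> cf.
pose P a x := \int[leb]_(t in `[a, x]) f t.
pose F (x : R) : R := P (Num.min x 0 - 1) x - P (Num.min x 0 - 1) 0.
exists F => x.
pose a := Num.min x 0 - 2.
have ax : a < x by rewrite /a; have := ge_min x x 0; rewrite lexx/=; lra.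
have a0 : a < 0 by rewrite /a; have := ge_min 0 x 0; rewrite lexx/= orbT; lra.
have [dP P'] : derivable (P a) x 1 /\ derive1 (P a) x = f x.
  apply: (@continuous_FTC1_closed _ _ _ _ (x + 1)) => //; first by rewrite ltrDl.
    exact: itgb_continuous.
  exact: cf.
have dPf : is_derive x 1 (P a) (f x) by apply: (DeriveDef dP); rewrite -derive1E; exact: P'.
have dPc : is_derive x 1 (fun y => P a y - P a 0) (f x).
  by rewrite -[f x]subr0; exact: is_deriveB.
apply: near_eq_is_derive dPc; near=> y.
have hy : x - 1 < y by near: y; apply: lt_nbhsr; lra.
have am : a <= Num.min y 0 - 1.
  rewrite /a.
  have [h1|h1] := leP y 0; have [h2|h2] := leP x 0; lra.
have split0 u : Num.min y 0 <= u ->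
    P a u = P a (Num.min y 0 - 1) + P (Num.min y 0 - 1) u.
  by move=> hu; apply: intg_cat => //; [lra|exact: itgb_continuous].
rewrite /F (split0 y) ?(split0 0); first lra.
- by rewrite ge_min lexx orbT.
- by rewrite ge_min lexx.
Unshelve. all: by end_near.
Qed.

Lemma intg_primitive a b f F : a <= b -> continuous f ->
  (forall x : R, is_derive x 1 F (f x)) ->
  \int[leb]_(x in `[a, b]) f x = F b - F a.
Proof.
rewrite le_eqVlt => /predU1P[->|ab] cf dF; first by rewrite intg_point subrr.
have cF : continuous F.
  move=> x; apply: differentiable_continuous; apply/derivable1_diffP.
  by have := dF x; case.
rewrite /Rintegral (@continuous_FTC2 _ f F)//.
- by apply: continuous_subspaceT.
- split.
  + by move=> x _; have := dF x; case.
  + by apply: cvg_at_right_filter; exact: cF.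
  + by apply: cvg_at_left_filter; exact: cF.
- by move=> x _; rewrite derive1E; exact: derive_val.
Qed.

End OneVariable.

(** * Proving continuity *)
Section Continuity.
Context {R : realType}.

Lemma cont_cst (T V : topologicalType) (k : V) : continuous (fun _ : T => k).
Proof. by move=> x; exact: cvg_cst. Qed.

Lemma cont_id (T : topologicalType) : continuous (fun x : T => x).
Proof. by move=> x; exact: cvg_id. Qed.

Lemma cont_fst (T U V : topologicalType) (f : T -> U * V) : continuous f ->
  continuous (fun x => (f x).1).
Proof. by move=> cf x; apply: cvg_comp (cf x) _; exact: cvg_fst. Qed.

Lemma cont_snd (T U V : topologicalType) (f : T -> U * V) : continuous f ->
  continuous (fun x => (f x).2).
Proof. by move=> cf x; apply: cvg_comp (cf x) _; exact: cvg_snd. Qed.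

Lemma cont_pair (T U V : topologicalType) (f : T -> U) (g : T -> V) :
  continuous f -> continuous g -> continuous (fun x => (f x, g x)).
Proof. by move=> cf cg x; apply: cvg_pair; [exact: cf|exact: cg]. Qed.

Section Ops.
Variable T : topologicalType.
Implicit Types (f g : T -> R).

Lemma contD f g : continuous f -> continuous g ->
  continuous (fun x => f x + g x).
Proof. by move=> cf cg x; apply: (@cvgD _ R^o _ _ _ _ _ (f x) (g x)); [exact: cf|exact: cg]. Qed.

Lemma contN f : continuous f -> continuous (fun x => - f x).
Proof. by move=> cf x; apply: (@cvgN _ R^o _ _ _ _ (f x)); exact: cf. Qed.

Lemma contM f g : continuous f -> continuous g ->
  continuous (fun x => f x * g x).
Proof. by move=> cf cg x; apply: cvgM; [exact: cf|exact: cg]. Qed.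

Lemma cont_max f g : continuous f -> continuous g ->
  continuous (fun x => Num.max (f x) (g x)).
Proof. by move=> cf cg x; apply: continuous_max; [exact: cf|exact: cg]. Qed.

Lemma cont_min f g : continuous f -> continuous g ->
  continuous (fun x => Num.min (f x) (g x)).
Proof. by move=> cf cg x; apply: continuous_min; [exact: cf|exact: cg]. Qed.

Lemma contX f n : continuous f -> continuous (fun x => f x ^+ n).
Proof.
by move=> cf; elim: n => [|n ih]; [exact: cont_cst|];
   under eq_fun do rewrite exprS; exact: contM.
Qed.

Lemma cont_norm f : continuous f -> continuous (fun x => `|f x|).
Proof. by move=> cf x; apply: cvg_norm; exact: cf. Qed.

Lemma cont_app1 (U V : topologicalType) (h : U -> V) (f : T -> U) :
  continuous h -> continuous f -> continuous (fun x => h (f x)).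
Proof. by move=> ch cf x; exact: (continuous_comp (cf x) (ch (f x))). Qed.

Lemma cont_app2 (U V W : topologicalType) (h : U -> V -> W) (f : T -> U)
    (g : T -> V) : continuous (fun p : U * V => h p.1 p.2) ->
  continuous f -> continuous g -> continuous (fun x => h (f x) (g x)).
Proof.
move=> ch cf cg x.
exact: (continuous_comp (cont_pair cf cg (x := x)) (ch (f x, g x))).
Qed.

Lemma cont_expR f : continuous f -> continuous (fun x => expR (f x)).
Proof. by move=> cf; apply: cont_app1 cf; exact: continuous_expR. Qed.

End Ops.
End Continuity.

(** Joint continuity, by recursion on the expression; the continuity of the
    functions of one or two variables that occur in it is looked up in the
    context. *)
Ltac cont :=
  cbn beta;
  lazymatch goal with
  | |- continuous (fun _ => ?k) => exact: cont_cst
  | |- continuous (fun x => x) => exact: cont_id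
  | |- continuous (fun x => (@?f x).1) => apply: (@cont_fst _ _ _ f); cont
  | |- continuous (fun x => (@?f x).2) => apply: (@cont_snd _ _ _ f); cont
  | |- continuous (fun x => (@?f x, @?g x)) =>
      apply: (@cont_pair _ _ _ f g); cont
  | |- continuous (fun x => @?f x + @?g x) => apply: (@contD _ _ f g); cont
  | |- continuous (fun x => @?f x * @?g x) => apply: (@contM _ _ f g); cont
  | |- continuous (fun x => - @?f x) => apply: (@contN _ _ f); cont
  | |- continuous (fun x => @?f x ^+ ?n) => apply: (@contX _ _ f); cont
  | |- continuous (fun x => expR (@?f x)) => apply: (@cont_expR _ _ f); cont
  | |- continuous (fun x => `|@?f x|) => apply: (@cont_norm _ _ f); cont
  | |- continuous (fun x => Num.max (@?f x) (@?g x)) => apply: (@cont_max _ _ f g); cont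
  | |- continuous (fun x => Num.min (@?f x) (@?g x)) => apply: (@cont_min _ _ f g); cont
  | |- continuous (fun x => ?h (@?f x) (@?g x)) =>
      first [apply: (@cont_app2 _ _ _ _ h f g);
               [first [assumption|done|idtac]|cont|cont]
            |lazymatch goal with |- continuous (fun x => ?k (@?e x)) =>
               apply: (@cont_app1 _ _ _ k e);
                 [first [assumption|done|idtac]|cont] end]
  | |- continuous (fun x => ?h (@?f x)) =>
      apply: (@cont_app1 _ _ _ h f); [first [assumption|done|idtac]|cont]
  | |- continuous ?f =>
      first [assumption | done | change (continuous (fun x => f x)); cont | idtac]
  end.

(** * Parametric and oriented integrals *)
Section Parametric.
Context {R : realType}.
Variable T : topologicalType.
Implicit Types (f u : T -> R -> R).

Lemma near_uniform_itv f a b p0 e : continuous (fun p : T * R => f p.1 p.2) ->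
  0 < e -> \forall p \near p0, forall s, a <= s <= b -> `|f p s - f p0 s| <= e.
Proof.
move=> cf e0.
have /compact_near_coveringP := @segment_compact R a b.
move=> /(_ T (nbhs p0) (fun p s => `|f p s - f p0 s| <= e) _) H.
have {}H := H _; apply: filterS (H _) => [p hp s hs|].
  by apply: hp; rewrite /= in_itv.
move=> s _.
have e2 : 0 < e / 2 by rewrite divr_gt0.
have /cvgrPdist_le/(_ _ e2) h1 := cf (p0, s).
have cs : continuous (f p0) by cont.
have /cvgrPdist_le/(_ _ e2) h2 := cs s.
move: h1 => -[[A B] /= [hA hB] AB].
exists (B `&` [set x' | `|f p0 s - f p0 x'| <= e / 2], A).
  by split => //; exact: filterI.
move=> -[s' p] /= [[Bs' h] Ap].
have -> : f p s' - f p0 s' = (f p0 s - f p0 s') - (f p0 s - f p s') by ring.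
rewrite (le_trans (ler_normB _ _))// [leRHS](splitr e) lerD//.
exact: (AB (p, s')).
Qed.

(** Near [p0], [f] is uniformly close to [f p0] on the compact segment, so it is
    enough that the densities vary continuously in [L^1]. *)
Lemma continuous_intgM f u a b : continuous (fun p : T * R => f p.1 p.2) ->
  (forall p, itgb a b (u p)) ->
  (forall p0, \int[leb]_(s in `[a, b]) `|u p s - u p0 s| @[p --> p0] --> 0) ->
  continuous (fun p => \int[leb]_(s in `[a, b]) (f p s * u p s)).
Proof.
move=> cf iu cu p0; apply/cvgrPdist_le => e e0.
have cfp p : continuous (f p) by cont.
have ifu p q : itgb a b (fun s => f p s * u q s) by exact: itgbM_continuous.
have [M [M0 hM]] := continuous_bounded_itv a b (cfp p0).
pose I := \int[leb]_(s in `[a, b]) `|u p0 s|.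
have I0 : 0 <= I by exact: intg_ge0.
pose d := e / (M + I + 2).
have d0 : 0 < d by rewrite divr_gt0//; lra.
have d1 : 0 < Num.min d 1 by rewrite lt_min d0 ltr01.
have hu : \forall p \near p0, \int[leb]_(s in `[a, b]) `|u p s - u p0 s| <= Num.min d 1.
  have /cvgrPdist_le/(_ _ d1) := cu p0.
  apply: filterS => p; rewrite sub0r normrN ger0_norm//.
  exact: intg_ge0.
have hf := near_uniform_itv a b p0 cf d0.
near=> p.
have hup : \int[leb]_(s in `[a, b]) `|u p s - u p0 s| <= Num.min d 1 by near: p.
have hfp : forall s, a <= s <= b -> `|f p s - f p0 s| <= d by near: p.
rewrite -intgB// (le_trans (normr_intg _))//; first exact: itgbB.
have idu : itgb a b (fun s => `|u p s - u p0 s|).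
  by apply: itgb_norm; exact: itgbB.
have iu0 : itgb a b (fun s => `|u p0 s|) by exact: itgb_norm.
apply: (@le_trans _ _ (\int[leb]_(s in `[a, b])
    ((M + d) * `|u p s - u p0 s| + d * `|u p0 s|))).
  apply: le_intg.
  - by apply: itgb_norm; exact: itgbB.
  - by apply: itgbD; exact: itgbZ.
  move=> s hs.
  have -> : f p0 s * u p0 s - f p s * u p s =
    - ((f p0 s + (f p s - f p0 s)) * (u p s - u p0 s) + (f p s - f p0 s) * u p0 s).
    by ring.
  rewrite normrN (le_trans (ler_normD _ _))// !normrM lerD//.
    rewrite ler_wpM2r// (le_trans (ler_normD _ _))// lerD//; [exact: hM|exact: hfp].
  by rewrite ler_wpM2r//; exact: hfp.
rewrite intgD ?intgZ//; try exact: itgbZ.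
move: hup; rewrite le_min => /andP[hup1 hup2].
rewrite -/I.
set J := Rintegral _ _ _ in hup1 hup2 *.
have J0 : 0 <= J by exact: intg_ge0.
apply: (@le_trans _ _ (d * (M + I + 2))); last first.
  rewrite /d divfK// gt_eqF//; lra.
have h1 : M * J <= M * d by rewrite ler_wpM2l.
have h2 : d * J <= d * 1 by rewrite ler_wpM2l// ltW.
nra.
Unshelve. all: by end_near.
Qed.

Lemma continuous_intg f a b : continuous (fun p : T * R => f p.1 p.2) ->
  continuous (fun p => \int[leb]_(s in `[a, b]) f p s).
Proof.
move=> cf.
have -> : (fun p => \int[leb]_(s in `[a, b]) f p s) =
          (fun p => \int[leb]_(s in `[a, b]) (f p s * 1)).
  by apply/funext => p; apply: eq_intg => s _; rewrite mulr1.
apply: (@continuous_intgM f (fun _ _ => 1)) => //.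
- by move=> p; apply: itgb_continuous; cont.
- move=> p0; under eq_fun do rewrite subrr normr0.
  rewrite (_ : (fun _ => _) = (fun=> 0)); first exact: cvg_cst.
  by apply/funext => p; rewrite Rintegral_cst// mul0r.
Qed.

End Parametric.

(** The oriented integral from [a] to [b], through the affine parametrisation of
    the segment: the orientation is built in, and it visibly depends
    continuously on the bounds. *)
Definition oint {R : realType} (f : R -> R) (a b : R) : R :=
  (b - a) * \int[leb]_(s in `[0, 1]) f (a + (b - a) * s).

Section Oriented.
Context {R : realType}.
Implicit Types (f g F : R -> R) (a b c k : R).

Lemma is_derive_affine F f a k : (forall x : R, is_derive x 1 F (f x)) ->
  forall x : R, is_derive x 1 (fun x => F (a + k * x)) (k * f (a + k * x)).
Proof.
move=> dF x; rewrite mulrC; apply: (@is_derive1_comp _ F (fun x => a + k * x)).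
rewrite -[X in is_derive _ _ _ X]add0r -[X in _ + X]mulr1.
by apply: is_deriveD; apply: is_deriveZ.
Qed.

Lemma oint_primitive f F a b : continuous f ->
  (forall x : R, is_derive x 1 F (f x)) -> oint f a b = F b - F a.
Proof.
move=> cf dF; rewrite /oint -intgZ; last by apply: itgb_continuous; cont.
have := is_derive_affine a (b - a) dF => dG.
rewrite (intg_primitive ler01 _ dG); last by cont.
by rewrite mulr1 mulr0 addr0 subrKC.
Qed.

Lemma intg_oint f a b : a <= b -> continuous f ->
  \int[leb]_(x in `[a, b]) f x = oint f a b.
Proof.
move=> ab cf; have [F dF] := continuous_primitive cf.
by rewrite (oint_primitive _ _ cf dF) (intg_primitive ab cf dF).
Qed.

Lemma oint_cat f a b c : continuous f -> oint f a b + oint f b c = oint f a c.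
Proof.
move=> cf; have [F dF] := continuous_primitive cf.
by rewrite !(oint_primitive _ _ cf dF); ring.
Qed.

Lemma continuous_oint (T : topologicalType) (f : T -> R -> R) (a b : T -> R) :
  continuous (fun p : T * R => f p.1 p.2) -> continuous a -> continuous b ->
  continuous (fun p => oint (f p) (a p) (b p)).
Proof.
move=> cf ca cb; rewrite /oint.
apply: contM; first by cont.
apply: (@continuous_intg _ _ (fun p s => f p (a p + (b p - a p) * s))).
by cont.
Qed.

End Oriented.

(** * Fubini on rectangles *)
Section TwoVariables.
Context {R : realType}.
Implicit Types (F G k : R -> R -> R) (f g : R -> R).

(** Measurability is meant for the product sigma-algebra, for which the open
    sets of the plane are not at hand: the function is the limit of its
    discretisations in the first variable. *)
Lemma continuous2_measurable F : continuous (fun p : R * R => F p.1 p.2) ->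
  measurable_fun [set: R * R] (fun p => F p.1 p.2).
Proof.
move=> cF.
pose q (n : nat) (z : int) : R := z%:~R / n.+1%:R.
pose r (n : nat) (x : R) : int := Num.floor (x * n.+1%:R).
apply: (@measurable_fun_cvg _ _ _ _ (fun n p => F (q n (r n p.1)) p.2)).
  move=> n _ Y mY; rewrite setTI.
  have -> : (fun p : R * R => F (q n (r n p.1)) p.2) @^-1` Y =
      \bigcup_(z : int) (`[q n z, q n (z + 1)[ `*` (F (q n z) @^-1` Y)).
    apply/seteqP; split => [[x y] /= hY|[x y] [z _ []] /=].
      exists (r n x) => //; split => //=.
      by rewrite in_itv/= ler_pdivrMr// ltr_pdivlMr// Num.Theory.floor_le floorD1_gt.
    rewrite in_itv/= ler_pdivrMr// ltr_pdivlMr// => /andP[h1 h2] hY.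
    suff -> : r n x = z by [].
    by apply/floor_def; rewrite h1 h2.
  apply: countable_bigcupT_measurable => [|z]; first exact: countableP.
  apply: measurableX => //.
  rewrite -[X in measurable X]setTI.
  by apply: (continuous_measurable measurableT _ measurableT mY); cont.
move=> [x y] _ /=.
suff h : (q n (r n x), y) @[n --> \oo] --> (x, y).
  exact: (cvg_comp _ _ h (cF (x, y))).
apply: (@cvg_pair _ _ _ _ (nbhs x) (nbhs y)); last exact: cvg_cst.
apply/cvgrPdist_le => e e0.
near=> n.
have n0 : 0 < n.+1%:R :> R by [].
have h1 : q n (r n x) <= x by rewrite ler_pdivrMr// Num.Theory.floor_le.
have h2 : x <= q n (r n x) + n.+1%:R^-1.
  by rewrite -[X in _ + X]mul1r -mulrDl ler_pdivlMr// -(intrD _ _ 1) ltW// floorD1_gt.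
have h3 : n.+1%:R^-1 < e by near: n; exact: (near_infty_natSinv_lt (PosNum e0)).
by rewrite ger0_norm ?subr_ge0// lerBlDl (le_trans h2)// lerD2l ltW.
Unshelve. all: by end_near.
Qed.

(** A bounded kernel times a density in the first variable is dominated by
    [M * `|g x|], hence integrable on the rectangle. *)
Lemma fubini_itv (a b c d : R) G g (M : R) : a <= b -> c <= d ->
  measurable_fun [set: R * R] (fun p => G p.1 p.2) ->
  (forall x y, a <= x <= b -> c <= y <= d -> `|G x y| <= M) -> itgb a b g ->
  [/\ itgb a b (fun x => g x * \int[leb]_(y in `[c, d]) G x y),
      itgb c d (fun y => \int[leb]_(x in `[a, b]) (g x * G x y)) &
      \int[leb]_(x in `[a, b]) (g x * \int[leb]_(y in `[c, d]) G x y) =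
      \int[leb]_(y in `[c, d]) \int[leb]_(x in `[a, b]) (g x * G x y)].
Proof.
move=> ab cd mG GM ig.
have M0 : 0 <= M.
  by apply: le_trans (normr_ge0 _) (GM a c _ _); rewrite lexx.
pose A : set R := [set` `[a, b]]; pose B : set R := [set` `[c, d]].
have mA : measurable A by exact: measurable_itv.
have mB : measurable B by exact: measurable_itv.
have muB : leb B = (d - c)%:E.
  rewrite lebesgue_measure_itv/= lte_fin.
  case: ltP => [//|dc]; have -> : c = d by apply/eqP; rewrite eq_le cd dc.
  by rewrite subrr.
pose k (p : R * R) : R := g p.1 * G p.1 p.2.
pose h (p : R * R) : \bar R := ((EFin \o k) \_ (A `*` B)) p.
have mk : measurable_fun (A `*` B) k.
  apply: measurable_funM; last exact: measurable_funTS.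
  apply: (@measurable_comp _ _ _ _ _ _ A g) => //.
  - by move=> _ [[x y] [/= Ax _] <-].
  - exact: itgb_measurable.
  - by apply: measurable_funTS; exact: measurable_fst.
have mh : measurable_fun setT h.
  apply/(measurable_restrictT _ _).1; first exact: measurableX.
  exact/measurable_EFinP.
have hE x y : h (x, y) = if x \in A then ((fun y => (g x * G x y)%:E) \_ B) y else 0%E.
  rewrite /h !patchE in_setX/=.
  by case: (x \in A); case: (y \in B).
have hE' x y : h (x, y) = if y \in B then ((fun x => (g x * G x y)%:E) \_ A) x else 0%E.
  rewrite /h !patchE in_setX/=.
  by case: (x \in A); case: (y \in B).
have mGx x : measurable_fun setT (G x).
  exact: (measurableT_comp mG (pair1_measurable x)).
have mGy y : measurable_fun setT (G ^~ y).
  exact: (measurableT_comp mG (pair2_measurable y)).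
have inA x : x \in A -> a <= x <= b by move=> /set_mem; rewrite /A /B /= in_itv.
have inB y : y \in B -> c <= y <= d by move=> /set_mem; rewrite /A /B /= in_itv.
have ix x : x \in A -> itgb c d (fun y => G x y).
  move=> xA; apply: measurable_bounded_integrable => //.
  - by rewrite [X in (X < _)%E]muB ltry.
  - by apply: measurable_funTS; exact: mGx.
  - exists M; split; first exact: num_real.
    move=> M' MM' y /= yB; apply: le_trans (ltW MM'); apply: GM; first exact: inA.
    by apply: inB; rewrite inE.
have iy y : y \in B -> itgb a b (fun x => g x * G x y).
  move=> yB.
  suff : leb.-integrable A ((EFin \o g) \* (EFin \o (G ^~ y)))%E by [].
  apply: integrableMl => //; first by apply: measurable_funTS; exact: mGy.
  exists M; split; first exact: num_real.
  move=> M' MM' x /= xA; apply: le_trans (ltW MM'); apply: GM; last exact: inB.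
  by apply: inA; rewrite inE.
have FE x : (\int[leb]_y h (x, y) =
    ((fun x => (g x * \int[leb]_(y in B) G x y)%:E) \_ A) x)%E.
  under eq_integral do rewrite hE.
  rewrite patchE; case: ifPn => xA; last by rewrite integral0.
  have -> : g x * (\int[leb]_(y in B) G x y) = \int[leb]_(y in B) (g x * G x y).
    by rewrite (intgZ _ (ix _ xA)).
  rewrite -integral_mkcond /Rintegral fineK//.
  apply: integrable_fin_num => //; exact: itgbZ (ix _ xA).
have GE y : (\int[leb]_x h (x, y) =
    ((fun y => (\int[leb]_(x in A) (g x * G x y))%:E) \_ B) y)%E.
  under eq_integral do rewrite hE'.
  rewrite patchE; case: ifPn => yB; last by rewrite integral0.
  rewrite -integral_mkcond /Rintegral fineK//.
  apply: integrable_fin_num => //; exact: iy.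
have ih : (leb \x leb)%E.-integrable setT h.
  apply: (iffRL (@integrable12ltyP _ _ _ _ R leb leb h mh)).
  apply: (@le_lt_trans _ _ (\int[leb]_x (((fun x => (`|g x| * M * (d - c))%:E) \_ A) x))%E).
    apply: ge0_le_integral => //.
    - by move=> x _; exact: integral_ge0.
    - have mah : measurable_fun setT (fun p => `|h p|%E) by exact: measurableT_comp.
      exact: (@measurable_fun_fubini_tonelli_F _ _ _ _ R leb _ mah (fun p => abse_ge0 (h p))).
    - apply/(measurable_restrictT _ _).1 => //.
      apply/measurable_EFinP; apply: measurable_funM => //; apply: measurable_funM => //.
      by apply: measurableT_comp => //; exact: itgb_measurable.
    move=> x _; rewrite patchE; case: ifPn => xA; last first.
      rewrite (_ : (fun y => `|h (x, y)|%E) = cst 0%E) ?integral0//.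
      by apply/funext => y; rewrite hE (negbTE xA) abse0.
    rewrite (_ : (fun y => `|h (x, y)|%E) = (fun y => `|(g x * G x y)%:E|%E) \_ B); last first.
      by apply/funext => y; rewrite hE xA !patchE; case: ifPn => //; rewrite abse0.
    rewrite -integral_mkcond EFinM -muB.
    apply: integral_le_bound => //.
    - by apply/measurable_EFinP; apply: measurable_funM => //; apply: measurable_funTS; exact: mGx.
    - by rewrite lee_fin mulr_ge0.
    - apply: aeW => y By; rewrite lee_fin normrM ler_wpM2l//; apply: GM; first exact: inA.
      by apply: inB; rewrite inE.
  rewrite -integral_mkcond.
  apply: integrable_lty => //.
  have : itgb a b (fun x => (M * (d - c)) * `|g x|) by apply: itgbZ; exact: itgb_norm.
  apply: eq_integrable => // x _ /=.
  by rewrite mulrC mulrA.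
have := Fubini ih.
under eq_integral do rewrite FE.
under [X in _ = X -> _]eq_integral do rewrite GE.
rewrite -!integral_mkcond => eFG; split.
- apply: (iffRL (@integrable_mkcond _ _ R leb A (fun x => (g x * \int[leb]_(y in B) G x y)%:E) mA)).
  have := integrable_fubini_F ih; rewrite /fubini_F.
  by apply: eq_integrable => // x _; rewrite FE.
- apply: measurable_bounded_integrable => //.
  + by rewrite [X in (X < _)%E]muB ltry.
  + apply/measurable_EFinP.
    apply: (iffRL (@measurable_restrictT _ _ _ _ B
      (fun y => (\int[leb]_(x in A) (g x * G x y))%:E) mB)).
    have := measurable_fubini_G ih; rewrite /fubini_G.
    by apply: eq_measurable_fun => y _; rewrite GE.
  + exists (\int[leb]_(x in `[a, b]) (M * `|g x|)); split; first exact: num_real.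
    move=> M' MM' y /= yB.
    have yB' : y \in B by rewrite inE.
    apply: le_trans (ltW MM'); apply: le_trans (normr_intg (iy _ yB')) _.
    apply: le_intg; [exact: itgb_norm (iy _ yB')|by apply: itgbZ; exact: itgb_norm|].
    by move=> x xab; rewrite normrM mulrC ler_wpM2r//; apply: GM => //; exact: inB.
- exact: (congr1 fine eFG).
Qed.

End TwoVariables.

(** * The L2 norm on a segment *)
Section SquareIntegrable.
Context {R : realType}.
Implicit Types (u v w f : R -> R) (a b k M : R).

Definition sqi a b v : Prop := square_integrable `[a, b] v.

Definition nrm a b v : R := Num.sqrt (\int[leb]_(x in `[a, b]) v x ^+ 2).

Lemma le_itgb a b f v : measurable_fun `[a, b] f -> itgb a b v ->
  (forall x, a <= x <= b -> `|f x| <= v x) -> itgb a b f.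
Proof.
move=> mf iv fv; apply: le_integrable iv => //; first exact/measurable_EFinP.
move=> x /=; rewrite in_itv/= => hx; rewrite lee_fin (le_trans (fv x hx))//.
exact: ler_norm.
Qed.

Lemma itgb_cst a b k : itgb a b (fun=> k).
Proof. exact: (itgb_continuous _ _ (@cont_cst _ _ k)). Qed.

Lemma sqi_sqr a b v : sqi a b v -> itgb a b (fun x => v x ^+ 2).
Proof. by case. Qed.

Lemma sqiP a b v : measurable_fun `[a, b] v ->
  itgb a b (fun x => v x ^+ 2) -> sqi a b v.
Proof. by []. Qed.

Lemma le_sqi a b f v : measurable_fun `[a, b] f -> sqi a b v ->
  (forall x, a <= x <= b -> `|f x| <= `|v x|) -> sqi a b f.
Proof.
move=> mf sv fv; apply: sqiP => //.
apply: le_itgb (sqi_sqr sv) _ => [|x hx]; first exact: measurable_funX.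
by rewrite normrX -[leRHS]ger0_norm ?sqr_ge0// normrX lerXn2r ?nnegrE// fv.
Qed.

Lemma sqi_itgb a b v : sqi a b v -> itgb a b v.
Proof.
move=> [mv sv]; apply: (@le_itgb _ _ _ (fun x => 1 + v x ^+ 2)) => //.
  by apply: itgbD sv; exact: itgb_cst.
move=> x _; rewrite ler_norml; apply/andP; split; nra.
Qed.

Lemma sqi_mul a b v w : sqi a b v -> sqi a b w -> itgb a b (fun x => v x * w x).
Proof.
move=> [mv sv] [mw sw].
apply: (@le_itgb _ _ _ (fun x => v x ^+ 2 + w x ^+ 2)).
- exact: measurable_funM.
- exact: itgbD.
move=> x _; rewrite ler_norml; apply/andP; split; nra.
Qed.

Lemma sqiZ a b k v : sqi a b v -> sqi a b (fun x => k * v x).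
Proof.
move=> [mv sv]; apply: sqiP; first exact: measurable_funM.
rewrite (_ : (fun x => _) = (fun x => k ^+ 2 * v x ^+ 2)); first exact: itgbZ.
by apply/funext => x; rewrite exprMn.
Qed.

Lemma sqiD a b v w : sqi a b v -> sqi a b w -> sqi a b (fun x => v x + w x).
Proof.
move=> sv sw; apply: sqiP; first by apply: measurable_funD; [case: sv|case: sw].
rewrite (_ : (fun x => _) = (fun x => (v x ^+ 2 + 2 * (v x * w x)) + w x ^+ 2)).
  apply: itgbD (sqi_sqr sw); apply: itgbD (sqi_sqr sv) _.
  by apply: itgbZ; exact: sqi_mul.
by apply/funext => x; ring.
Qed.

Lemma sqiB a b v w : sqi a b v -> sqi a b w -> sqi a b (fun x => v x - w x).
Proof.
move=> sv sw; have := sqiD sv (sqiZ (-1) sw).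
by under eq_fun do rewrite mulN1r.
Qed.

Lemma sqi_continuous a b v : continuous v -> sqi a b v.
Proof.
move=> cv; apply: sqiP; first exact: continuous_measurable.
by apply: itgb_continuous; cont.
Qed.

Lemma sqi_bounded a b v M : measurable_fun `[a, b] v ->
  (forall x, a <= x <= b -> `|v x| <= M) -> sqi a b v.
Proof.
move=> mv vM; apply: le_sqi mv (sqi_continuous a b (@cont_cst _ _ M)) _.
by move=> x hx; rewrite (le_trans (vM x hx))// ler_norm.
Qed.

Lemma sqiM_continuous a b f v : continuous f -> sqi a b v ->
  sqi a b (fun x => f x * v x).
Proof.
move=> cf sv; have [M [M0 hM]] := continuous_bounded_itv a b cf.
apply: le_sqi (sqiZ M sv) _ => [|x hx].
  by apply: measurable_funM; [exact: continuous_measurable|case: sv].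
by rewrite !normrM ler_wpM2r// (le_trans (hM x hx))// ler_norm.
Qed.

Lemma sqi_norm a b v : sqi a b v -> sqi a b (fun x => `|v x|).
Proof.
move=> sv; apply: (le_sqi _ sv) => [|x _]; last by rewrite normr_id.
by case: sv => mv _; exact: measurableT_comp.
Qed.

Lemma sqi_sub a b a' b' v : a <= a' -> b' <= b -> sqi a b v -> sqi a' b' v.
Proof.
move=> aa bb [mv sv]; apply: sqiP; last exact: (itgb_sub aa bb sv).
apply: measurable_funS mv => //.
by apply: subset_itv; rewrite bnd_simp.
Qed.

Lemma nrm_ge0 a b v : 0 <= nrm a b v.
Proof. exact: sqrtr_ge0. Qed.

Lemma nrm_sqr a b v : nrm a b v ^+ 2 = \int[leb]_(x in `[a, b]) v x ^+ 2.
Proof. by rewrite sqr_sqrtr//; apply: intg_ge0 => x _; exact: sqr_ge0. Qed.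

Lemma eq_nrm a b v w : (forall x, a <= x <= b -> v x = w x) ->
  nrm a b v = nrm a b w.
Proof. by move=> vw; congr Num.sqrt; apply: eq_intg => x /vw ->. Qed.

Lemma le_nrm a b v w : sqi a b v -> sqi a b w ->
  (forall x, a <= x <= b -> `|v x| <= `|w x|) -> nrm a b v <= nrm a b w.
Proof.
move=> [_ sv] [_ sw] vw; apply: ler_wsqrtr; apply: le_intg => // x /vw h.
by rewrite -[leLHS]ger0_norm ?sqr_ge0// -[leRHS]ger0_norm ?sqr_ge0// !normrX lerXn2r ?nnegrE.
Qed.

Lemma nrm_abs a b v : nrm a b (fun x => `|v x|) = nrm a b v.
Proof. by congr Num.sqrt; apply: eq_intg => x _; rewrite real_normK ?num_real. Qed.

Lemma nrm_subC a b v w :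
  nrm a b (fun x => v x - w x) = nrm a b (fun x => w x - v x).
Proof. by congr Num.sqrt; apply: eq_intg => x _; rewrite -sqrrN opprB. Qed.

Lemma nrmZ a b k v : sqi a b v -> nrm a b (fun x => k * v x) = `|k| * nrm a b v.
Proof.
move=> [_ sv]; rewrite /nrm -sqrtr_sqr -sqrtrM ?sqr_ge0//; congr Num.sqrt.
by rewrite -intgZ//; apply: eq_intg => x _; rewrite exprMn.
Qed.

(** The discriminant argument: [s |-> nrm a b (s v + w) ^+ 2] is a nonnegative
    polynomial of degree at most two. *)
Lemma cauchy_schwarz a b v w : sqi a b v -> sqi a b w ->
  `|\int[leb]_(x in `[a, b]) (v x * w x)| <= nrm a b v * nrm a b w.
Proof.
move=> sv sw; set C := Rintegral _ _ _.
suff h : C ^+ 2 <= (nrm a b v * nrm a b w) ^+ 2.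
  rewrite -[leRHS]ger0_norm ?mulr_ge0 ?nrm_ge0//.
  by rewrite -(@ler_pXn2r _ 2) ?nnegrE// -!normrX !ger0_norm ?sqr_ge0.
have iv := sqi_sqr sv; have iw := sqi_sqr sw; have ivw := sqi_mul sv sw.
have h0 s : 0 <= nrm a b v ^+ 2 * s ^+ 2 + 2 * C * s + nrm a b w ^+ 2.
  have : 0 <= \int[leb]_(x in `[a, b]) (s * v x + w x) ^+ 2.
    by apply: intg_ge0 => x _; exact: sqr_ge0.
  rewrite (@eq_intg _ _ _ _ (fun x => (s ^+ 2 * v x ^+ 2 + (2 * s) * (v x * w x)) + w x ^+ 2)).
    rewrite intgD//; last by apply: itgbD; exact: itgbZ.
    rewrite intgD; [|exact: itgbZ|exact: itgbZ].
    rewrite !intgZ// -!nrm_sqr -/C => h; apply: le_trans h _.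
    by rewrite le_eqVlt; apply/orP; left; apply/eqP; ring.
  by move=> x _; ring.
rewrite exprMn; set A := nrm a b v ^+ 2 in h0 *; set B := nrm a b w ^+ 2 in h0 *.
have A0 : 0 <= A by exact: sqr_ge0.
have B0 : 0 <= B by exact: sqr_ge0.
have [A00|Apos] := eqVneq A 0.
  rewrite A00 mul0r.
  have [->|C0] := eqVneq C 0; first by rewrite expr0n.
  have := h0 (- (B + 1) / (2 * C)).
  rewrite A00 mul0r add0r.
  have -> : 2 * C * (- (B + 1) / (2 * C)) = - (B + 1) by field.
  lra.
have Agt : 0 < A by rewrite lt0r Apos.
have := h0 (- C / A).
have -> : A * (- C / A) ^+ 2 + 2 * C * (- C / A) + B = (A * B - C ^+ 2) / A by field.
by rewrite pmulr_lge0 ?invr_gt0// subr_ge0.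
Qed.

Lemma nrmD a b v w : sqi a b v -> sqi a b w ->
  nrm a b (fun x => v x + w x) <= nrm a b v + nrm a b w.
Proof.
move=> sv sw.
have iv := sqi_sqr sv; have iw := sqi_sqr sw; have ivw := sqi_mul sv sw.
rewrite -(@ler_pXn2r _ 2) ?nnegrE ?addr_ge0 ?nrm_ge0//.
rewrite nrm_sqr (@eq_intg _ _ _ _ (fun x => (v x ^+ 2 + 2 * (v x * w x)) + w x ^+ 2)); last first.
  by move=> x _; ring.
rewrite intgD ?intgD ?intgZ//; [|exact: itgbZ|by apply: itgbD => //; exact: itgbZ].
rewrite -!nrm_sqr.
have := le_trans (ler_norm _) (cauchy_schwarz sv sw).
set C := Rintegral _ _ _; nra.
Qed.

Lemma nrmB a b v w : sqi a b v -> sqi a b w ->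
  nrm a b v - nrm a b w <= nrm a b (fun x => v x - w x).
Proof.
move=> sv sw; rewrite lerBlDr.
rewrite (@eq_nrm _ _ v (fun x => (v x - w x) + w x)).
  by apply: nrmD => //; exact: sqiB.
by move=> x _; rewrite subrK.
Qed.

Lemma intg_abs_le_nrm v : sqi 0 1 v -> \int[leb]_(x in `[0, 1]) `|v x| <= nrm 0 1 v.
Proof.
move=> sv; have s1 : sqi 0 1 (fun=> 1 : R) by exact: (sqi_continuous _ _ (@cont_cst _ _ _)).
have := le_trans (ler_norm _) (cauchy_schwarz s1 (sqi_norm sv)).
rewrite nrm_abs /nrm (@eq_intg _ _ _ (fun x => 1 * `|v x|) (fun x => `|v x|)); last first.
  by move=> x _; rewrite mul1r.
by rewrite intg_cst// expr1n mul1r subr0 sqrtr1 mul1r.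
Qed.

End SquareIntegrable.

(** * Duality for the L2 norm *)
Section Duality.
Context {R : realType}.
Implicit Types (u v w f : R -> R) (a b k M e B : R).

Lemma approx_continuous_intg a b f e : 0 < e -> itgb a b f ->
  exists g : R -> R, continuous g /\ \int[leb]_(x in `[a, b]) `|f x - g x| <= e.
Proof.
move=> e0 hf.
have fin : (@lebesgue_measure R [set` `[a, b]] < +oo)%E.
  by rewrite lebesgue_measure_itv/=; case: ifP => // _; rewrite -EFinB ltry.
have [g_ [cg ig cvg]] :=
  @approximation_continuous_integrable R `[a, b] f (measurable_itv _) fin hf.
have hfin n : (\int[leb]_(z in `[a, b]) `|(f z - g_ n z)%:E|)%E =
    (\int[leb]_(x in `[a, b]) `|f x - g_ n x|)%:E.
  rewrite /Rintegral fineK//.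
  apply: integrable_fin_num => //.
  have : itgb a b (fun x => `|f x - g_ n x|).
    by apply: itgb_norm; apply: itgbB => //; exact: ig.
  by [].
move: cvg; under eq_fun do rewrite hfin.
move=> /fine_cvgP[_ /cvgrPdist_le/(_ _ e0)] [N _ /(_ N (leqnn N))] /=.
rewrite sub0r normrN ger0_norm => [h|]; last exact: intg_ge0.
by exists (g_ N).
Qed.

(** Approximation in [L^2] of a bounded function supported away from the end
    points: truncate an [L^1] approximation and cut it off near the end points;
    on bounded functions small in [L^1] means small in [L^2]. *)
Lemma approx_continuous_nrm a b d v M e : 0 < d -> 0 <= M -> 0 < e ->
  measurable_fun `[a, b] v -> (forall x, `|v x| <= M) ->
  (forall x, x < a + d \/ b - d < x -> v x = 0) ->
  exists psi : R -> R, [/\ continuous psi,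
    forall x, x <= a \/ b <= x -> psi x = 0 &
    nrm a b (fun x => v x - psi x) <= e].
Proof.
move=> d0 M0 e0 mv vM vsupp.
have sv : sqi a b v by apply: (sqi_bounded mv (M := M)).
have e1 : 0 < e ^+ 2 / (2 * M + 1) by rewrite divr_gt0 ?exprn_gt0//; lra.
have [g [cg hg]] := approx_continuous_intg e1 (sqi_itgb sv).
pose g' x := Num.max (- M) (Num.min M (g x)).
pose eta x := Num.max 0 (Num.min 1 (Num.min ((x - a) / d) ((b - x) / d))).
have cM : continuous (fun _ : R => M) by exact: cont_cst.
have cg' : continuous g' by rewrite /g'; cont.
have ceta : continuous eta by rewrite /eta; cont.
pose psi x := eta x * g' x.
have cpsi : continuous psi by rewrite /psi; cont.
have eta0 x : 0 <= eta x by rewrite /eta le_max lexx.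
have eta1 x : eta x <= 1 by rewrite /eta ge_max ler01 ge_min lexx.
have g'M x : `|g' x| <= M.
  rewrite ler_norml /g' le_max lexx/= ge_max ge_min lexx/= andbT; lra.
have close x : `|v x - psi x| <= `|v x - g x|.
  have h1 : `|v x - g' x| <= `|v x - g x|.
    have := vM x; rewrite ler_norml => /andP[h1 h2].
    rewrite /g'; have [h|h] := leP M (g x).
      rewrite max_r; last lra.
      by rewrite ler0_norm ?ler0_norm; lra.
    have [h'|h'] := leP (- M) (g x); first by [].
    by rewrite !ger0_norm; lra.
  have -> : v x - psi x = eta x * (v x - g' x).
    rewrite /psi mulrBr; congr (_ - _).
    have [hx|hx] := ltP x (a + d); first by rewrite vsupp ?mulr0//; left.
    have [hx'|hx'] := ltP (b - d) x; first by rewrite vsupp ?mulr0//; right.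
    rewrite /eta (min_l (x := 1)) ?max_r ?ler01 ?mul1r//.
    by rewrite le_min !ler_pdivlMr// !mul1r; lra.
  by rewrite normrM ger0_norm// (le_trans _ h1)// ler_piMl.
exists psi; split => //.
  move=> x hx; rewrite /psi /eta max_l ?mul0r// ge_min; apply/orP; right.
  rewrite ge_min !ler_pdivrMr// !mul0r.
  by apply/orP; case: hx => hx; [left|right]; lra.
have spsi : sqi a b psi by exact: sqi_continuous.
have sd := sqiB sv spsi.
rewrite -(@ler_pXn2r _ 2) ?nnegrE ?nrm_ge0 ?(ltW e0)// nrm_sqr.
apply: (@le_trans _ _ (\int[leb]_(x in `[a, b]) (2 * M * `|v x - g x|))).
  have ivg : itgb a b (fun x => `|v x - g x|).
    by apply: itgb_norm; apply: itgbB; [exact: sqi_itgb|exact: itgb_continuous].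
  apply: le_intg; [exact: sqi_sqr sd|exact: itgbZ|].
  move=> x _; rewrite -real_normK ?num_real// expr2 ler_pM//.
  apply: le_trans (ler_normB _ _) _.
  suff : `|psi x| <= M by have := vM x; lra.
  by rewrite /psi normrM ger0_norm// -[leRHS]mul1r ler_pM.
have ivg : itgb a b (fun x => `|v x - g x|).
  by apply: itgb_norm; apply: itgbB; [exact: sqi_itgb|exact: itgb_continuous].
rewrite intgZ//.
apply: (@le_trans _ _ (2 * M * (e ^+ 2 / (2 * M + 1)))).
  by apply: ler_wpM2l => //; lra.
rewrite mulrA ler_pdivrMr; last lra.
by rewrite mulrC ler_wpM2l ?sqr_ge0//; lra.
Qed.

(** The converse of the Cauchy-Schwarz inequality.  Let [chi n] be [u] where it
    is bounded by [n + 1] and away from the end points, and zero elsewhere.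
    Testing with continuous approximations of [chi n] bounds its norm by [B],
    and dominated convergence gives [u].  That the test functions vanish outside
    [(a, b)] is what removes the boundary terms when [u] is a state of a
    transport equation. *)
Lemma duality a b u B : sqi a b u -> 0 <= B ->
  (forall psi : R -> R, continuous psi ->
    (forall x, x <= a \/ b <= x -> psi x = 0) ->
    `|\int[leb]_(x in `[a, b]) (psi x * u x)| <= B * nrm a b psi) ->
  nrm a b u <= B.
Proof.
move=> su B0 H.
pose good n x := (`|u x| <= n.+1%:R) && (a + n.+1%:R^-1 <= x <= b - n.+1%:R^-1).
pose chi n x := if (x \in `[a, b]) && good n x then u x else 0.
have mu : measurable_fun `[a, b] u by case: su.
have mchi n : measurable_fun `[a, b] (chi n).
  pose D : set R := [set` `[a + n.+1%:R^-1, b - n.+1%:R^-1]] `&`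
    ([set` `[a, b]] `&` (fun x => `|u x|) @^-1` [set` `]-oo, n.+1%:R]]).
  have mD : measurable D.
    apply: measurableI; first exact: measurable_itv.
    have mnu : measurable_fun `[a, b] (fun x => `|u x|) by exact: measurableT_comp.
    exact: (mnu (measurable_itv _) _ (measurable_itv _)).
  rewrite (_ : chi n = u \_ D).
    apply: (iffLR (@measurable_restrict _ _ _ _ D [set` `[a, b]] u mD (measurable_itv _))).
    by apply: measurable_funS mu => // x [] .
  apply/funext => x; rewrite patchE /chi /good.
  have -> : (x \in D) = ((x \in `[a, b]) && ((`|u x| <= n.+1%:R) &&
      (a + n.+1%:R^-1 <= x <= b - n.+1%:R^-1))).
    rewrite in_itv/=; apply/idP/idP => [/set_mem []|/andP[h1 /andP[h2 h3]]].
      by rewrite /= !in_itv/= => -> [-> ->].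
    by apply/mem_set; split; [|split]; rewrite /= in_itv.
  by case: ifP.
have chi_le n x : a <= x <= b -> `|chi n x| <= `|u x|.
  by rewrite /chi; case: ifP => // _ _; rewrite normr0.
have schi n : sqi a b (chi n) by exact: le_sqi (mchi n) su (chi_le n).
(* [nrm (chi n) ^+ 2] is the integral of [chi n * u]. *)
have step n : nrm a b (chi n) <= B.
  have e_ineq e : 0 < e -> nrm a b (chi n) ^+ 2 <= B * nrm a b (chi n) + e * (B + nrm a b u).
    move=> e0.
    have n0 : 0 < n.+1%:R^-1 :> R by rewrite invr_gt0.
    have [||psi [cpsi psi0 hpsi]] := approx_continuous_nrm n0 (ler0n R n.+1) e0 (mchi n).
    - by move=> x; rewrite /chi; case: ifP => [/andP[_ /andP[]]//|_]; rewrite normr0.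
    - move=> x hx; rewrite /chi; case: ifP => // /andP[_ /andP[_ /andP[h1 h2]]].
      by exfalso; set t := n.+1%:R^-1 in h1 h2 hx; case: hx; rewrite ltNge ?h1 ?h2.
    have spsi : sqi a b psi by exact: sqi_continuous.
    have sd := sqiB (schi n) spsi.
    rewrite nrm_sqr (@eq_intg _ _ _ _ (fun x => psi x * u x + (chi n x - psi x) * u x)); last first.
      move=> x _; rewrite -mulrDl addrC subrK /chi; case: ifP => _; first by rewrite expr2.
      by rewrite expr0n mul0r.
    rewrite intgD; [|exact: sqi_mul|exact: sqi_mul].
    have h1 := le_trans (ler_norm _) (H psi cpsi psi0).
    have h2 := le_trans (ler_norm _) (cauchy_schwarz sd su).
    have h3 : nrm a b psi <= nrm a b (chi n) + e.
      have := nrmB spsi (schi n).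
      rewrite nrm_subC; lra.
    have h4 := ler_wpM2l B0 h3.
    have h5 := ler_wpM2r (nrm_ge0 a b u) hpsi.
    lra.
  have [->|c0] := eqVneq (nrm a b (chi n)) 0; first by [].
  have cgt : 0 < nrm a b (chi n) by rewrite lt0r c0 nrm_ge0.
  rewrite -(ler_pM2r cgt) -expr2.
  apply/ler_addgt0Pr => e e0.
  have S0 : 0 < B + nrm a b u + 1 by rewrite ltr_pwDr// addr_ge0// nrm_ge0.
  have := e_ineq (e / (B + nrm a b u + 1)); rewrite divr_gt0// => /(_ isT) h.
  apply: le_trans h _; rewrite lerD2l mulrAC ler_pdivrMr//.
  by rewrite ler_wpM2l ?ltW// ltrDl.
rewrite -(@ler_pXn2r _ 2) ?nnegrE ?nrm_ge0// nrm_sqr.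
pose D : set R := [set` `]a, b[].
have mD : measurable D by exact: measurable_itv.
have Dsub : D `<=` [set` `[a, b]] by apply: subset_itv; rewrite bnd_simp.
have iu : leb.-integrable D (EFin \o (fun x => u x ^+ 2)).
  by apply: integrableS (sqi_sqr su).
have ichi n : leb.-integrable D (EFin \o (fun x => chi n x ^+ 2)).
  by apply: integrableS (sqi_sqr (schi n)).
have cv : {ae leb, forall x, D x ->
    (chi n x ^+ 2)%:E @[n --> \oo] --> (u x ^+ 2)%:E}.
  apply: aeW => x; rewrite /D /= in_itv/= => /andP[ax xb].
  apply: cvg_near_cst; near=> n.
  rewrite /chi in_itv/= (ltW ax) (ltW xb) /good.
  have -> : a + n.+1%:R^-1 <= x.
    rewrite -lerBrDl ltW//; near: n.
    by have xa : 0 < x - a by [rewrite subr_gt0]; exact: (near_infty_natSinv_lt (PosNum xa)).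
  have -> : x <= b - n.+1%:R^-1.
    rewrite lerBrDl -lerBrDr ltW//; near: n.
    by have xa : 0 < b - x by [rewrite subr_gt0]; exact: (near_infty_natSinv_lt (PosNum xa)).
  have -> // : `|u x| <= n.+1%:R.
  near: n; exists (Num.bound `|u x|) => // n /= hn.
  apply: le_trans (ltW (archi_boundP (normr_ge0 _))) _.
  by rewrite ler_nat; exact: leqW.
have dom : {ae leb, forall x n, D x -> (`|(chi n x ^+ 2)%:E| <= (u x ^+ 2)%:E)%E}.
  apply: aeW => x n Dx; rewrite lee_fin normrX -[leRHS]ger0_norm ?sqr_ge0//.
  rewrite normrX lerXn2r ?nnegrE//; apply: chi_le.
  by have := Dsub _ Dx; rewrite /= in_itv.
have [_ _ cvi] := @dominated_convergence _ _ R leb D mD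
  (fun n x => (chi n x ^+ 2)%:E) (fun x => (u x ^+ 2)%:E) (fun x => (u x ^+ 2)%:E)
  (fun n => measurable_int _ (ichi n)) (measurable_int _ iu) cv iu dom.
rewrite -Rintegral_itv_bndo_bndc; last first.
  by apply: integrableS (sqi_sqr su) => //; apply: subset_itv; rewrite bnd_simp.
rewrite -Rintegral_itv_obnd_cbnd//.
have {}cvi : \int[leb]_(x in D) (chi n x ^+ 2) @[n --> \oo] -->
    \int[leb]_(x in D) (u x ^+ 2).
  apply: fine_cvg; rewrite /Rintegral fineK//.
  exact: integrable_fin_num.
apply: (cvgr_to_le cvi); apply: nearW => n /=.
apply: (@le_trans _ _ (nrm a b (chi n) ^+ 2)); last first.
  by rewrite lerXn2r ?nnegrE ?nrm_ge0.
rewrite nrm_sqr -[leRHS]Rintegral_itv_bndo_bndc; last first.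
  by apply: integrableS (sqi_sqr (schi n)) => //; apply: subset_itv; rewrite bnd_simp.
by rewrite -Rintegral_itv_obnd_cbnd//; exact: ichi.
Unshelve. all: by end_near.
Qed.

End Duality.

(** * Fubini on regions, and smooth approximation *)
Section Regions.
Context {R : realType}.
Implicit Types (K : R -> R -> R) (f v : R -> R) (P : R -> R -> bool).

Lemma continuous2_bounded K (a b c d : R) :
  continuous (fun p : R * R => K p.1 p.2) ->
  exists M : R, forall x y, a <= x <= b -> c <= y <= d -> `|K x y| <= M.
Proof.
move=> cK.
have cpt : compact (`[a, b] `*` `[c, d] : set (R * R)).
  by apply: compact_setX; exact: segment_compact.
have /compact_bounded[M [_ hM]] :=
  continuous_compact (continuous_subspaceT cK) cpt.
exists (`|M| + 1) => x y hx hy.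
apply: (hM (`|M| + 1)); first by rewrite (le_lt_trans (ler_norm _))// ltrDl.
by exists (x, y) => //=; rewrite !in_itv.
Qed.

Lemma intg_if (a b c d : R) f : a <= c -> d <= b ->
  \int[leb]_(x in `[a, b]) (if c <= x <= d then f x else 0) =
  \int[leb]_(x in `[c, d]) f x.
Proof.
move=> ac db.
have -> : [set` `[c, d]] = [set` `[a, b]] `&` [set` `[c, d]] :> set R.
  rewrite setIidr//; first by apply: subset_itv; rewrite bnd_simp.
rewrite Rintegral_mkcondr; apply: eq_intg => x _; rewrite patchE.
by rewrite mem_setE in_itv.
Qed.

Lemma fubini_region K P v (a b c d : R) : a <= b -> c <= d ->
  continuous (fun p : R * R => K p.1 p.2) ->
  measurable_fun [set: R * R] (fun p => P p.1 p.2) -> itgb a b v ->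
  [/\ itgb a b (fun x => v x * \int[leb]_(y in `[c, d]) if P x y then K x y else 0),
      itgb c d (fun y => \int[leb]_(x in `[a, b]) if P x y then v x * K x y else 0) &
      \int[leb]_(x in `[a, b]) (v x * \int[leb]_(y in `[c, d]) if P x y then K x y else 0) =
      \int[leb]_(y in `[c, d]) \int[leb]_(x in `[a, b]) if P x y then v x * K x y else 0].
Proof.
move=> ab cd cK mP iv.
have [M hM] := continuous2_bounded a b c d cK.
have mG : measurable_fun [set: R * R] (fun p => if P p.1 p.2 then K p.1 p.2 else 0).
  by apply: measurable_fun_ifT => //; exact: continuous2_measurable.
have GM x y : a <= x <= b -> c <= y <= d -> `|if P x y then K x y else 0| <= M.
  move=> hx hy; have := hM x y hx hy; case: ifP => // _ h.
  by rewrite normr0 (le_trans _ h).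
have := @fubini_itv R a b c d (fun x y => if P x y then K x y else 0) v M ab cd mG GM iv.
have E y : \int[leb]_(x in `[a, b]) (v x * if P x y then K x y else 0) =
           \int[leb]_(x in `[a, b]) if P x y then v x * K x y else 0.
  by apply: eq_intg => x _; case: ifP => //; rewrite mulr0.
move=> [h1 h2 h3]; split => //.
  by apply: eq_itgb h2 => y _; exact: E.
by rewrite h3; apply: eq_intg => y _; exact: E.
Qed.

Lemma measurable_le2 (f g : R * R -> R) : continuous f -> continuous g ->
  measurable_fun [set: R * R] (fun p => f p <= g p).
Proof.
move=> cf cg.
have H (h : R * R -> R) : continuous h -> measurable_fun [set: R * R] h.
  move=> ch; rewrite (_ : h = fun p => h (p.1, p.2)); last by apply/funext => -[].
  by apply: (@continuous2_measurable R (fun x y => h (x, y))); cont.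
by apply: measurable_fun_ler; exact: H.
Qed.

Lemma fubini_triangle K v (a b : R) : a <= b ->
  continuous (fun p : R * R => K p.1 p.2) -> itgb a b v ->
  [/\ itgb a b (fun x => v x * \int[leb]_(y in `[a, x]) K x y),
      itgb a b (fun y => \int[leb]_(x in `[y, b]) (v x * K x y)) &
      \int[leb]_(x in `[a, b]) (v x * \int[leb]_(y in `[a, x]) K x y) =
      \int[leb]_(y in `[a, b]) \int[leb]_(x in `[y, b]) (v x * K x y)].
Proof.
move=> ab cK iv.
have mP : measurable_fun [set: R * R] (fun p => p.2 <= p.1).
  by apply: measurable_le2; cont.
have [h1 h2 h3] := fubini_region (P := fun x y => y <= x) ab ab cK mP iv.
have E1 x : a <= x <= b -> \int[leb]_(y in `[a, b]) (if y <= x then K x y else 0) =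
    \int[leb]_(y in `[a, x]) K x y.
  move=> /andP[ax xb]; rewrite -(@intg_if a b a x)//.
  by apply: eq_intg => y /andP[-> _].
have E2 y : a <= y <= b -> \int[leb]_(x in `[a, b]) (if y <= x then v x * K x y else 0) =
    \int[leb]_(x in `[y, b]) (v x * K x y).
  move=> /andP[ay yb]; rewrite -(@intg_if a b y b)//.
  by apply: eq_intg => x /andP[_ ->]; rewrite andbT.
split.
- by apply: eq_itgb h1 => x hx; rewrite E1.
- by apply: eq_itgb h2 => y hy; rewrite E2.
- rewrite (@eq_intg _ _ _ _ (fun x => v x * \int[leb]_(y in `[a, b]) if y <= x then K x y else 0)).
    by rewrite h3; apply: eq_intg => y hy; rewrite E2.
  by move=> x hx; rewrite E1.
Qed.
End Regions.

Section C1Approx.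
Context {R : realType}.

(** Difference quotients of a primitive are [C^1] and converge locally
    uniformly. *)
Lemma approx_C1 (psi : R -> R) (L e : R) : continuous psi -> 0 < e ->
  exists psi1 dpsi1 : R -> R, [/\ continuous dpsi1,
    forall x : R, is_derive x 1 psi1 (dpsi1 x) &
    forall x, - L <= x <= L -> `|psi1 x - psi x| <= e].
Proof.
move=> cpsi e0; have [F dF] := continuous_primitive cpsi.
have cs : continuous (fun p : R * R => psi (p.2 + p.1)) by cont.
have := @near_uniform_itv R R (fun h s => psi (s + h)) (- L) L 0 e cs e0.
move=> /nbhs_ballP[d /= d0 hd].
pose h := d / 2.
have h0 : 0 < h by rewrite divr_gt0.
exists (fun x => h^-1 * (F (h + 1 * x) - F x)), (fun x => h^-1 * (1 * psi (h + 1 * x) - psi x)).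
split.
- by cont.
- move=> x; apply: is_deriveZ.
  by apply: is_deriveB; exact: (is_derive_affine h 1 dF).
- move=> x hx.
  have xh : x < x + h by rewrite ltrDl.
  have cF : {within `[x, x + h], continuous F}.
    apply: continuous_subspaceT => y; apply: differentiable_continuous.
    by apply/derivable1_diffP; have := dF y; case.
  have [y] := MVT xh (fun y _ => dF y) cF.
  rewrite in_itv/= => /andP[xy yxh].
  rewrite mul1r [h + x]addrC => ->; rewrite addrAC subrr add0r mulrC mulfK ?gt_eqF//.
  have := hd (y - x) _ x hx; rewrite addr0 subrKC; apply.
  rewrite /ball/= sub0r normrN ger0_norm ?subr_ge0 ?ltW//.
  rewrite ltrBlDl (lt_trans yxh)// ltrD2l /h ltr_pdivrMr//; lra.
Qed.
End C1Approx.

(** * Transport tested along characteristics *)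
Section Transport.
Context {R : realType}.
Implicit Types (u f : R -> R -> R) (v psi : R -> R) (c T t x : R).

Lemma continuous_in_L2_sqi f t : continuous_in_L2 f -> 0 <= t -> sqi 0 1 (f t).
Proof. by move=> [h _] t0; exact: h. Qed.

Lemma near_continuous_in_L2 f t0 (e : R) : continuous_in_L2 f -> 0 <= t0 -> 0 < e ->
  \forall t \near t0, 0 <= t -> nrm 0 1 (fun x => f t x - f t0 x) <= e.
Proof.
move=> [_ cf] t00 e0; have /cvgrPdist_le/(_ _ e0) := cf _ t00.
rewrite near_withinE; apply: filterS => t h t0'.
have := h t0'; rewrite sub0r normrN; apply: le_trans; exact: ler_norm.
Qed.

Lemma continuous_intg_L2 (S : topologicalType) (g : S -> R -> R) f (tau : S -> R) :
  continuous_in_L2 f -> continuous (fun p : S * R => g p.1 p.2) ->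
  continuous tau -> (forall p, 0 <= tau p) ->
  continuous (fun p => \int[leb]_(x in `[0, 1]) (g p x * f (tau p) x)).
Proof.
move=> cf cg ctau tau0; apply: (@continuous_intgM _ _ g (fun p => f (tau p))) => //.
  by move=> p; apply: sqi_itgb; exact: continuous_in_L2_sqi.
move=> p0; apply/cvgrPdist_le => e e0.
have : \forall p \near p0, 0 <= tau p ->
    nrm 0 1 (fun x => f (tau p) x - f (tau p0) x) <= e.
  exact: (ctau p0 _ (near_continuous_in_L2 cf (tau0 p0) e0)).
apply: filterS => p /(_ (tau0 p)) h.
rewrite sub0r normrN ger0_norm; last exact: intg_ge0.
apply: le_trans h; apply: intg_abs_le_nrm.
by apply: sqiB; exact: continuous_in_L2_sqi.
Qed.

Lemma continuous_in_L2D f g : continuous_in_L2 f -> continuous_in_L2 g ->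
  continuous_in_L2 (fun t x => f t x + g t x).
Proof.
move=> cf cg; split=> [t t0|t0 t00].
  by apply: sqiD; exact: continuous_in_L2_sqi.
apply/cvgrPdist_le => e e0; have e2 : 0 < e / 2 by rewrite divr_gt0.
rewrite near_withinE; near=> t => t0'.
rewrite sub0r normrN ger0_norm ?sqrtr_ge0//.
have -> : L2norm (fun x => f t x + g t x - (f t0 x + g t0 x)) =
    nrm 0 1 (fun x => (f t x - f t0 x) + (g t x - g t0 x)).
  by apply: eq_nrm => x _; ring.
apply: le_trans (nrmD _ _) _; try by apply: sqiB; exact: continuous_in_L2_sqi.
rewrite [leRHS](splitr e) lerD//.
  by move: t0'; near: t; exact: near_continuous_in_L2.
by move: t0'; near: t; exact: near_continuous_in_L2.
Unshelve. all: by end_near.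
Qed.

Lemma continuous_in_L2M f (a : R -> R) : continuous a -> continuous_in_L2 f ->
  continuous_in_L2 (fun t x => a x * f t x).
Proof.
move=> ca cf; have [M [M0 hM]] := continuous_bounded_itv 0 1 ca.
split=> [t t0|t0 t00].
  by apply: sqiM_continuous => //; exact: continuous_in_L2_sqi.
apply/cvgrPdist_le => e e0; have e2 : 0 < e / (M + 1).
  by rewrite divr_gt0//; lra.
rewrite near_withinE; near=> t => t0'.
have sd : sqi 0 1 (fun x => f t x - f t0 x) by apply: sqiB; exact: continuous_in_L2_sqi.
rewrite sub0r normrN ger0_norm ?sqrtr_ge0//.
have -> : L2norm (fun x => a x * f t x - a x * f t0 x) =
    nrm 0 1 (fun x => a x * (f t x - f t0 x)).
  by apply: eq_nrm => x _; ring.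
apply: (@le_trans _ _ (nrm 0 1 (fun x => M * (f t x - f t0 x)))).
  apply: le_nrm; [exact: sqiM_continuous|exact: sqiZ|].
  by move=> x hx; rewrite !normrM ler_wpM2r// (le_trans (hM x hx))// ler_norm.
rewrite nrmZ// ger0_norm//.
apply: (@le_trans _ _ (M * (e / (M + 1)))).
  apply: ler_wpM2l => //.
  by move: t0'; near: t; exact: near_continuous_in_L2.
rewrite mulrA ler_pdivrMr; last lra.
by rewrite mulrC ler_wpM2l// ?ltW//; lra.
Unshelve. all: by end_near.
Qed.

Lemma continuous_in_L2_norm f : continuous_in_L2 f ->
  continuous_in_L2 (fun t x => `|f t x|).
Proof.
move=> cf; split=> [t t0|t0 t00].
  by apply: sqi_norm; exact: continuous_in_L2_sqi.
apply/cvgrPdist_le => e e0; rewrite near_withinE.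
apply: filterS (near_continuous_in_L2 cf t00 e0) => t h t0'.
rewrite sub0r normrN ger0_norm ?sqrtr_ge0//; apply: le_trans (h t0').
have st := continuous_in_L2_sqi cf t0'; have st0 := continuous_in_L2_sqi cf t00.
apply: le_nrm; [by apply: sqiB; exact: sqi_norm|exact: sqiB|].
by move=> x _; exact: ler_dist_dist.
Qed.

Lemma normr_intgM_le (a b e : R) (g w : R -> R) : itgb a b w -> continuous g ->
  (forall x, a <= x <= b -> `|g x| <= e) ->
  `|\int[leb]_(x in `[a, b]) (g x * w x)| <= e * \int[leb]_(x in `[a, b]) `|w x|.
Proof.
move=> iw cg hg; have igw := itgbM_continuous cg iw.
rewrite -intgZ; last exact: itgb_norm.
apply: le_trans (normr_intg igw) _.
apply: le_intg; [exact: itgb_norm|by apply: itgbZ; exact: itgb_norm|].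
by move=> x hx; rewrite normrM ler_wpM2r//; exact: hg.
Qed.

Section TestFunctions.
Variables (c : R) (u f : R -> R -> R) (v0 v1 : R -> R).
Hypotheses (sol : weak_transport c u f v0 v1) (cf : continuous_in_L2 f).

Let cu : continuous_in_L2 u. Proof. by case: sol. Qed.
Let iv0 T : itgb 0 T v0.
Proof.
have [T0|T0] := ltP 0 T; first by apply: sqi_itgb; case: sol => _ + _ _; apply.
apply: itgb_sub (lexx _) (le_trans T0 ler01) _.
by apply: sqi_itgb; case: sol => _ + _ _; apply.
Qed.
Let iv1 T : itgb 0 T v1.
Proof.
have [T0|T0] := ltP 0 T; first by apply: sqi_itgb; case: sol => _ _ + _; apply.
apply: itgb_sub (lexx _) (le_trans T0 ler01) _.
by apply: sqi_itgb; case: sol => _ _ + _; apply.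
Qed.

(** The terms of the weak formulation for the test function [psi (x - c t)],
    which the transport operator annihilates. *)
Definition mom psi t := \int[leb]_(x in `[0, 1]) (psi (x - c * t) * u t x).
Definition src psi t := \int[leb]_(x in `[0, 1]) (psi (x - c * t) * f t x).
Definition bdr psi t := psi (1 - c * t) * v1 t - psi (0 - c * t) * v0 t.

Lemma continuous_src psi : continuous psi ->
  continuous (fun t => src psi (Num.max t 0)).
Proof.
move=> cpsi; apply: (@continuous_intg_L2 _ (fun t x => psi (x - c * Num.max t 0))) => //.
- by cont.
- by cont.
- by move=> t; rewrite le_max lexx orbT.
Qed.

Lemma itgb_src psi T : continuous psi -> itgb 0 T (src psi).
Proof.
move=> cpsi; apply: eq_itgb (itgb_continuous 0 T (continuous_src cpsi)).
by move=> t /andP[t0 _]; rewrite max_l.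
Qed.

Lemma itgb_bdr psi T : continuous psi -> itgb 0 T (bdr psi).
Proof.
move=> cpsi; apply: itgbB.
  by apply: itgbM_continuous => //; cont.
by apply: itgbM_continuous => //; cont.
Qed.

Lemma transport_test_C1 psi dpsi T : 0 < T -> continuous dpsi ->
  (forall x : R, is_derive x 1 psi (dpsi x)) ->
  mom psi T - mom psi 0 =
  \int[leb]_(t in `[0, T]) src psi t - c * \int[leb]_(t in `[0, T]) bdr psi t.
Proof.
move=> T0 cd dd.
have cpsi : continuous psi.
  move=> x; apply: differentiable_continuous.
  by apply/derivable1_diffP; have := dd x; case.
pose phi t x := psi (x - c * t).
have dt_phi t x : is_derive t 1 (fun s => phi s x) (- c * dpsi (x - c * t)).
  have := is_derive_affine x (- c) dd t.
  by under eq_fun do rewrite mulNr; rewrite [- c * t]mulNr.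
have dx_phi t x : is_derive x 1 (phi t) (dpsi (x - c * t)).
  have := is_derive_affine (- (c * t)) 1 dd x.
  under eq_fun do rewrite mul1r addrC.
  by rewrite !mul1r addrC.
have dtE t x : dt phi t x = - c * dpsi (x - c * t).
  by rewrite /dt derive1E; have := dt_phi t x => ?; exact: derive_val.
have dxE t x : dx phi t x = dpsi (x - c * t).
  by rewrite /dx derive1E; have := dx_phi t x => ?; exact: derive_val.
have C1phi : C1 phi.
  split.
  - by move=> t x; have := dt_phi t x; case.
  - by move=> t x; have := dx_phi t x; case.
  - have -> : (fun p : R * R => dt phi p.1 p.2) = (fun p => - c * dpsi (p.2 - c * p.1)).
      by apply/funext => p; rewrite dtE.
    by cont.
  - have -> : (fun p : R * R => dx phi p.1 p.2) = (fun p => dpsi (p.2 - c * p.1)).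
      by apply/funext => p; rewrite dxE.
    by cont.
case: sol => _ _ _ /(_ phi C1phi T T0) => h.
apply: (eq_trans h).
apply: (congr1 (fun z : R => z - c * \int[leb]_(t in `[0, T]) bdr psi t)).
apply: eq_intg => t _; apply: eq_intg => x _.
by rewrite dtE dxE mulNr addNr mul0r add0r.
Qed.

(** Both sides depend continuously on [psi] for the uniform convergence on the
    bounded set of values of [x - c * t], so [C^1] functions are enough. *)
Lemma transport_test psi T : 0 <= T -> continuous psi ->
  mom psi T - mom psi 0 =
  \int[leb]_(t in `[0, T]) src psi t - c * \int[leb]_(t in `[0, T]) bdr psi t.
Proof.
rewrite le_eqVlt => /predU1P[<- _|T0 cpsi].
  by rewrite !intg_point mulr0 !subrr.
pose Lam psi := mom psi T - mom psi 0 -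
  (\int[leb]_(t in `[0, T]) src psi t - c * \int[leb]_(t in `[0, T]) bdr psi t).
suff : Lam psi = 0 by move/eqP; rewrite subr_eq0 => /eqP.
have T0' := ltW T0.
have Tnn : 0 <= T by [].
have iu t : 0 <= t -> itgb 0 1 (u t).
  by move=> t0; apply: sqi_itgb; exact: continuous_in_L2_sqi.
have if' t : 0 <= t -> itgb 0 1 (f t).
  by move=> t0; apply: sqi_itgb; exact: continuous_in_L2_sqi.
pose L := 1 + `|c| * T.
pose nf t := \int[leb]_(x in `[0, 1]) `|f t x|.
have inf : itgb 0 T nf.
  have cn : continuous (fun t => \int[leb]_(x in `[0, 1]) (1 * `|f (Num.max t 0) x|)).
    apply: (@continuous_intg_L2 R (fun _ _ => 1) (fun t x => `|f t x|) (fun t => Num.max t 0)).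
    - exact: continuous_in_L2_norm.
    - by cont.
    - by cont.
    - by move=> t; rewrite le_max lexx orbT.
  apply: eq_itgb (itgb_continuous 0 T cn) => t /andP[t0 _].
  by rewrite max_l//; apply: eq_intg => x _; rewrite mul1r.
pose C := \int[leb]_(x in `[0, 1]) `|u T x| + \int[leb]_(x in `[0, 1]) `|u 0 x|
  + \int[leb]_(t in `[0, T]) nf t
  + `|c| * \int[leb]_(t in `[0, T]) (`|v1 t| + `|v0 t|).
have C0 : 0 <= C.
  rewrite !addr_ge0//; try by apply: intg_ge0.
    by apply: intg_ge0 => t _; exact: intg_ge0.
  by apply: mulr_ge0 => //; apply: intg_ge0 => t _; rewrite addr_ge0.
have rng t x : 0 <= t <= T -> 0 <= x <= 1 -> - L <= x - c * t <= L.
  move=> /andP[t0 tT] /andP[x0 x1].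
  have : `|c * t| <= `|c| * T by rewrite normrM (ger0_norm t0) ler_wpM2l.
  by rewrite ler_norml /L => /andP[h1 h2]; lra.
(* [C] is the norm of [Lam] as a functional of the test function. *)
have small d e : continuous d -> (forall x, - L <= x <= L -> `|d x| <= e) ->
    `|Lam d| <= e * C.
  move=> cd hd.
  have hm t : 0 <= t <= T -> `|mom d t| <= e * \int[leb]_(x in `[0, 1]) `|u t x|.
    move=> ht; apply: normr_intgM_le; [by apply: iu; case/andP: ht|by cont|].
    by move=> x hx; apply: hd; exact: rng.
  have hs t : 0 <= t <= T -> `|src d t| <= e * nf t.
    move=> ht; apply: normr_intgM_le; [by apply: if'; case/andP: ht|by cont|].
    by move=> x hx; apply: hd; exact: rng.
  have hb t : 0 <= t <= T -> `|bdr d t| <= e * (`|v1 t| + `|v0 t|).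
    move=> ht; rewrite (le_trans (ler_normB _ _))// !normrM mulrDr lerD// ler_wpM2r//.
      by apply/hd/rng => //; rewrite lexx ler01.
    by apply/hd/rng => //; rewrite lexx ler01.
  have is' := itgb_src T cd; have ib := itgb_bdr T cd.
  have h3 : `|\int[leb]_(t in `[0, T]) src d t| <= e * \int[leb]_(t in `[0, T]) nf t.
    rewrite -intgZ// (le_trans (normr_intg is'))//.
    by apply: le_intg; [exact: itgb_norm|exact: itgbZ|exact: hs].
  have iv : itgb 0 T (fun t => `|v1 t| + `|v0 t|) by apply: itgbD; exact: itgb_norm.
  have h4 : `|\int[leb]_(t in `[0, T]) bdr d t| <=
      e * \int[leb]_(t in `[0, T]) (`|v1 t| + `|v0 t|).
    rewrite -intgZ// (le_trans (normr_intg ib))//.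
    by apply: le_intg; [exact: itgb_norm|exact: itgbZ|exact: hb].
  have h1 := hm T; rewrite T0' lexx in h1; have {}h1 := h1 isT.
  have h2 := hm 0; rewrite T0' lexx in h2; have {}h2 := h2 isT.
  rewrite /Lam (le_trans (ler_normB _ _))// /C -addrA mulrDr lerD//.
    by rewrite (le_trans (ler_normB _ _))// mulrDr lerD.
  rewrite (le_trans (ler_normB _ _))// mulrDr lerD//.
  by rewrite normrM mulrCA ler_wpM2l.
have LamB p1 p2 : continuous p1 -> continuous p2 ->
    Lam (fun x => p1 x - p2 x) = Lam p1 - Lam p2.
  move=> c1 c2.
  have mE t : 0 <= t -> mom (fun x => p1 x - p2 x) t = mom p1 t - mom p2 t.
    move=> t0; rewrite /mom -intgB; [|apply: itgbM_continuous; [by cont|exact: iu]..].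
    by apply: eq_intg => x _; rewrite mulrBl.
  have sE t : 0 <= t -> src (fun x => p1 x - p2 x) t = src p1 t - src p2 t.
    move=> t0; rewrite /src -intgB; [|apply: itgbM_continuous; [by cont|exact: if']..].
    by apply: eq_intg => x _; rewrite mulrBl.
  rewrite /Lam !mE// (@eq_intg _ _ _ (src _) (fun t => src p1 t - src p2 t)); last first.
    by move=> t /andP[t0 _]; exact: sE.
  rewrite intgB; [|exact: itgb_src..].
  rewrite (@eq_intg _ _ _ (bdr (fun x => p1 x - p2 x)) (fun t => bdr p1 t - bdr p2 t)); last first.
    by move=> t _; rewrite /bdr; ring.
  rewrite intgB; [|exact: itgb_bdr..].
  move: (mom p1 T) (mom p1 0) (mom p2 T) (mom p2 0) => m1 m2 m3 m4.
  move: (Rintegral _ _ _) (Rintegral _ _ _) (Rintegral _ _ _) (Rintegral _ _ _).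
  by move=> *; ring.
apply/eqP; rewrite -normr_le0; apply/ler_addgt0Pr => e e0; rewrite add0r.
have e1 : 0 < e / (C + 1) by rewrite divr_gt0//; lra.
have [p [dp [cdp dpp hp]]] := approx_C1 L cpsi e1.
have cp : continuous p.
  move=> x; apply: differentiable_continuous.
  by apply/derivable1_diffP; have := dpp x; case.
have Lp : Lam p = 0 by apply/eqP; rewrite subr_eq0; apply/eqP; exact: transport_test_C1 dpp.
have : `|Lam (fun x => p x - psi x)| <= e / (C + 1) * C by apply: small hp; cont.
rewrite LamB// Lp sub0r normrN => /le_trans; apply.
rewrite mulrAC ler_pdivrMr; last lra.
by rewrite ler_wpM2l// ?ltW//; lra.
Qed.
End TestFunctions.
End Transport.

(** * Superpositions of test functions *)
Section Superposition.
Context {R : realType}.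
Implicit Types (G : R -> R -> R) (g w : R -> R).

Lemma continuous_intg_L2_pos (g f : R -> R -> R) : continuous_in_L2 f ->
  continuous (fun p : R * R => g p.1 p.2) ->
  continuous (fun t => \int[leb]_(x in `[0, 1]) (g t x * f (Num.max t 0) x)).
Proof.
move=> cf cg; apply: (@continuous_intg_L2 _ R g f (fun t => Num.max t 0)) => //.
  by cont.
by move=> t; rewrite le_max lexx orbT.
Qed.

Lemma itgb_intg_L2 (g f : R -> R -> R) (a b : R) : 0 <= a -> continuous_in_L2 f ->
  continuous (fun p : R * R => g p.1 p.2) ->
  itgb a b (fun t => \int[leb]_(x in `[0, 1]) (g t x * f t x)).
Proof.
move=> a0 cf cg; apply: eq_itgb (itgb_continuous a b (continuous_intg_L2_pos cf cg)).
by move=> t /andP[t0 _]; rewrite max_l// (le_trans a0).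
Qed.

Lemma fubini_rect (K : R -> R -> R) (v : R -> R) (a b c d : R) : a <= b -> c <= d ->
  continuous (fun p : R * R => K p.1 p.2) -> itgb a b v ->
  \int[leb]_(x in `[a, b]) ((\int[leb]_(y in `[c, d]) K x y) * v x) =
  \int[leb]_(y in `[c, d]) \int[leb]_(x in `[a, b]) (K x y * v x).
Proof.
move=> ab cd cK iv; have [M hM] := continuous2_bounded a b c d cK.
have [_ _ h] := fubini_itv ab cd (continuous2_measurable cK) hM iv.
transitivity (\int[leb]_(x in `[a, b]) (v x * \int[leb]_(y in `[c, d]) K x y)).
  by apply: eq_intg => x _; rewrite mulrC.
by rewrite h; apply: eq_intg => y _; apply: eq_intg => x _; rewrite mulrC.
Qed.

Lemma intg_combination (a b k : R) (f1 f2 f3 f4 : R -> R) :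
  itgb a b f1 -> itgb a b f2 -> itgb a b f3 -> itgb a b f4 ->
  \int[leb]_(x in `[a, b]) (f1 x + (f2 x - k * (f3 x - f4 x))) =
  \int[leb]_(x in `[a, b]) f1 x + (\int[leb]_(x in `[a, b]) f2 x
    - k * (\int[leb]_(x in `[a, b]) f3 x - \int[leb]_(x in `[a, b]) f4 x)).
Proof.
move=> i1 i2 i3 i4; have i34 := itgbB i3 i4; have ik := itgbZ k i34.
by rewrite (intgD i1 (itgbB i2 ik)) (intgB i2 ik) (intgZ k i34) (intgB i3 i4).
Qed.

Variables (c : R) (u f : R -> R -> R) (v0 v1 : R -> R).
Hypotheses (sol : weak_transport c u f v0 v1) (cf : continuous_in_L2 f).

Lemma weak_transport_L2 : continuous_in_L2 u. Proof. by case: sol. Qed.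

Lemma weak_transport_itgb0 T : 0 < T -> itgb 0 T v0.
Proof. by move=> T0; apply: sqi_itgb; case: sol => _ + _ _; apply. Qed.

Lemma weak_transport_itgb1 T : 0 < T -> itgb 0 T v1.
Proof. by move=> T0; apply: sqi_itgb; case: sol => _ _ + _; apply. Qed.

Let cu := weak_transport_L2.

Lemma transport_test_from (psi : R -> R) (r T : R) : 0 <= r -> r <= T -> continuous psi ->
  mom c u psi T = mom c u psi r + (\int[leb]_(t in `[r, T]) src c f psi t
    - c * \int[leb]_(t in `[r, T]) bdr c v0 v1 psi t).
Proof.
move=> r0 rT cpsi; have T0 := le_trans r0 rT.
have hT := transport_test sol cf T0 cpsi.
have hr := transport_test sol cf r0 cpsi.
have is' := itgb_src c cf T cpsi; have ib := itgb_bdr sol T cpsi.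
move: hT; rewrite (intg_cat r0 rT is') (intg_cat r0 rT ib) mulrDr.
move: hr; move: (mom c u psi T) (mom c u psi 0) (mom c u psi r) => m1 m2 m3.
move: (Rintegral _ _ _) (Rintegral _ _ _) (Rintegral _ _ _) (Rintegral _ _ _).
by move=> i1 i2 i3 i4; lra.
Qed.

(** A superposition in [r] of functions [G r (x - c t)] switched on at time [r]
    is again an admissible test function; only the time integrals have to be
    exchanged, so that no regularity beyond continuity of [G] is needed. *)
Lemma superposition G (T : R) : 0 < T -> continuous (fun p : R * R => G p.1 p.2) ->
  let psi t y := \int[leb]_(r in `[0, t]) G r y in
  mom c u (psi T) T = \int[leb]_(t in `[0, T]) mom c u (G t) t +
    (\int[leb]_(t in `[0, T]) src c f (psi t) t
     - c * \int[leb]_(t in `[0, T]) bdr c v0 v1 (psi t) t).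
Proof.
move=> T0 cG psi; have T0' := ltW T0.
have cGr r : continuous (G r) by cont.
have slice w t : 0 <= t -> itgb 0 1 w ->
    \int[leb]_(x in `[0, 1]) (psi t (x - c * t) * w x) =
    \int[leb]_(r in `[0, t]) \int[leb]_(x in `[0, 1]) (G r (x - c * t) * w x).
  move=> t0 iw; apply: (@fubini_rect (fun x r => G r (x - c * t))) => //.
  by cont.
have iu t : 0 <= t -> itgb 0 1 (u t).
  by move=> t0; apply: sqi_itgb; exact: continuous_in_L2_sqi.
have if' t : 0 <= t -> itgb 0 1 (f t).
  by move=> t0; apply: sqi_itgb; exact: continuous_in_L2_sqi.
have iv1 := weak_transport_itgb1 T0; have iv0 := weak_transport_itgb0 T0.
rewrite /mom slice//; last exact: iu.
pose Ks (t r : R) := src c f (G r) (Num.max t 0).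
have cKs : continuous (fun p : R * R => Ks p.1 p.2).
  apply: (@continuous_intg_L2 _ (R * R)%type
    (fun p x => G p.2 (x - c * Num.max p.1 0)) f (fun p => Num.max p.1 0)) => //.
  - by cont.
  - by cont.
  - by move=> p; rewrite le_max lexx orbT.
have [is1 is2 is3] := fubini_triangle T0' cKs (itgb_cst 0 T 1).
have cK1 : continuous (fun p : R * R => G p.2 (1 - c * p.1)) by cont.
have [ib1 ib2 ib3] := fubini_triangle (K := fun t r => G r (1 - c * t)) T0' cK1 iv1.
have cK0 : continuous (fun p : R * R => G p.2 (0 - c * p.1)) by cont.
have [ic1 ic2 ic3] := fubini_triangle (K := fun t r => G r (0 - c * t)) T0' cK0 iv0.
have srcE t : 0 <= t <= T -> src c f (psi t) t = 1 * \int[leb]_(r in `[0, t]) Ks t r.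
  move=> /andP[t0 _]; rewrite mul1r; apply: eq_trans (slice _ _ t0 (if' _ t0)) _.
  by apply: eq_intg => r _; rewrite /Ks max_l.
have bdrE t : bdr c v0 v1 (psi t) t =
    v1 t * (\int[leb]_(r in `[0, t]) G r (1 - c * t))
    - v0 t * (\int[leb]_(r in `[0, t]) G r (0 - c * t)).
  by rewrite /bdr mulrC [psi t (0 - _) * _]mulrC.
rewrite (eq_intg srcE) is3 (@eq_intg _ _ _ (fun t => bdr c v0 v1 (psi t) t) _ (fun t _ => bdrE t)).
rewrite (intgB ib1 ic1) ib3 ic3.
have imom : itgb 0 T (fun r => mom c u (G r) r).
  apply: (@itgb_intg_L2 (fun r x => G r (x - c * r))) => //.
  by cont.
apply: (eq_trans _ (intg_combination c imom is2 ib2 ic2)).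
apply: eq_intg => r /andP[r0 rT].
rewrite -/(mom c u (G r) T) (transport_test_from r0 rT (cGr r)).
congr (_ + (_ - c * _)).
  by apply: eq_intg => t /andP[rt _]; rewrite mul1r /Ks max_l// (le_trans r0).
rewrite -intgB; [|apply: itgb_sub r0 (lexx T) _..]; last 2 first.
- by under eq_fun do rewrite mulrC; apply: itgbM_continuous => //; cont.
- by under eq_fun do rewrite mulrC; apply: itgbM_continuous => //; cont.
by apply: eq_intg => t _; rewrite /bdr mulrC [G r (0 - _) * _]mulrC.
Qed.

End Superposition.

(** * Solutions of the adjoint problem as test functions *)
Section Duhamel.
Context {R : realType}.

(** The solution of the adjoint problem [dt phi + c dx phi = g], [phi t 1 = 0],
    where [g t x = G t (x - c t)]: each characteristic is followed to the
    time at which it meets [x = 1], which is later than [t] if [c] is positive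
    and earlier if [c] is negative. *)
Definition charint (c : R) (G : R -> R -> R) (t x : R) : R :=
  - oint (fun r => G r (x - c * t)) t ((1 - (x - c * t)) / c).

Lemma continuous_charint (c : R) G : continuous (fun p : R * R => G p.1 p.2) ->
  continuous (fun p : R * R => charint c G p.1 p.2).
Proof.
move=> cG; rewrite /charint; apply: contN.
apply: (@continuous_oint _ _ (fun p r => G r (p.2 - c * p.1)) (fun p => p.1)
  (fun p => (1 - (p.2 - c * p.1)) / c)); by cont.
Qed.

Variables (c : R) (u f : R -> R -> R) (v0 v1 : R -> R).
Hypotheses (sol : weak_transport c u f v0 v1) (cf : continuous_in_L2 f).

(** For [t >= 0], splitting the integral in [charint] at time [0] writes it as a
    function of [x - c * t] plus a superposition of functions switched on at
    times up to [t]; both are admissible.  The trace [v1] disappears because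
    [charint] vanishes at [x = 1]. *)
Lemma duhamel_test (G : R -> R -> R) (T : R) : c != 0 -> 0 < T ->
  continuous (fun p : R * R => G p.1 p.2) ->
  \int[leb]_(x in `[0, 1]) (charint c G T x * u T x)
  - \int[leb]_(x in `[0, 1]) (charint c G 0 x * u 0 x) =
  \int[leb]_(t in `[0, T]) (\int[leb]_(x in `[0, 1]) (G t (x - c * t) * u t x)
    + \int[leb]_(x in `[0, 1]) (charint c G t x * f t x))
  + c * \int[leb]_(t in `[0, T]) (charint c G t 0 * v0 t).
Proof.
move=> c0 T0 cG; have T0' := ltW T0.
have cPhi := continuous_charint (c := c) cG.
pose psi0 y := - oint (fun r => G r y) 0 ((1 - y) / c).
have cpsi0 : continuous psi0.
  apply: contN.
  by apply: (@continuous_oint _ _ (fun y r => G r y) (fun=> 0) (fun y => (1 - y) / c)); cont.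
pose psi t y := \int[leb]_(r in `[0, t]) G r y.
have PhiE t x : 0 <= t -> charint c G t x = psi0 (x - c * t) + psi t (x - c * t).
  move=> t0; rewrite /charint /psi0 /psi intg_oint//; last by cont.
  by rewrite -(@oint_cat _ _ 0 t _); [ring|cont].
have iu t : 0 <= t -> itgb 0 1 (u t).
  by move=> t0; apply: sqi_itgb; apply: continuous_in_L2_sqi t0; case: sol.
have if' t : 0 <= t -> itgb 0 1 (f t).
  by move=> t0; apply: sqi_itgb; exact: continuous_in_L2_sqi.
have psiE t x : 0 <= t -> psi t (x - c * t) = charint c G t x - psi0 (x - c * t).
  by move=> t0; rewrite PhiE// addrAC subrr add0r.
have split w t : 0 <= t -> itgb 0 1 w ->
    \int[leb]_(x in `[0, 1]) (psi t (x - c * t) * w x) =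
    \int[leb]_(x in `[0, 1]) (charint c G t x * w x) -
    \int[leb]_(x in `[0, 1]) (psi0 (x - c * t) * w x).
  move=> t0 iw.
  have i1 : itgb 0 1 (fun x => charint c G t x * w x).
    by apply: itgbM_continuous => //; cont.
  have i2 : itgb 0 1 (fun x => psi0 (x - c * t) * w x).
    by apply: itgbM_continuous => //; cont.
  apply: (eq_trans _ (intgB i1 i2)).
  by apply: eq_intg => x _; rewrite psiE// mulrBl.
have h0 := transport_test sol cf T0' cpsi0.
have hs : mom c u (psi T) T = \int[leb]_(t in `[0, T]) mom c u (G t) t +
    (\int[leb]_(t in `[0, T]) src c f (psi t) t
     - c * \int[leb]_(t in `[0, T]) bdr c v0 v1 (psi t) t).
  exact: superposition.
have mT := split _ _ T0' (iu T T0').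
have Phi1 t : charint c G t 1 = 0.
  have -> : charint c G t 1 = - oint (fun r => G r (1 - c * t)) t t.
    by congr (- oint _ _ _); field.
  by rewrite /oint subrr mul0r oppr0.
have i0 := itgb_src c cf T cpsi0.
have iPf : itgb 0 T (fun t => \int[leb]_(x in `[0, 1]) (charint c G t x * f t x)).
  exact: (@itgb_intg_L2 R (charint c G)).
have srcE (t : R) : 0 <= t <= T -> src c f (psi t) t =
    \int[leb]_(x in `[0, 1]) (charint c G t x * f t x) - src c f psi0 t.
  by move=> /andP[t0 _]; exact: (split _ _ t0 (if' t t0)).
have ib0 := itgb_bdr sol T cpsi0.
have iP0 : itgb 0 T (fun t => charint c G t 0 * v0 t).
  apply: itgbM_continuous; first by cont.
  exact: (weak_transport_itgb0 sol).
have bdrE (t : R) : 0 <= t <= T -> bdr c v0 v1 (psi t) t =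
    - (charint c G t 0 * v0 t) - bdr c v0 v1 psi0 t.
  by move=> /andP[t0 _]; rewrite /bdr !psiE// Phi1; ring.
have img : itgb 0 T (fun t => \int[leb]_(x in `[0, 1]) (G t (x - c * t) * u t x)).
  apply: (@itgb_intg_L2 R (fun t x => G t (x - c * t))) => //; last by cont.
  by case: sol.
move: hs; rewrite (eq_intg srcE) (eq_intg bdrE) (intgB iPf i0) (intgB (itgbN iP0) ib0) (intgN iP0).
rewrite (intgD img iPf) => hs.
have m0 : mom c u psi0 0 = \int[leb]_(x in `[0, 1]) (charint c G 0 x * u 0 x).
  apply: eq_intg => x _; rewrite PhiE// /psi intg_point addr0//.
rewrite -m0; move: mT hs h0.
rewrite -/(mom c u (psi T) T) -/(mom c u psi0 T).
have -> : \int[leb]_(t in `[0, T]) mom c u (G t) t =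
  \int[leb]_(t in `[0, T]) \int[leb]_(x in `[0, 1]) (G t (x - c * t) * u t x) by [].
move: (mom c u (psi T) T) (mom c u psi0 T) (mom c u psi0 0) => m1 m2 m3.
move: (Rintegral _ _ _) (Rintegral _ _ _) (Rintegral _ _ _) (Rintegral _ _ _) (Rintegral _ _ _) (Rintegral _ _ _).
move=> i1 i2 i3 i4 i5 i6 h1 h2 h3.
nra.
Qed.
End Duhamel.

(** * Duality for a kernel transported across the diagonal *)
Section KernelIdentity.
Context {R : realType}.
Implicit Types (k h : R -> R -> R) (psi f : R -> R) (mu g xi t x : R).

Lemma oint_affine f (a b c d : R) : continuous f ->
  oint (fun x => d * f (c + d * x)) a b = oint f (c + d * a) (c + d * b).
Proof.
move=> cf; have [F dF] := continuous_primitive cf.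
have dG := is_derive_affine c d dF.
rewrite (oint_primitive _ _ cf dF) (oint_primitive _ _ _ dG)//.
by cont.
Qed.

Lemma oint_opp f (a b : R) : continuous f -> oint f b a = - oint f a b.
Proof.
move=> cf; have [F dF] := continuous_primitive cf.
by rewrite !(oint_primitive _ _ cf dF) opprB.
Qed.

Lemma eq_oint f1 f2 (a b : R) : f1 =1 f2 -> oint f1 a b = oint f2 a b.
Proof. by move=> /funext ->. Qed.

Lemma fubini_continuous_region (K : R -> R -> R) (P : R -> R -> bool) (a b c d : R) :
  a <= b -> c <= d -> continuous (fun p : R * R => K p.1 p.2) ->
  measurable_fun [set: R * R] (fun p => P p.1 p.2) ->
  [/\ itgb a b (fun x => \int[leb]_(y in `[c, d]) if P x y then K x y else 0),
      itgb c d (fun y => \int[leb]_(x in `[a, b]) if P x y then K x y else 0) &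
  \int[leb]_(x in `[a, b]) \int[leb]_(y in `[c, d]) (if P x y then K x y else 0) =
  \int[leb]_(y in `[c, d]) \int[leb]_(x in `[a, b]) (if P x y then K x y else 0)].
Proof.
move=> ab cd cK mP.
have [h1 h2 h3] := fubini_region ab cd cK mP (itgb_cst a b 1).
have E1 (x : R) : 1 * (\int[leb]_(y in `[c, d]) if P x y then K x y else 0) =
  \int[leb]_(y in `[c, d]) if P x y then K x y else 0 by rewrite mul1r.
have E2 (y : R) : \int[leb]_(x in `[a, b]) (if P x y then 1 * K x y else 0) =
  \int[leb]_(x in `[a, b]) (if P x y then K x y else 0).
  by apply: eq_intg => x _; rewrite mul1r.
split.
- by apply: eq_itgb h1 => x _; exact: E1.
- by apply: eq_itgb h2 => y _; exact: E2.
- apply: eq_trans (eq_trans _ h3) _; apply: eq_intg => z _; first by rewrite E1.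
  exact: E2.
Qed.

Section Right.
Variables (mu g : R) (k h : R -> R -> R) (psi : R -> R).
Hypotheses (mu0 : 0 < mu) (g0 : 0 < g).
Hypotheses (ck : continuous (fun p : R * R => k p.1 p.2)).
Hypotheses (ch : continuous (fun p : R * R => h p.1 p.2)).
Hypothesis kh : holds_along_characteristics mu (- g) k h.
Hypothesis cpsi : continuous psi.

Let gmu0 : 0 < g + mu. Proof. exact: addr_gt0. Qed.
Let mun : mu != 0. Proof. exact: lt0r_neq0. Qed.
Let gmun : g + mu != 0. Proof. exact: lt0r_neq0. Qed.

(** Integrating [h] along the part of a characteristic of [k] between its exit
    from the triangle through the diagonal, at [r1], and a time [r0]. *)
Let segment xi (y r0 r1 : R) : 0 <= xi -> 0 <= r0 -> r0 <= r1 ->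
  xi + (g + mu) * r1 = y -> xi + g * r1 <= 1 -> y - mu * r0 <= 1 ->
  \int[leb]_(r in `[r0, r1]) h (y - mu * r) (xi + g * r) =
  k (y - mu * r0) (xi + g * r0) - k (xi + g * r1) (xi + g * r1).
Proof.
move=> xi0 r00 r01 ey h1 h2.
have r10 := le_trans r00 r01.
have s0 : 0 <= r1 - r0 by rewrite subr_ge0.
have T1 : triangle (xi + g * r1, xi + g * r1).
  by rewrite /triangle/=; split; [rewrite addr_ge0// mulr_ge0// ltW|split].
have e1 : xi + g * r1 + mu * (r1 - r0) = y - mu * r0 by rewrite -ey; ring.
have e2 : xi + g * r1 + - g * (r1 - r0) = xi + g * r0 by ring.
have T2 : triangle (xi + g * r1 + mu * (r1 - r0), xi + g * r1 + - g * (r1 - r0)).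
  rewrite e1 e2 /triangle/=; split; [|split => //].
    by rewrite addr_ge0// mulr_ge0// ltW.
  have : (g + mu) * r0 <= (g + mu) * r1 by rewrite ler_wpM2l// ltW.
  by rewrite -ey; lra.
have := kh s0 T1 T2; rewrite e1 e2 => ->.
have cF : continuous (fun r => h (y - mu * r) (xi + g * r)) by cont.
rewrite (intg_oint r01 cF) (intg_oint s0); last by cont.
have := oint_affine 0 (r1 - r0) r1 (-1) cF.
rewrite mulr0 addr0 (_ : r1 + -1 * (r1 - r0) = r0); last by ring.
rewrite (oint_opp _ _ cF) => e.
rewrite -[LHS]opprK -e /oint -mulrN; congr (_ * _).
rewrite -intgN; last by apply: itgb_continuous; cont.
apply: eq_intg => r _; rewrite mulN1r opprK; congr (h _ _); rewrite -?ey; ring.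
Qed.

(** Put [y = x + mu * r].  For fixed [y], the points [(y - mu * r, xi + g * r)]
    describe the characteristic of [k] through [(y, xi)], which is inside the
    triangle from the time [r0 y], when it has [x = 1] or [r = 0], to the time
    [r1 y], when it meets the diagonal.  So integrating first in [r] yields
    differences of values of [k], and exchanging the integrals gives the
    identity; the part [y >= 1] cancels against the term at [x = 1], and the
    values on the diagonal against the other boundary term. *)
Lemma kernel_duality_right0 xi : 0 <= xi <= 1 ->
  \int[leb]_(x in `[xi, 1]) (psi x * k x xi) =
  - \int[leb]_(r in `[0, (1 - xi) / g])
     (mu * psi (1 + mu * r) * k 1 (xi + g * r)
      - (g + mu) * psi (xi + (g + mu) * r) * k (xi + g * r) (xi + g * r)
      - oint (fun x => psi (x + mu * r) * h x (xi + g * r)) (xi + g * r) 1).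
Proof.
move=> /andP[xi0 xi1]; set p := (1 - xi) / g.
have p0 : 0 <= p by rewrite divr_ge0 ?subr_ge0// ltW.
have gp : g * p = 1 - xi by rewrite /p mulrC divfK// gt_eqF.
pose q := 1 + mu * p.
have mp0 : 0 <= mu * p by rewrite mulr_ge0// ltW.
have qE : q = xi + (g + mu) * p by rewrite /q mulrDl gp; ring.
have q1 : 1 <= q by rewrite /q lerDl.
have xiq : xi <= q by exact: le_trans xi1 q1.
pose r1 y := (y - xi) / (g + mu).
pose r0 y := Num.max 0 ((y - 1) / mu).
pose P r y := (xi + (g + mu) * r <= y) && (y <= 1 + mu * r).
have slice_r r : 0 <= r <= p -> [/\ xi <= xi + (g + mu) * r,
    1 + mu * r <= q & xi + (g + mu) * r <= 1 + mu * r].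
  move=> /andP[rr0 rp].
  have mr : mu * r <= mu * p by apply: ler_wpM2l rp; exact: ltW.
  have gr : g * r <= g * p by apply: ler_wpM2l rp; exact: ltW.
  have mr0 : 0 <= mu * r by apply: mulr_ge0 => //; exact: ltW.
  have gr0 : 0 <= g * r by apply: mulr_ge0 => //; exact: ltW.
  by rewrite /q mulrDl; split; lra.
have slice_y y : xi <= y <= q -> [/\ r1 y <= p, 0 <= r0 y & r0 y <= r1 y] /\
    [/\ xi + (g + mu) * r1 y = y, xi + g * r1 y <= 1 & y - mu * r0 y <= 1].
  move=> /andP[xiy yq].
  have r1p : r1 y <= p.
    by rewrite /r1 ler_pdivrMr// mulrC; move: yq; rewrite qE; lra.
  have r00 : 0 <= r0 y by rewrite /r0 le_max lexx.
  have e1 : xi + (g + mu) * r1 y = y by rewrite /r1; field.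
  have r01 : r0 y <= r1 y.
    rewrite /r0 ge_max /r1 divr_ge0 ?subr_ge0 ?(ltW gmu0)//= ler_pdivrMr//.
    rewrite mulrAC ler_pdivlMr//; move: yq; rewrite /q -(ler_pM2r g0).
    by rewrite mulrDl mul1r -mulrA [p * g]mulrC gp; nra.
  have h1 : xi + g * r1 y <= 1.
    have : g * r1 y <= g * p by apply: ler_wpM2l r1p; exact: ltW.
    by rewrite gp; lra.
  have h2 : y - mu * r0 y <= 1.
    have : (y - 1) / mu <= r0 y by rewrite /r0 le_max lexx orbT.
    by rewrite ler_pdivrMr// mulrC; lra.
  by split; split.
have PE r y : 0 <= r -> P r y = (r0 y <= r <= r1 y).
  move=> rr; rewrite /P andbC /r0 ge_max rr/= /r1 ler_pdivlMr// ler_pdivrMr//.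
  by congr (_ && _); [rewrite lerBlDl mulrC|rewrite lerBrDl mulrC].
pose D y := xi + g * ((y - xi) / (g + mu)).
pose f1 y := psi y * k 1 (xi + g * ((y - 1) / mu)).
pose f2 y := psi y * k (D y) (D y).
have cf1 : continuous f1 by rewrite /f1; cont.
have cf2 : continuous f2 by rewrite /f2 /D; cont.
have I1 : \int[leb]_(r in `[0, p]) (mu * psi (1 + mu * r) * k 1 (xi + g * r)) =
    \int[leb]_(y in `[1, q]) f1 y.
  have := oint_affine 0 p 1 mu cf1; rewrite mulr0 addr0 -/q (intg_oint q1 cf1) => <-.
  rewrite intg_oint//; last by cont.
  apply: eq_oint => r; rewrite /f1 -mulrA.
  by have -> : (1 + mu * r - 1) / mu = r by field.
have I2 : \int[leb]_(r in `[0, p])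
    ((g + mu) * psi (xi + (g + mu) * r) * k (xi + g * r) (xi + g * r)) =
    \int[leb]_(y in `[xi, q]) f2 y.
  have := oint_affine 0 p xi (g + mu) cf2; rewrite mulr0 addr0 -qE (intg_oint xiq cf2) => <-.
  rewrite intg_oint//; last by cont.
  apply: eq_oint => r; rewrite /f2 /D -mulrA.
  by have -> : (xi + (g + mu) * r - xi) / (g + mu) = r by field.
pose K r y := psi y * h (y - mu * r) (xi + g * r).
have cK : continuous (fun z : R * R => K z.1 z.2) by rewrite /K; cont.
have mP : measurable_fun [set: R * R] (fun z => P z.1 z.2).
  by apply: measurable_and; apply: measurable_le2; cont.
have [iP1 iP2 swap] := fubini_continuous_region p0 xiq cK mP.
have inner1 r : 0 <= r <= p ->
    oint (fun x => psi (x + mu * r) * h x (xi + g * r)) (xi + g * r) 1 =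
    \int[leb]_(y in `[xi, q]) if P r y then K r y else 0.
  move=> /slice_r[le1 le2 le3].
  rewrite /P (intg_if _ le1 le2).
  have cKr : continuous (K r) by rewrite /K; cont.
  rewrite (intg_oint le3 cKr).
  have := oint_affine (xi + g * r) 1 (mu * r) 1 cKr.
  rewrite !mul1r (_ : mu * r + (xi + g * r) = xi + (g + mu) * r); last by ring.
  rewrite [mu * r + 1]addrC => <-; apply: eq_oint => x.
  by rewrite !mul1r /K [mu * r + x]addrC addrK.
have inner2 y : xi <= y <= q ->
    \int[leb]_(r in `[0, p]) (if P r y then K r y else 0) =
    psi y * k (y - mu * r0 y) (xi + g * r0 y) - f2 y.
  move=> /slice_y[[r1p r00 r01] [e1 h1 h2]].
  rewrite (@eq_intg _ _ _ _ (fun r => if r0 y <= r <= r1 y then K r y else 0)); last first.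
    by move=> r /andP[rr _]; rewrite PE.
  rewrite (intg_if _ r00 r1p) /K intgZ; last by apply: itgb_continuous; cont.
  rewrite (segment xi0 r00 r01 e1 h1 h2) mulrBr /f2.
  by [].
have I3 : \int[leb]_(r in `[0, p])
     oint (fun x => psi (x + mu * r) * h x (xi + g * r)) (xi + g * r) 1 =
   \int[leb]_(x in `[xi, 1]) (psi x * k x xi) + \int[leb]_(y in `[1, q]) f1 y
   - \int[leb]_(y in `[xi, q]) f2 y.
  rewrite (eq_intg inner1) swap (eq_intg inner2).
  have cr0 : continuous r0 by rewrite /r0; cont.
  have c3 : continuous (fun y => psi y * k (y - mu * r0 y) (xi + g * r0 y)) by cont.
  rewrite (intgB (itgb_continuous _ _ c3) (itgb_continuous _ _ cf2)).
  rewrite (intg_cat xi1 q1 (itgb_continuous _ _ c3)); congr (_ + _ - _).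
    apply: eq_intg => y /andP[xiy y1]; rewrite /r0 max_l.
      by rewrite !mulr0 subr0 addr0.
    by rewrite (ler_pdivrMr _ _ mu0) mul0r subr_le0.
  apply: eq_intg => y /andP[y1 yq]; rewrite /r0 max_r; last first.
    by rewrite (ler_pdivlMr _ _ mu0) mul0r subr_ge0.
  rewrite /f1; congr (_ * k _ _).
  by field.
have i1 : itgb 0 p (fun r => mu * psi (1 + mu * r) * k 1 (xi + g * r)).
  by apply: itgb_continuous; cont.
have i2 : itgb 0 p (fun r => (g + mu) * psi (xi + (g + mu) * r) * k (xi + g * r) (xi + g * r)).
  by apply: itgb_continuous; cont.
have i3 : itgb 0 p (fun r => oint (fun x => psi (x + mu * r) * h x (xi + g * r)) (xi + g * r) 1).
  by apply: eq_itgb iP1 => r hr; rewrite inner1.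
rewrite (intgB (itgbB i1 i2) i3) (intgB i1 i2) I1 I2 I3.
by move: (Rintegral _ _ _) (Rintegral _ _ _) (Rintegral _ _ _) => *; ring.
Qed.

End Right.
End KernelIdentity.

(** * Duality for a kernel transported along the diagonal *)
Section KernelIdentityLeft.
Context {R : realType}.
Variables (mu : R) (k h : R -> R -> R) (psi : R -> R).
Hypotheses (mu0 : 0 < mu).
Hypotheses (ck : continuous (fun p : R * R => k p.1 p.2)).
Hypotheses (ch : continuous (fun p : R * R => h p.1 p.2)).
Hypothesis kh : holds_along_characteristics mu mu k h.
Hypothesis cpsi : continuous psi.

Let mun : mu != 0. Proof. exact: lt0r_neq0. Qed.

(** The same exchange of integrals; here the characteristics are parallel to the
    diagonal, and the one through [(y, xi)] leaves the triangle at [x = 1], at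
    the time [s y]. *)
Lemma kernel_duality_left0 (xi : R) : 0 <= xi <= 1 ->
  \int[leb]_(x in `[xi, 1]) (psi x * k x xi) =
  \int[leb]_(r in `[0, (1 - xi) / mu])
     (mu * psi (1 - mu * r) * k 1 (xi + mu * r)
      - oint (fun x => psi (x - mu * r) * h x (xi + mu * r)) (xi + mu * r) 1).
Proof.
move=> /andP[xi0 xi1]; set p := (1 - xi) / mu.
have p0 : 0 <= p by rewrite divr_ge0 ?subr_ge0// ltW.
have mp : mu * p = 1 - xi by rewrite /p mulrC divfK.
have slice_r (r : R) : 0 <= r <= p -> 1 - mu * r <= 1 /\ xi <= 1 - mu * r.
  move=> /andP[r0 rp].
  have mr : mu * r <= mu * p by apply: ler_wpM2l rp; exact: ltW.
  have mr0 : 0 <= mu * r by apply: mulr_ge0 => //; exact: ltW.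
  by split; lra.
pose s y := (1 - y) / mu.
have ms y : mu * s y = 1 - y by rewrite /s; field.
have slice_y (y : R) : xi <= y -> y <= 1 -> [/\ 0 <= s y, s y <= p,
    triangle (y, xi) & triangle (y + mu * s y, xi + mu * s y)].
  move=> xiy y1; split.
  - by rewrite /s divr_ge0 ?subr_ge0// ltW.
  - by rewrite /s ler_pM2r ?invr_gt0//; lra.
  - by [].
  - by rewrite /triangle/= ms; split; [|split]; lra.
pose f1 y := psi y * k 1 (xi + 1 - y).
have cf1 : continuous f1 by rewrite /f1; cont.
have I1 : \int[leb]_(r in `[0, p]) (mu * psi (1 - mu * r) * k 1 (xi + mu * r)) =
    \int[leb]_(y in `[xi, 1]) f1 y.
  have := oint_affine 0 p 1 (- mu) cf1; rewrite mulr0 addr0 mulNr mp.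
  rewrite (_ : 1 - (1 - xi) = xi); last by ring.
  rewrite (oint_opp _ _ cf1) -(intg_oint xi1 cf1) => /eqP; rewrite -eqr_oppLR => /eqP <-.
  rewrite intg_oint//; last by cont.
  rewrite /oint -mulrN; congr (_ * _).
  rewrite -intgN; last by apply: itgb_continuous; cont.
  apply: eq_intg => r _; rewrite /f1 mulNr opprK -mulrA; congr (_ * (_ * k _ _)).
    by rewrite mulNr.
  by ring.
pose P r y := (xi <= y) && (y <= 1 - mu * r).
pose K r y := psi y * h (y + mu * r) (xi + mu * r).
have cK : continuous (fun z : R * R => K z.1 z.2) by rewrite /K; cont.
have mP : measurable_fun [set: R * R] (fun z => P z.1 z.2).
  by apply: measurable_and; apply: measurable_le2; cont.
have [iP1 iP2 swap] := fubini_continuous_region p0 xi1 cK mP.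
have inner1 (r : R) : 0 <= r <= p ->
    oint (fun x => psi (x - mu * r) * h x (xi + mu * r)) (xi + mu * r) 1 =
    \int[leb]_(y in `[xi, 1]) if P r y then K r y else 0.
  move=> /slice_r[le1 le].
  rewrite /P (intg_if _ (lexx xi) le1).
  have cKr : continuous (K r) by rewrite /K; cont.
  rewrite (intg_oint le cKr).
  have := oint_affine (xi + mu * r) 1 (- (mu * r)) 1 cKr.
  rewrite !mul1r (_ : - (mu * r) + (xi + mu * r) = xi); last by ring.
  rewrite [- (mu * r) + 1]addrC => <-; apply: eq_oint => x.
  by rewrite !mul1r /K [- (mu * r) + x]addrC subrK.
have inner2 (y : R) : xi <= y <= 1 ->
    \int[leb]_(r in `[0, p]) (if P r y then K r y else 0) = f1 y - psi y * k y xi.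
  move=> /andP[xiy y1].
  have [s0 sp T1 T2] := slice_y y xiy y1.
  rewrite (@eq_intg _ _ _ _ (fun r => if 0 <= r <= s y then K r y else 0)); last first.
    move=> r /andP[r0 _]; rewrite /P xiy r0 andTb andTb /s (ler_pdivlMr _ _ mu0).
    by rewrite lerBrDr -lerBrDl [r * mu]mulrC.
  rewrite (intg_if _ (lexx 0) sp) /K intgZ; last by apply: itgb_continuous; cont.
  rewrite -(kh s0 T1 T2) ms mulrBr /f1.
  have -> : y + (1 - y) = 1 by rewrite addrC subrK.
  by have -> : xi + (1 - y) = xi + 1 - y by rewrite addrA.
have i1 : itgb 0 p (fun r => mu * psi (1 - mu * r) * k 1 (xi + mu * r)).
  by apply: itgb_continuous; cont.
have i3 : itgb 0 p (fun r => oint (fun x => psi (x - mu * r) * h x (xi + mu * r)) (xi + mu * r) 1).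
  by apply: eq_itgb iP1 => r hr; rewrite inner1.
have c2 : continuous (fun y => psi y * k y xi) by cont.
rewrite (intgB i1 i3) I1 (eq_intg inner1) swap (eq_intg inner2).
rewrite (intgB (itgb_continuous _ _ cf1) (itgb_continuous _ _ c2)).
by rewrite opprB addrC subrK.
Qed.

End KernelIdentityLeft.

Section CharacteristicForm.
Context {R : realType}.
Variables (mu : R) (k h : R -> R -> R) (psi : R -> R).
Hypotheses (mu0 : 0 < mu).
Hypotheses (ck : continuous (fun p : R * R => k p.1 p.2)).
Hypotheses (ch : continuous (fun p : R * R => h p.1 p.2)).
Hypothesis cpsi : continuous psi.
Let mun : mu != 0. Proof. exact: lt0r_neq0. Qed.

(** Integrating it against [v] is integrating [psi (x + mu * t)] against the
    Volterra operator of kernel [k] applied to [v]. *)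
Definition dual_test (t xi : R) : R :=
  \int[leb]_(x in `[xi, 1]) (psi (x + mu * t) * k x xi).

(** What [dt + g dxi] would yield on [dual_test] if everything were smooth, for
    a kernel transported along [(mu, - g)]: a term at [x = 1], one on the
    diagonal, and the coupling. *)
Definition source_right (g t xi : R) : R :=
  mu * psi (1 + mu * t) * k 1 xi - (g + mu) * psi (xi + mu * t) * k xi xi
  - oint (fun x => psi (x + mu * t) * h x xi) xi 1.

(** Along [(mu, mu)] the diagonal is characteristic and contributes nothing. *)
Definition source_left (t xi : R) : R :=
  mu * psi (1 + mu * t) * k 1 xi - oint (fun x => psi (x + mu * t) * h x xi) xi 1.

Lemma continuous_source_left :
  continuous (fun p : R * R => source_left p.1 p.2).
Proof.
rewrite /source_left; apply: contD; first by cont.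
apply: contN; apply: (@continuous_oint _ _ (fun p x => psi (x + mu * p.1) * h x p.2)
  (fun p => p.2) (fun=> 1)); by cont.
Qed.

Lemma continuous_source_right (g : R) :
  continuous (fun p : R * R => source_right g p.1 p.2).
Proof.
rewrite /source_right; apply: contD; first by cont.
apply: contN; apply: (@continuous_oint _ _ (fun p x => psi (x + mu * p.1) * h x p.2)
  (fun p => p.2) (fun=> 1)); by cont.
Qed.

(** The identity [kernel_duality_right0], shifted in time, is the adjoint
    equation of [dual_test] in integrated form. *)
Lemma dual_test_right (g t xi : R) : 0 < g ->
  holds_along_characteristics mu (- g) k h -> 0 <= xi <= 1 ->
  charint g (fun r y => source_right g r (y + g * r)) t xi = dual_test t xi.
Proof.
move=> g0 kh hxi; have gn : g != 0 := lt0r_neq0 g0.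
have cs := @continuous_source_right g.
have cpsit : continuous (fun x => psi (x + mu * t)) by cont.
have p0 : 0 <= (1 - xi) / g.
  by case/andP: hxi => _ h1; rewrite divr_ge0 ?subr_ge0// ltW.
rewrite /dual_test (kernel_duality_right0 mu0 g0 ck ch kh cpsit hxi) /charint.
congr (- _).
have cF : continuous (fun r => source_right g r (xi - g * t + g * r)) by cont.
have := oint_affine 0 ((1 - xi) / g) t 1 cF.
rewrite !mul1r addr0 (_ : t + (1 - xi) / g = (1 - (xi - g * t)) / g); last by field.
move=> <-; rewrite -intg_oint//; last by cont.
apply: eq_intg => r _; rewrite !mul1r /source_right.
have -> : xi - g * t + g * (t + r) = xi + g * r by ring.
have -> : 1 + mu * (t + r) = 1 + mu * r + mu * t by ring.
have -> : xi + g * r + mu * (t + r) = xi + (g + mu) * r + mu * t by ring.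
congr (_ - _); apply: eq_oint => x.
by have -> : x + mu * (t + r) = x + mu * r + mu * t by ring.
Qed.

Lemma dual_test_left (t xi : R) : holds_along_characteristics mu mu k h ->
  0 <= xi <= 1 ->
  charint (- mu) (fun r y => source_left r (y + - mu * r)) t xi = dual_test t xi.
Proof.
move=> kh hxi; have cs := @continuous_source_left.
have cpsit : continuous (fun x => psi (x + mu * t)) by cont.
have p0 : 0 <= (1 - xi) / mu.
  by case/andP: hxi => _ h1; rewrite divr_ge0 ?subr_ge0// ltW.
rewrite /dual_test (kernel_duality_left0 mu0 ck ch kh cpsit hxi) /charint.
have cF : continuous (fun r => source_left r (xi - - mu * t + - mu * r)) by cont.
have := oint_affine 0 ((1 - xi) / mu) t (-1) cF.
rewrite mulr0 addr0 (_ : t + -1 * ((1 - xi) / mu) = (1 - (xi - - mu * t)) / (- mu)); last first.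
  by field.
move=> <-.
have cF' : continuous (fun r : R => -1 * source_left (t + -1 * r) (xi - - mu * t + - mu * (t + -1 * r))).
  by cont.
rewrite -(intg_oint p0 cF') -(intgN (itgb_continuous _ _ cF')).
apply: eq_intg => r _; rewrite mulN1r opprK /source_left.
have -> : xi - - mu * t + - mu * (t + -1 * r) = xi + mu * r by ring.
have -> : 1 + mu * (t + -1 * r) = 1 - mu * r + mu * t by ring.
congr (_ - _); apply: eq_oint => x.
by have -> : x + mu * (t + -1 * r) = x - mu * r + mu * t by ring.
Qed.

End CharacteristicForm.

(** * Exchanging and collecting integrals *)
Section Tools.
Context {R : realType}.

Lemma cont_slice (F : R -> R -> R) (t : R) :
  continuous (fun p : R * R => F p.1 p.2) -> continuous (F t).
Proof. by move=> cF; cont. Qed.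

Lemma fubini_triangle_up (K : R -> R -> R) (v : R -> R) (a b : R) : a <= b ->
  continuous (fun p : R * R => K p.1 p.2) -> itgb a b v ->
  [/\ itgb a b (fun y => v y * \int[leb]_(x in `[y, b]) K x y),
      itgb a b (fun x => \int[leb]_(y in `[a, x]) (v y * K x y)) &
      \int[leb]_(x in `[a, b]) \int[leb]_(y in `[a, x]) (v y * K x y) =
      \int[leb]_(y in `[a, b]) (v y * \int[leb]_(x in `[y, b]) K x y)].
Proof.
move=> ab cK iv.
have cK' : continuous (fun p : R * R => K p.2 p.1) by cont.
have mP : measurable_fun [set: R * R] (fun p => p.1 <= p.2).
  by apply: measurable_le2; cont.
have [h1 h2 h3] := fubini_region (K := fun y x => K x y) (P := fun y x => y <= x)
  ab ab cK' mP iv.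
have E1 (y : R) : a <= y <= b -> \int[leb]_(x in `[a, b]) (if y <= x then K x y else 0) =
    \int[leb]_(x in `[y, b]) K x y.
  move=> /andP[ay yb]; rewrite -(@intg_if _ a b y b)//.
  by apply: eq_intg => x /andP[_ ->]; rewrite andbT.
have E2 (x : R) : a <= x <= b -> \int[leb]_(y in `[a, b]) (if y <= x then v y * K x y else 0) =
    \int[leb]_(y in `[a, x]) (v y * K x y).
  move=> /andP[ax xb]; rewrite -(@intg_if _ a b a x)//.
  by apply: eq_intg => y /andP[-> _].
split.
- by apply: eq_itgb h1 => y hy; rewrite E1.
- by apply: eq_itgb h2 => x hx; rewrite E2.
- apply: eq_trans (eq_trans _ (esym h3)) _.
    by apply: eq_intg => x hx; rewrite E2.
  by apply: eq_intg => y hy; rewrite E1.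
Qed.

(** The boundary conditions hold only almost everywhere, and only for positive
    times. *)
Lemma ae_eq_intg (T : R) (f g : R -> R) : itgb 0 T f -> itgb 0 T g ->
  {ae leb, forall t : R, 0 < t -> f t = g t} ->
  \int[leb]_(t in `[0, T]) f t = \int[leb]_(t in `[0, T]) g t.
Proof.
move=> hf hg fg.
have sub : [set` `]0, T]] `<=` [set` `[0, T]] by apply: subset_itv; rewrite bnd_simp.
have hf' : leb.-integrable `]0, T] (EFin \o f) by apply: integrableS hf.
have hg' : leb.-integrable `]0, T] (EFin \o g) by apply: integrableS hg.
rewrite -(Rintegral_itv_obnd_cbnd hf') -(Rintegral_itv_obnd_cbnd hg').
congr fine; apply: ae_eq_integral => //.
- exact: measurable_int hf'.
- exact: measurable_int hg'.
- move: fg; apply: filterS; first exact: (ae_filter_ringOfSetsType leb).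
  move=> t h /=; rewrite in_itv/= => /andP[t0 _].
  by rewrite h.
Qed.

Lemma intg_balance (a b : R) (f b1 c1 b2 c2 b3 c3 : R -> R) : itgb a b f ->
  itgb a b b1 -> itgb a b c1 -> itgb a b b2 -> itgb a b c2 -> itgb a b b3 -> itgb a b c3 ->
  \int[leb]_(x in `[a, b]) (f x - (b1 x + c1 x) - (b2 x + c2 x) - (b3 x + c3 x)) =
  \int[leb]_(x in `[a, b]) f x
   - (\int[leb]_(x in `[a, b]) b1 x + \int[leb]_(x in `[a, b]) c1 x)
   - (\int[leb]_(x in `[a, b]) b2 x + \int[leb]_(x in `[a, b]) c2 x)
   - (\int[leb]_(x in `[a, b]) b3 x + \int[leb]_(x in `[a, b]) c3 x).
Proof.
move=> hf h1 h1' h2 h2' h3 h3'.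
rewrite (intgB (itgbB (itgbB hf (itgbD h1 h1')) (itgbD h2 h2')) (itgbD h3 h3')).
rewrite (intgB (itgbB hf (itgbD h1 h1')) (itgbD h2 h2')) (intgB hf (itgbD h1 h1')).
by rewrite (intgD h1 h1') (intgD h2 h2') (intgD h3 h3').
Qed.

Lemma intg_boundary (a b m g1 g2 : R) (n f e1 e2 e3 : R -> R) : itgb a b n -> itgb a b f ->
  itgb a b e1 -> itgb a b e2 -> itgb a b e3 ->
  itgb a b (fun x => n x + m * f x - g1 * e1 x - g2 * e2 x + m * e3 x) /\
  \int[leb]_(x in `[a, b]) (n x + m * f x - g1 * e1 x - g2 * e2 x + m * e3 x) =
  \int[leb]_(x in `[a, b]) n x + m * \int[leb]_(x in `[a, b]) f x
   - g1 * \int[leb]_(x in `[a, b]) e1 x - g2 * \int[leb]_(x in `[a, b]) e2 x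
   + m * \int[leb]_(x in `[a, b]) e3 x.
Proof.
move=> hn hf h1 h2 h3.
have jf := itgbZ m hf; have j1 := itgbZ g1 h1; have j2 := itgbZ g2 h2.
have j3 := itgbZ m h3.
have l1 := itgbD hn jf; have l2 := itgbB l1 j1; have l3 := itgbB l2 j2.
split; first exact: itgbD l3 j3.
rewrite (intgD l3 j3) (intgB l2 j2) (intgB l1 j1) (intgD hn jf).
by rewrite (intgZ m hf) (intgZ g1 h1) (intgZ g2 h2) (intgZ m h3).
Qed.

End Tools.

Lemma balance_bookkeeping (R : realType) (m g1 g2 A1 B1 A2 B2 A3 B3 W V s b
    a1 b1 e1 a2 b2 e2 a3 b3 e3 : R) :
  A1 - B1 = (a1 + b1) + g1 * e1 -> A2 - B2 = (a2 + b2) + g2 * e2 ->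
  A3 - B3 = (a3 + b3) + - m * e3 -> W - V = s + m * b ->
  (W - A1 - A2 - A3) - (V - B1 - B2 - B3) =
  (s - (a1 + b1) - (a2 + b2) - (a3 + b3)) + m * b - g1 * e1 - g2 * e2 + m * e3.
Proof.
move=> h1 h2 h3 h4.
have -> : (W - A1 - A2 - A3) - (V - B1 - B2 - B3) =
  (W - V) - (A1 - B1) - (A2 - B2) - (A3 - B3) by ring.
by rewrite h1 h2 h3 h4; ring.
Qed.

Section Coupling.
Context {R : realType}.
Variables (m : R) (psi : R -> R) (k1 k2 k3 : R -> R -> R).
Hypothesis cpsi : continuous psi.
Hypotheses (ck1 : continuous (fun p : R * R => k1 p.1 p.2))
  (ck2 : continuous (fun p : R * R => k2 p.1 p.2))
  (ck3 : continuous (fun p : R * R => k3 p.1 p.2)).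

Lemma dual_test_coupling (s1 s2 s3 t xi : R) : xi <= 1 ->
  oint (fun x => psi (x + m * t) * (s1 * k1 x xi + s2 * k2 x xi + s3 * k3 x xi)) xi 1 =
  s1 * dual_test m k1 psi t xi + s2 * dual_test m k2 psi t xi
  + s3 * dual_test m k3 psi t xi.
Proof.
move=> x1; rewrite -intg_oint//; last by cont.
have i1 : itgb xi 1 (fun x => psi (x + m * t) * k1 x xi) by apply: itgb_continuous; cont.
have i2 : itgb xi 1 (fun x => psi (x + m * t) * k2 x xi) by apply: itgb_continuous; cont.
have i3 : itgb xi 1 (fun x => psi (x + m * t) * k3 x xi) by apply: itgb_continuous; cont.
rewrite /dual_test -(intgZ s1 i1) -(intgZ s2 i2) -(intgZ s3 i3).
have j1 := itgbZ s1 i1; have j2 := itgbZ s2 i2; have j3 := itgbZ s3 i3.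
rewrite -(intgD j1 j2) -(intgD (itgbD j1 j2) j3).
by apply: eq_intg => x _; ring.
Qed.

(** This carries the boundary condition of the third kernel over to the dual
    functions, where it cancels the inflow terms of [u1] and [u2]. *)
Lemma dual_test_inflow (s1 s2 s3 t : R) :
  (forall x, 0 <= x <= 1 -> s3 * k3 x 0 = s1 * k1 x 0 + s2 * k2 x 0) ->
  s3 * dual_test m k3 psi t 0 =
  s1 * dual_test m k1 psi t 0 + s2 * dual_test m k2 psi t 0.
Proof.
move=> h.
have i1 : itgb 0 1 (fun x => psi (x + m * t) * k1 x 0) by apply: itgb_continuous; cont.
have i2 : itgb 0 1 (fun x => psi (x + m * t) * k2 x 0) by apply: itgb_continuous; cont.
have i3 : itgb 0 1 (fun x => psi (x + m * t) * k3 x 0) by apply: itgb_continuous; cont.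
rewrite /dual_test -(intgZ s1 i1) -(intgZ s2 i2) -(intgZ s3 i3).
rewrite -(intgD (itgbZ s1 i1) (itgbZ s2 i2)).
by apply: eq_intg => x hx; rewrite mulrCA (h x hx); ring.
Qed.

End Coupling.

(** * The backstepping variable *)
Section Backstepping.
Context {R : realType}.
Variables (c : coeffs R) (q1 q2 : R) (k1 k2 k3 : R -> R -> R).
Let m := mu c.
Hypotheses (mu0 : 0 < mu c) (g10 : 0 < gamma1 c) (g20 : 0 < gamma2 c).
Hypotheses (ca : continuous (alpha c)) (ct1 : continuous (theta1 c))
  (ct2 : continuous (theta2 c)).
Hypotheses (ck1 : continuous (fun p : R * R => k1 p.1 p.2))
  (ck2 : continuous (fun p : R * R => k2 p.1 p.2))
  (ck3 : continuous (fun p : R * R => k3 p.1 p.2)).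
Hypotheses (keq : kernel_equations c k1 k2 k3)
  (kbc : kernel_boundary_conditions c q1 q2 k1 k2 k3).

Let h1 x xi := sigma11 c * k1 x xi + sigma21 c * k2 x xi + theta1 c xi * k3 x xi.
Let h2 x xi := sigma12 c * k1 x xi + sigma22 c * k2 x xi + theta2 c xi * k3 x xi.
Let h3 x xi := alpha c xi * k1 x xi + alpha c xi * k2 x xi.
Let ch1 : continuous (fun p : R * R => h1 p.1 p.2). Proof. by rewrite /h1; cont. Qed.
Let ch2 : continuous (fun p : R * R => h2 p.1 p.2). Proof. by rewrite /h2; cont. Qed.
Let ch3 : continuous (fun p : R * R => h3 p.1 p.2). Proof. by rewrite /h3; cont. Qed.

Section FixedTest.
Variables (psi : R -> R) (cpsi : continuous psi).

Let S1 := source_right m k1 h1 psi (gamma1 c).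
Let S2 := source_right m k2 h2 psi (gamma2 c).
Let S3 := source_left m k3 h3 psi.
(* On [[0, 1]] these are the dual functions of the kernels ([Q1E], [Q2E], [Q3E]);
   in this form they can serve as test functions. *)
Let Q1 := charint (gamma1 c) (fun r y => S1 r (y + gamma1 c * r)).
Let Q2 := charint (gamma2 c) (fun r y => S2 r (y + gamma2 c * r)).
Let Q3 := charint (- m) (fun r y => S3 r (y + - m * r)).

Let cS1 : continuous (fun p : R * R => S1 p.1 p.2).
Proof. exact: continuous_source_right. Qed.
Let cS2 : continuous (fun p : R * R => S2 p.1 p.2).
Proof. exact: continuous_source_right. Qed.
Let cS3 : continuous (fun p : R * R => S3 p.1 p.2).
Proof. exact: continuous_source_left. Qed.
Let cG1 : continuous (fun p : R * R => S1 p.1 (p.2 + gamma1 c * p.1)). Proof. by cont. Qed.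
Let cG2 : continuous (fun p : R * R => S2 p.1 (p.2 + gamma2 c * p.1)). Proof. by cont. Qed.
Let cG3 : continuous (fun p : R * R => S3 p.1 (p.2 + - m * p.1)). Proof. by cont. Qed.
Let cQ1 : continuous (fun p : R * R => Q1 p.1 p.2).
Proof. exact: (continuous_charint (c := gamma1 c) cG1). Qed.
Let cQ2 : continuous (fun p : R * R => Q2 p.1 p.2).
Proof. exact: (continuous_charint (c := gamma2 c) cG2). Qed.
Let cQ3 : continuous (fun p : R * R => Q3 p.1 p.2).
Proof. exact: (continuous_charint (c := - m) cG3). Qed.

Let Q1E t xi : 0 <= xi <= 1 -> Q1 t xi = dual_test m k1 psi t xi.
Proof. by move=> hxi; apply: dual_test_right => //; case: keq. Qed.
Let Q2E t xi : 0 <= xi <= 1 -> Q2 t xi = dual_test m k2 psi t xi.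
Proof. by move=> hxi; apply: dual_test_right => //; case: keq. Qed.
Let Q3E t xi : 0 <= xi <= 1 -> Q3 t xi = dual_test m k3 psi t xi.
Proof. by move=> hxi; apply: dual_test_left => //; case: keq. Qed.

(** The kernel equations say that, tested against the dual functions, the
    couplings inside the domain cancel and only the value at [x = 1] remains,
    which is what the feedback law compensates. *)
Let balance (t : R) (v1 v2 v3 : R -> R) : itgb 0 1 v1 -> itgb 0 1 v2 -> itgb 0 1 v3 ->
  let f1 x := sigma11 c * v1 x + sigma12 c * v2 x + alpha c x * v3 x in
  let f2 x := sigma21 c * v1 x + sigma22 c * v2 x + alpha c x * v3 x in
  let f3 x := theta1 c x * v1 x + theta2 c x * v2 x in
  \int[leb]_(x in `[0, 1]) (psi (x + m * t) * f3 x)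
  - (\int[leb]_(x in `[0, 1]) (S1 t x * v1 x) + \int[leb]_(x in `[0, 1]) (Q1 t x * f1 x))
  - (\int[leb]_(x in `[0, 1]) (S2 t x * v2 x) + \int[leb]_(x in `[0, 1]) (Q2 t x * f2 x))
  - (\int[leb]_(x in `[0, 1]) (S3 t x * v3 x) + \int[leb]_(x in `[0, 1]) (Q3 t x * f3 x)) =
  (- (m * psi (1 + m * t))) *
    \int[leb]_(x in `[0, 1]) (k1 1 x * v1 x + k2 1 x * v2 x + k3 1 x * v3 x).
Proof.
move=> i1 i2 i3 f1 f2 f3.
have if1 : itgb 0 1 f1.
  by apply: itgbD; [apply: itgbD; exact: itgbZ|exact: itgbM_continuous].
have if2 : itgb 0 1 f2.
  by apply: itgbD; [apply: itgbD; exact: itgbZ|exact: itgbM_continuous].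
have if3 : itgb 0 1 f3 by apply: itgbD; exact: itgbM_continuous.
have cpsit : continuous (fun x => psi (x + m * t)).
  by cont.
have j0 : itgb 0 1 (fun x => psi (x + m * t) * f3 x) := itgbM_continuous cpsit if3.
have j1 : itgb 0 1 (fun x => S1 t x * v1 x) := itgbM_continuous (cont_slice (t := t) cS1) i1.
have j2 : itgb 0 1 (fun x => S2 t x * v2 x) := itgbM_continuous (cont_slice (t := t) cS2) i2.
have j3 : itgb 0 1 (fun x => S3 t x * v3 x) := itgbM_continuous (cont_slice (t := t) cS3) i3.
have l1 : itgb 0 1 (fun x => Q1 t x * f1 x) := itgbM_continuous (cont_slice (t := t) cQ1) if1.
have l2 : itgb 0 1 (fun x => Q2 t x * f2 x) := itgbM_continuous (cont_slice (t := t) cQ2) if2.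
have l3 : itgb 0 1 (fun x => Q3 t x * f3 x) := itgbM_continuous (cont_slice (t := t) cQ3) if3.
have n1 : itgb 0 1 (fun x => k1 1 x * v1 x) := itgbM_continuous (cont_slice (t := 1) ck1) i1.
have n2 : itgb 0 1 (fun x => k2 1 x * v2 x) := itgbM_continuous (cont_slice (t := 1) ck2) i2.
have n3 : itgb 0 1 (fun x => k3 1 x * v3 x) := itgbM_continuous (cont_slice (t := 1) ck3) i3.
apply: eq_trans (esym (intg_balance j0 j1 l1 j2 l2 j3 l3)) _.
apply: eq_trans _ (intgZ _ (itgbD (itgbD n1 n2) n3)).
apply: eq_intg => x hx.
have /andP[x0 x1] := hx.
have gm1 : gamma1 c + m != 0 by apply: lt0r_neq0; exact: addr_gt0.
have gm2 : gamma2 c + m != 0 by apply: lt0r_neq0; exact: addr_gt0.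
have [b1 b2 _] := kbc hx.
rewrite (Q1E t hx) (Q2E t hx) (Q3E t hx).
rewrite /S1 /S2 /S3 /source_right /source_left b1 b2.
rewrite (dual_test_coupling m cpsi ck1 ck2 ck3 (sigma11 c) (sigma21 c) (theta1 c x) t x1).
rewrite (dual_test_coupling m cpsi ck1 ck2 ck3 (sigma12 c) (sigma22 c) (theta2 c x) t x1).
have -> : oint (fun z => psi (z + m * t) * h3 z x) x 1 =
    alpha c x * dual_test m k1 psi t x + alpha c x * dual_test m k2 psi t x.
  have := dual_test_coupling m cpsi ck1 ck2 ck3 (alpha c x) (alpha c x) 0 t x1.
  rewrite mul0r addr0 => <-; apply: eq_oint => z; rewrite /h3.
  by rewrite mul0r addr0.
rewrite /f1 /f2 /f3 -/m.
move: (dual_test _ _ _ _ _) (dual_test _ _ _ _ _) (dual_test _ _ _ _ _).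
by move=> d1 d2 d3; field; rewrite gm1 gm2.
Qed.

Variables (u1 u2 w : R -> R -> R) (z1 z2 z y1 y2 y : R -> R).
Let f1 t x := sigma11 c * u1 t x + sigma12 c * u2 t x + alpha c x * w t x.
Let f2 t x := sigma21 c * u1 t x + sigma22 c * u2 t x + alpha c x * w t x.
Let f3 t x := theta1 c x * u1 t x + theta2 c x * u2 t x.
Hypotheses (sol1 : weak_transport (gamma1 c) u1 f1 z1 y1)
  (sol2 : weak_transport (gamma2 c) u2 f2 z2 y2)
  (sol3 : weak_transport (- m) w f3 z y).
Hypothesis inflow : {ae leb, forall t : R, 0 < t -> z1 t = q1 * z t /\ z2 t = q2 * z t}.
Hypothesis feedback : {ae leb, forall t : R, 0 < t ->
  y t = \int[leb]_(x in `[0, 1]) (k1 1 x * u1 t x + k2 1 x * u2 t x + k3 1 x * w t x)}.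

Definition backstepping (v1 v2 v3 : R -> R) (x : R) : R :=
  v3 x - \int[leb]_(xi in `[0, x]) (k1 x xi * v1 xi + k2 x xi * v2 xi + k3 x xi * v3 xi).

Let Volterra (k : R -> R -> R) (v : R -> R) x := \int[leb]_(xi in `[0, x]) (k x xi * v xi).

(** Fubini's theorem on the triangle moves the kernels onto the test function. *)
Let test_backstepping (t : R) (v1 v2 v3 : R -> R) :
  itgb 0 1 v1 -> itgb 0 1 v2 -> itgb 0 1 v3 ->
  \int[leb]_(x in `[0, 1]) (psi (x + m * t) * backstepping v1 v2 v3 x) =
  \int[leb]_(x in `[0, 1]) (psi (x + m * t) * v3 x)
  - \int[leb]_(x in `[0, 1]) (Q1 t x * v1 x) - \int[leb]_(x in `[0, 1]) (Q2 t x * v2 x)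
  - \int[leb]_(x in `[0, 1]) (Q3 t x * v3 x).
Proof.
move=> i1 i2 i3.
have key (k : R -> R -> R) (v : R -> R) : continuous (fun p : R * R => k p.1 p.2) ->
    itgb 0 1 v ->
    itgb 0 1 (fun x => psi (x + m * t) * Volterra k v x) /\
    \int[leb]_(x in `[0, 1]) (psi (x + m * t) * Volterra k v x) =
    \int[leb]_(x in `[0, 1]) (dual_test m k psi t x * v x).
  move=> ck iv.
  have cK : continuous (fun p : R * R => psi (p.1 + m * t) * k p.1 p.2) by cont.
  have [_ h2' h3'] := fubini_triangle_up (K := fun x xi => psi (x + m * t) * k x xi) ler01 cK iv.
  have E (x : R) : 0 <= x <= 1 -> \int[leb]_(xi in `[0, x]) (v xi * (psi (x + m * t) * k x xi)) =
      psi (x + m * t) * Volterra k v x.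
    move=> /andP[x0 x1]; have ikv : itgb 0 x (fun xi => k x xi * v xi).
      exact: itgbM_continuous (cont_slice (t := x) ck) (itgb_sub (lexx 0) x1 iv).
    rewrite /Volterra -(intgZ _ ikv); apply: eq_intg => xi _; ring.
  split; first by apply: eq_itgb h2' => x hx; rewrite E.
  transitivity (\int[leb]_(x in `[0, 1]) \int[leb]_(xi in `[0, x]) (v xi * (psi (x + m * t) * k x xi))).
    by apply: eq_intg => x hx; rewrite E.
  by rewrite h3'; apply: eq_intg => x _; rewrite mulrC.
have [n1 e1] := key k1 v1 ck1 i1.
have [n2 e2] := key k2 v2 ck2 i2.
have [n3 e3] := key k3 v3 ck3 i3.
have cpsit : continuous (fun x => psi (x + m * t)).
  by cont.
have j3 : itgb 0 1 (fun x => psi (x + m * t) * v3 x) := itgbM_continuous cpsit i3.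
have d1 : \int[leb]_(x in `[0, 1]) (Q1 t x * v1 x) = \int[leb]_(x in `[0, 1]) (dual_test m k1 psi t x * v1 x).
  by apply: eq_intg => x hx; rewrite Q1E.
have d2 : \int[leb]_(x in `[0, 1]) (Q2 t x * v2 x) = \int[leb]_(x in `[0, 1]) (dual_test m k2 psi t x * v2 x).
  by apply: eq_intg => x hx; rewrite Q2E.
have d3 : \int[leb]_(x in `[0, 1]) (Q3 t x * v3 x) = \int[leb]_(x in `[0, 1]) (dual_test m k3 psi t x * v3 x).
  by apply: eq_intg => x hx; rewrite Q3E.
rewrite d1 d2 d3 -e1 -e2 -e3.
rewrite -(intgB j3 n1) -(intgB (itgbB j3 n1) n2) -(intgB (itgbB (itgbB j3 n1) n2) n3).
apply: eq_intg => x /andP[x0 x1].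
have ikv (k : R -> R -> R) (v : R -> R) : continuous (fun p : R * R => k p.1 p.2) ->
    itgb 0 1 v -> itgb 0 x (fun xi => k x xi * v xi).
  move=> ck iv.
  exact: itgbM_continuous (cont_slice (t := x) ck) (itgb_sub (lexx 0) x1 iv).
have a1 := ikv _ _ ck1 i1; have a2 := ikv _ _ ck2 i2; have a3 := ikv _ _ ck3 i3.
rewrite /backstepping /Volterra (intgD (itgbD a1 a2) a3) (intgD a1 a2).
by move: (Rintegral _ _ _) (Rintegral _ _ _) (Rintegral _ _ _) => *; ring.
Qed.

Let cf1 : continuous_in_L2 f1.
Proof.
apply: continuous_in_L2D; last exact: continuous_in_L2M ca (weak_transport_L2 sol3).
by apply: continuous_in_L2D; apply: (continuous_in_L2M (@cont_cst _ _ _));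
  [exact: weak_transport_L2 sol1|exact: weak_transport_L2 sol2].
Qed.
Let cf2 : continuous_in_L2 f2.
Proof.
apply: continuous_in_L2D; last exact: continuous_in_L2M ca (weak_transport_L2 sol3).
by apply: continuous_in_L2D; apply: (continuous_in_L2M (@cont_cst _ _ _));
  [exact: weak_transport_L2 sol1|exact: weak_transport_L2 sol2].
Qed.
Let cf3 : continuous_in_L2 f3.
Proof.
by apply: continuous_in_L2D; [exact: continuous_in_L2M ct1 (weak_transport_L2 sol1)
  |exact: continuous_in_L2M ct2 (weak_transport_L2 sol2)].
Qed.

Let state t := backstepping (u1 t) (u2 t) (w t).

(** The weak form of [dt beta - mu dx beta = 0], [beta(t, 1) = 0],
    [beta(t, 0) = z t].  What [balance] leaves at [x = 1] is the feedback, which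
    cancels the trace [y]; the inflow terms at [x = 0] cancel by the boundary
    condition of [k3]. *)
Lemma backstepping_transport (T : R) : 0 < T ->
  \int[leb]_(x in `[0, 1]) (psi (x + m * T) * state T x)
  - \int[leb]_(x in `[0, 1]) (psi (x + m * 0) * state 0 x) =
  - m * \int[leb]_(t in `[0, T]) (psi (m * t) * z t).
Proof.
move=> T0; have T0' := ltW T0.
have L1 t : 0 <= t -> itgb 0 1 (u1 t).
  by move=> t0; exact: sqi_itgb (continuous_in_L2_sqi (weak_transport_L2 sol1) t0).
have L2 t : 0 <= t -> itgb 0 1 (u2 t).
  by move=> t0; exact: sqi_itgb (continuous_in_L2_sqi (weak_transport_L2 sol2) t0).
have L3 t : 0 <= t -> itgb 0 1 (w t).
  by move=> t0; exact: sqi_itgb (continuous_in_L2_sqi (weak_transport_L2 sol3) t0).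
have g1n := lt0r_neq0 g10; have g2n := lt0r_neq0 g20.
have mn : - m != 0 by rewrite oppr_eq0; exact: lt0r_neq0.
pose s t := \int[leb]_(x in `[0, 1]) (psi (x + m * t) * f3 t x).
pose a1 t := \int[leb]_(x in `[0, 1]) (S1 t x * u1 t x).
pose a2 t := \int[leb]_(x in `[0, 1]) (S2 t x * u2 t x).
pose a3 t := \int[leb]_(x in `[0, 1]) (S3 t x * w t x).
pose b1 t := \int[leb]_(x in `[0, 1]) (Q1 t x * f1 t x).
pose b2 t := \int[leb]_(x in `[0, 1]) (Q2 t x * f2 t x).
pose b3 t := \int[leb]_(x in `[0, 1]) (Q3 t x * f3 t x).
pose e1 t := Q1 t 0 * z1 t.
pose e2 t := Q2 t 0 * z2 t.
pose e3 t := Q3 t 0 * z t.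
pose b t := bdr (- m) z y psi t.
have cpsit : continuous (fun p : R * R => psi (p.2 + m * p.1)) by cont.
have is_ : itgb 0 T s := itgb_intg_L2 (g := fun t x => psi (x + m * t)) T (lexx 0) cf3 cpsit.
have ia1 : itgb 0 T a1 := itgb_intg_L2 T (lexx 0) (weak_transport_L2 sol1) cS1.
have ia2 : itgb 0 T a2 := itgb_intg_L2 T (lexx 0) (weak_transport_L2 sol2) cS2.
have ia3 : itgb 0 T a3 := itgb_intg_L2 T (lexx 0) (weak_transport_L2 sol3) cS3.
have ib1 : itgb 0 T b1 := itgb_intg_L2 T (lexx 0) cf1 cQ1.
have ib2 : itgb 0 T b2 := itgb_intg_L2 T (lexx 0) cf2 cQ2.
have ib3 : itgb 0 T b3 := itgb_intg_L2 T (lexx 0) cf3 cQ3.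
have swapc (F : R -> R -> R) : continuous (fun p : R * R => F p.1 p.2) ->
    continuous (fun t => F t 0) by move=> cF; cont.
have ie1 : itgb 0 T e1 := itgbM_continuous (swapc _ cQ1) (weak_transport_itgb0 sol1 T0).
have ie2 : itgb 0 T e2 := itgbM_continuous (swapc _ cQ2) (weak_transport_itgb0 sol2 T0).
have ie3 : itgb 0 T e3 := itgbM_continuous (swapc _ cQ3) (weak_transport_itgb0 sol3 T0).
have ib : itgb 0 T b := itgb_bdr sol3 T cpsi.
have D1 : \int[leb]_(x in `[0, 1]) (Q1 T x * u1 T x) - \int[leb]_(x in `[0, 1]) (Q1 0 x * u1 0 x) =
    (\int[leb]_(t in `[0, T]) a1 t + \int[leb]_(t in `[0, T]) b1 t)
    + gamma1 c * \int[leb]_(t in `[0, T]) e1 t.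
  apply: eq_trans (duhamel_test sol1 cf1 g1n T0 cG1) _; rewrite -(intgD ia1 ib1).
  apply: (congr1 (fun i => i + _)); apply: eq_intg => t _.
  by apply: (congr1 (fun i => i + _)); apply: eq_intg => x _; rewrite subrK.
have D2 : \int[leb]_(x in `[0, 1]) (Q2 T x * u2 T x) - \int[leb]_(x in `[0, 1]) (Q2 0 x * u2 0 x) =
    (\int[leb]_(t in `[0, T]) a2 t + \int[leb]_(t in `[0, T]) b2 t)
    + gamma2 c * \int[leb]_(t in `[0, T]) e2 t.
  apply: eq_trans (duhamel_test sol2 cf2 g2n T0 cG2) _; rewrite -(intgD ia2 ib2).
  apply: (congr1 (fun i => i + _)); apply: eq_intg => t _.
  by apply: (congr1 (fun i => i + _)); apply: eq_intg => x _; rewrite subrK.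
have D3 : \int[leb]_(x in `[0, 1]) (Q3 T x * w T x) - \int[leb]_(x in `[0, 1]) (Q3 0 x * w 0 x) =
    (\int[leb]_(t in `[0, T]) a3 t + \int[leb]_(t in `[0, T]) b3 t)
    + - m * \int[leb]_(t in `[0, T]) e3 t.
  apply: eq_trans (duhamel_test sol3 cf3 mn T0 cG3) _; rewrite -(intgD ia3 ib3).
  apply: (congr1 (fun i => i + _)); apply: eq_intg => t _.
  by apply: (congr1 (fun i => i + _)); apply: eq_intg => x _; rewrite subrK.
have arg t x : x - - m * t = x + m * t by rewrite mulNr opprK.
have Dw : \int[leb]_(x in `[0, 1]) (psi (x + m * T) * w T x)
    - \int[leb]_(x in `[0, 1]) (psi (x + m * 0) * w 0 x) =
    \int[leb]_(t in `[0, T]) s t + m * \int[leb]_(t in `[0, T]) b t.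
  have h := transport_test sol3 cf3 T0' cpsi.
  have e B : - (- m * B) = m * B by rewrite mulNr opprK.
  apply: eq_trans (eq_trans _ h) _.
    by rewrite /mom; congr (_ - _); apply: eq_intg => x _; rewrite arg.
  rewrite -(e (\int[leb]_(t in `[0, T]) b t)).
  apply: (congr1 (fun i => i - (- m * \int[leb]_(t in `[0, T]) b t))).
  apply: eq_intg => t _.
  by apply: eq_intg => x _; rewrite arg.
pose n t := s t - (a1 t + b1 t) - (a2 t + b2 t) - (a3 t + b3 t).
have in_ : itgb 0 T n.
  exact: itgbB (itgbB (itgbB is_ (itgbD ia1 ib1)) (itgbD ia2 ib2)) (itgbD ia3 ib3).
have nE := intg_balance is_ ia1 ib1 ia2 ib2 ia3 ib3.
have [iF FE] := intg_boundary m (gamma1 c) (gamma2 c) in_ ib ie1 ie2 ie3.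
have ipz : itgb 0 T (fun t => psi (m * t) * z t).
  by apply: itgbM_continuous (weak_transport_itgb0 sol3 T0); cont.
have bcE t : m * Q3 t 0 = q1 * gamma1 c * Q1 t 0 + q2 * gamma2 c * Q2 t 0.
  have h0 : (fun x : R => 0 <= x <= 1) 0 by rewrite lexx ler01.
  rewrite (Q1E t h0) (Q2E t h0) (Q3E t h0).
  by apply: (dual_test_inflow m cpsi ck1 ck2 ck3) => x /kbc[].
have ae : {ae leb, forall t : R, 0 < t ->
    n t + m * b t - gamma1 c * e1 t - gamma2 c * e2 t + m * e3 t =
    - m * (psi (m * t) * z t)}.
  move: inflow feedback; apply: filterS2; first exact: (ae_filter_ringOfSetsType leb).
  move=> t hin hfb t0; have [hz1 hz2] := hin t0; have hy := hfb t0.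
  have nt : n t = - (m * psi (1 + m * t)) * y t.
    by rewrite hy; apply: balance; [exact: L1 (ltW t0)|exact: L2 (ltW t0)|exact: L3 (ltW t0)].
  rewrite nt /b /bdr !arg add0r /e1 /e2 /e3 hz1 hz2.
  have -> : m * (Q3 t 0 * z t) = (m * Q3 t 0) * z t by ring.
  rewrite bcE.
  move: (Q1 t 0) (Q2 t 0) (psi _) (psi _) => d1 d2 d3 d4; ring.
have tot := eq_trans (esym FE) (eq_trans (ae_eq_intg iF (itgbZ (- m) ipz) ae) (intgZ (- m) ipz)).
have BT := test_backstepping T (L1 T T0') (L2 T T0') (L3 T T0').
have B0 := test_backstepping 0 (L1 0 (lexx 0)) (L2 0 (lexx 0)) (L3 0 (lexx 0)).
rewrite /state; apply: (eq_trans (congr2 (fun a b => a - b) BT B0)).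
apply: (eq_trans _ tot).
rewrite [X in _ = X + _ - _ - _ + _]nE.
exact: balance_bookkeeping D1 D2 D3 Dw.
Qed.

End FixedTest.
End Backstepping.

(** * Changes of variable and growth *)
Section Estimates.
Context {R : realType}.
Implicit Types (chi psi v : R -> R).

Lemma le_intg_sub (a b c d : R) (f : R -> R) : a <= c -> c <= d -> d <= b ->
  itgb a b f -> (forall x, a <= x <= b -> 0 <= f x) ->
  \int[leb]_(x in `[c, d]) f x <= \int[leb]_(x in `[a, b]) f x.
Proof.
move=> ac cd db hf f0.
have hf' : itgb c b f by exact: itgb_sub ac (lexx b) hf.
rewrite (intg_cat ac (le_trans cd db) hf) (intg_cat cd db hf').
have p1 : 0 <= \int[leb]_(x in `[a, c]) f x.
  apply: intg_ge0 => x /andP[h1 h2]; apply: f0; rewrite h1 (le_trans h2)//.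
  exact: le_trans cd db.
have p2 : 0 <= \int[leb]_(x in `[d, b]) f x.
  apply: intg_ge0 => x /andP[h1 h2]; apply: f0; rewrite h2 andbT.
  by rewrite (le_trans ac)// (le_trans cd).
by rewrite addrCA lerDl addr_ge0.
Qed.

(** The affine image of [[0, 1]] may leave [[0, 1]], but [chi] has no mass
    there, so the change of variable costs only the Jacobian. *)
Lemma nrm_affine chi (a b : R) : b != 0 -> continuous chi ->
  (forall x, x <= 0 \/ 1 <= x -> chi x = 0) ->
  nrm 0 1 (fun x => chi (a + b * x)) <= (Num.sqrt `|b|)^-1 * nrm 0 1 chi.
Proof.
move=> b0 cchi chi0.
have c2 : continuous (fun x => chi x ^+ 2) by cont.
have [F dF] := continuous_primitive c2.
have F_mono x y : x <= y -> F x <= F y.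
  move=> xy; rewrite -subr_ge0 -(intg_primitive xy c2 dF).
  by apply: intg_ge0 => z _; exact: sqr_ge0.
have F_le x : F x <= F 1.
  have [x1|x1] := leP x 1; first exact: F_mono.
  rewrite -subr_le0 -(intg_primitive (ltW x1) c2 dF).
  rewrite (@eq_intg _ _ _ _ (fun=> 0)) => [|z /andP[z1 _]].
    by rewrite (intg_cst _ (ltW x1)) mul0r.
  by rewrite chi0 ?expr0n//; right.
have F_ge x : F 0 <= F x.
  have [x1|x1] := leP 0 x; first exact: F_mono.
  rewrite -subr_le0 -(intg_primitive (ltW x1) c2 dF).
  rewrite (@eq_intg _ _ _ _ (fun=> 0)) => [|z /andP[_ z1]].
    by rewrite (intg_cst _ (ltW x1)) mul0r.
  by rewrite chi0 ?expr0n//; left.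
rewrite -sqrtrV; last exact: normr_ge0.
rewrite /nrm -sqrtrM ?invr_ge0//; apply: ler_wsqrtr.
rewrite ler_pdivlMl ?normr_gt0//.
rewrite (intg_primitive ler01 c2 dF).
have dG := is_derive_affine a b dF.
have cG : continuous (fun x => b * chi (a + b * x) ^+ 2) by cont.
have := intg_primitive ler01 cG dG.
rewrite intgZ; last by apply: itgb_continuous; cont.
rewrite mulr1 mulr0 addr0 => e.
have : `|b * \int[leb]_(x in `[0, 1]) chi (a + b * x) ^+ 2| <= F 1 - F 0.
  rewrite e ler_norml; have := F_le (a + b); have := F_ge (a + b).
  by have := F_le a; have := F_ge a; move: (F _) (F a) (F 0) (F 1) => *; lra.
rewrite normrM [X in _ * X]ger0_norm//.
by apply: intg_ge0 => x _; exact: sqr_ge0.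
Qed.

Lemma nrm_shift chi (a : R) : continuous chi ->
  (forall x, x <= 0 \/ 1 <= x -> chi x = 0) ->
  nrm 0 1 (fun x => chi (a + x)) <= nrm 0 1 chi.
Proof.
move=> cchi chi0; have := nrm_affine a (oner_neq0 R) cchi chi0.
rewrite normr1 sqrtr1 invr1 mul1r; apply: le_trans.
by rewrite le_eqVlt; apply/orP; left; apply/eqP/eq_nrm => x _; rewrite mul1r.
Qed.

Lemma gronwall (kappa A : R) (Y : R -> R) : 0 <= kappa -> continuous Y ->
  (forall T : R, 0 <= T -> Y T <= A + kappa * \int[leb]_(t in `[0, T]) Y t) ->
  forall T : R, 0 <= T -> Y T <= A * expR (kappa * T).
Proof.
move=> k0 cY hY T T0; have [F dF] := continuous_primitive cY.
pose G t := expR (- kappa * t) * (A + kappa * (F t - F 0)).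
have dG (t : R) : is_derive t 1 G
    (- kappa * expR (- kappa * t) * (A + kappa * (F t - F 0))
     + expR (- kappa * t) * (kappa * Y t)).
  have d1 : is_derive t 1 (fun t => expR (- kappa * t)) (- kappa * expR (- kappa * t)).
    have := @is_derive_affine R (@expR R) (@expR R) 0 (- kappa) (fun x => is_derive_expR x) t.
    by under eq_fun do rewrite add0r; rewrite add0r.
  have d2 : is_derive t 1 (fun t => A + kappa * (F t - F 0)) (kappa * Y t).
    rewrite -[kappa * Y t]add0r; apply: is_deriveD; apply: is_deriveZ.
    by rewrite -[Y t]subr0; exact: is_deriveB.
  rewrite addrC [- kappa * _ * _]mulrC.
  exact: is_deriveM.
have mono : G T <= G 0.
  move: T0; rewrite le_eqVlt => /predU1P[<-//|T0].
  have cG : {within `[0, T], continuous G}.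
    apply: continuous_subspaceT => y; apply: differentiable_continuous.
    by apply/derivable1_diffP; have := dG y; case.
  have [s] := MVT T0 (fun t _ => dG t) cG.
  rewrite in_itv/= => /andP[s0 sT] e.
  rewrite -subr_le0 e subr0; apply: mulr_le0_ge0; last exact: ltW.
  have := hY s (ltW s0); rewrite (intg_primitive (ltW s0) cY dF) => h.
  rewrite (_ : _ + _ = expR (- kappa * s) * (kappa * (Y s - (A + kappa * (F s - F 0))))); last by ring.
  apply: mulr_ge0_le0; first exact: expR_ge0.
  by apply: mulr_ge0_le0 => //; rewrite subr_le0.
have := hY T T0; rewrite (intg_primitive T0 cY dF) => /le_trans; apply.
move: mono; rewrite /G mulr0 expR0 mul1r subrr mulr0 addr0 mulNr expRN.
by rewrite ler_pdivrMl ?expR_gt0// [expR _ * A]mulrC.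
Qed.

End Estimates.

(** * Decay under transport *)
Section Decay.
Context {R : realType}.
(* [stE] is the weak form of the transport of [state] to the left, without
   inflow, with trace [z] at [x = 0]. *)
Variables (m : R) (state : R -> R -> R) (z : R -> R).
Hypothesis m0 : 0 < m.
Hypothesis sst : forall t : R, 0 <= t -> sqi 0 1 (state t).
Hypothesis iz : forall T : R, 0 < T -> itgb 0 T z.
Hypothesis stE : forall psi : R -> R, continuous psi -> forall T : R, 0 < T ->
  \int[leb]_(x in `[0, 1]) (psi (x + m * T) * state T x)
  - \int[leb]_(x in `[0, 1]) (psi (x + m * 0) * state 0 x) =
  - m * \int[leb]_(t in `[0, T]) (psi (m * t) * z t).

(** Up to the time [m^-1] the state is a translate of its initial value, cut off
    at [x = 0], and later it vanishes.  The exponential bound is a weaker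
    statement that covers both regimes for every rate [lam]. *)
Lemma state_decay (lam T : R) : 0 <= lam -> 0 <= T ->
  nrm 0 1 (state T) <= expR (lam * (m^-1 - T)) * nrm 0 1 (state 0).
Proof.
move=> lam0; rewrite le_eqVlt => /predU1P[<-|T0].
  rewrite subr0 ler_peMl ?nrm_ge0// -expR0 ler_expR mulr_ge0// invr_ge0 ltW//.
apply: duality; [exact: sst (ltW T0)|by rewrite mulr_ge0 ?expR_ge0 ?nrm_ge0|].
move=> chi cchi chi0.
have cpsi : continuous (fun s => chi (s - m * T)) by cont.
have cpsi' : continuous (fun x => chi (- (m * T) + x)) by cont.
have := stE cpsi T0.
rewrite (@eq_intg _ _ _ (fun t => chi (m * t - m * T) * z t) (fun=> 0)); last first.
  move=> t /andP[_ tT]; rewrite chi0 ?mul0r//; left.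
  by rewrite subr_le0; apply: ler_wpM2l tT; exact: ltW.
rewrite (intg_cst _ (ltW T0)) mul0r [- m * 0]mulr0 => /eqP; rewrite subr_eq0 => /eqP e.
rewrite (@eq_intg _ _ _ _ (fun x => chi (x + m * T - m * T) * state T x)); last first.
  by move=> x _; rewrite addrK.
rewrite e (@eq_intg _ _ _ _ (fun x => chi (- (m * T) + x) * state 0 x)); last first.
  by move=> x _; rewrite mulr0 addr0 addrC.
have [mT|mT] := leP 1 (m * T).
  rewrite (@eq_intg _ _ _ _ (fun=> 0)).
    by rewrite (intg_cst _ ler01) mul0r normr0 !mulr_ge0 ?nrm_ge0 ?expR_ge0.
  by move=> x /andP[_ x1]; rewrite chi0 ?mul0r//; left; lra.
apply: le_trans (cauchy_schwarz (sqi_continuous 0 1 cpsi') (sst (lexx 0))) _.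
have h1 : 1 <= expR (lam * (m^-1 - T)).
  rewrite -expR0 ler_expR mulr_ge0// subr_ge0 -[m^-1]mul1r ler_pdivlMr// mulrC.
  exact: ltW.
have h2 := nrm_shift (- (m * T)) cchi chi0.
rewrite -mulrA [nrm 0 1 (state 0) * _]mulrC mulrA.
apply: (ler_wpM2r (nrm_ge0 _ _ _)); apply: le_trans h2 _.
by rewrite ler_peMl// nrm_ge0.
Qed.

Definition wgt (delta : R) (v : R -> R) (x : R) : R := expR (- (delta * x)) * v x.

Lemma sqi_wgt delta v : sqi 0 1 v -> sqi 0 1 (wgt delta v).
Proof. by move=> sv; apply: sqiM_continuous sv; cont. Qed.

Lemma continuous_nrm_wgt delta (f : R -> R -> R) : continuous_in_L2 f ->
  continuous (fun t : R => nrm 0 1 (wgt delta (f (Num.max t 0)))).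
Proof.
move=> cf; have ce : continuous (fun x : R => expR (- (delta * x))) by cont.
have cg : continuous_in_L2 (fun t => wgt delta (f t)) := continuous_in_L2M ce cf.
move=> t0; apply/cvgrPdist_le => e e0.
have tt (t : R) : 0 <= Num.max t 0 by rewrite le_max lexx orbT.
have cm : continuous (fun t : R => Num.max t 0) by cont.
have : \forall t \near t0, 0 <= Num.max t 0 ->
    nrm 0 1 (fun x => wgt delta (f (Num.max t 0)) x - wgt delta (f (Num.max t0 0)) x) <= e.
  exact: (cm t0 _ (near_continuous_in_L2 cg (tt t0) e0)).
apply: filterS => t /(_ (tt t)) h.
have s1 := continuous_in_L2_sqi cg (tt t); have s0 := continuous_in_L2_sqi cg (tt t0).
rewrite ler_norml; apply/andP; split.
  by rewrite lerNl opprB; apply: le_trans h; exact: nrmB.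
by apply: le_trans h; rewrite nrm_subC; exact: nrmB.
Qed.

Lemma itgb_nrm_wgt delta lam (f : R -> R -> R) (T : R) : continuous_in_L2 f ->
  itgb 0 T (fun t => expR (lam * t) * nrm 0 1 (wgt delta (f t))).
Proof.
move=> cf; have cn := continuous_nrm_wgt (delta := delta) cf.
have cF : continuous (fun t : R => expR (lam * t) * nrm 0 1 (wgt delta (f (Num.max t 0)))).
  by apply: contM cn; cont.
apply: eq_itgb (itgb_continuous 0 T cF) => t /andP[t0 _].
by rewrite max_l.
Qed.

Section Rightward.
Variables (c q : R) (u f : R -> R -> R) (z1 y1 : R -> R).
Hypothesis c0 : 0 < c.
Hypothesis sol : weak_transport c u f z1 y1.
Hypothesis cf : continuous_in_L2 f.
Hypothesis inflow : {ae leb, forall t : R, 0 < t -> z1 t = q * z t}.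
Variables (delta lam : R).
Hypotheses (lam0 : 0 <= lam) (lamdelta : lam <= delta * c).

(** The gain from the initial [state] to the inflow signal [q * z].  Reading at
    speed [c] a signal emitted at speed [m] costs the Jacobian [c / m]; since
    the signal has ceased at time [1 / m], the factor [expR (lam * t)] costs at
    most [expR (lam / m)]. *)
Definition inflow_gain : R := c * `|q| / m * ((Num.sqrt (c / m))^-1 * expR (lam / m)).

(** Moving to the right by [c * (T - t)] multiplies the weighted norm by
    [expR (- (delta * c * (T - t)))], whence the rate [delta * c >= lam].  A test
    function that vanishes outside [(0, 1)] at time [T] vanishes at [x = 1]
    before, so the outflow does not enter. *)
Lemma transport_decay (T : R) : 0 <= T ->
  nrm 0 1 (wgt delta (u T)) <= expR (- (lam * T)) *
   (nrm 0 1 (wgt delta (u 0))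
    + \int[leb]_(t in `[0, T]) (expR (lam * t) * nrm 0 1 (wgt delta (f t)))
    + inflow_gain * nrm 0 1 (state 0)).
Proof.
have cu := weak_transport_L2 sol.
have gain0 : 0 <= inflow_gain.
  by rewrite /inflow_gain !mulr_ge0 ?invr_ge0 ?sqrtr_ge0 ?expR_ge0 ?(ltW c0) ?(ltW m0).
rewrite le_eqVlt => /predU1P[<-|T0].
  rewrite intg_point mulr0 oppr0 expR0 mul1r addr0 lerDl mulr_ge0// nrm_ge0//.
have T0' := ltW T0.
set N := nrm 0 1 (wgt delta (u 0)).
set I := Rintegral _ _ _.
set B := nrm 0 1 (state 0).
have N0 : 0 <= N by exact: nrm_ge0.
have B0 : 0 <= B by exact: nrm_ge0.
have I0 : 0 <= I by apply: intg_ge0 => t _; rewrite mulr_ge0 ?expR_ge0 ?nrm_ge0.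
have su (t : R) : 0 <= t -> sqi 0 1 (wgt delta (u t)).
  by move=> t0; apply: sqi_wgt; exact: continuous_in_L2_sqi cu t0.
have sf (t : R) : 0 <= t -> sqi 0 1 (wgt delta (f t)).
  by move=> t0; apply: sqi_wgt; exact: continuous_in_L2_sqi cf t0.
apply: duality; [exact: su|by rewrite mulr_ge0 ?expR_ge0// !addr_ge0// mulr_ge0|].
move=> chi cchi chi0.
pose X := nrm 0 1 chi.
have X0 : 0 <= X by exact: nrm_ge0.
pose psi s := chi (s + c * T) * expR (- (delta * (s + c * T))).
have cpsi : continuous psi by rewrite /psi; cont.
(* A contribution entering at time [t], seen at time [T]. *)
have pair (t : R) v : 0 <= t <= T -> sqi 0 1 (wgt delta v) ->
    `|\int[leb]_(x in `[0, 1]) (psi (x - c * t) * v x)| <=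
    expR (- (lam * T)) * (expR (lam * t) * nrm 0 1 (wgt delta v)) * X.
  move=> /andP[t0 tT] sv.
  pose a := c * (T - t).
  have a0 : 0 <= a by rewrite mulr_ge0 ?subr_ge0// ltW.
  have cchia : continuous (fun x => chi (a + x)) by cont.
  rewrite (@eq_intg _ _ _ _ (fun x => (expR (- (delta * a)) * chi (a + x)) * wgt delta v x)); last first.
    move=> x _; rewrite /psi /wgt (_ : x - c * t + c * T = a + x); last by rewrite /a; ring.
    by rewrite mulrDr opprD expRD; ring.
  have se : sqi 0 1 (fun x => expR (- (delta * a)) * chi (a + x)) by apply: sqi_continuous; cont.
  apply: le_trans (cauchy_schwarz se sv) _.
  rewrite (nrmZ _ (sqi_continuous 0 1 cchia)) ger0_norm ?expR_ge0//.
  have e1 : expR (- (delta * a)) <= expR (- (lam * T)) * expR (lam * t).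
    rewrite -expRD ler_expR /a mulrA.
    have : lam * (T - t) <= delta * c * (T - t) by apply: ler_wpM2r; rewrite ?subr_ge0.
    by move: (delta * c) => dc; lra.
  have e2 := nrm_shift a cchi chi0.
  set W := nrm 0 1 (wgt delta v); set E := expR (- (lam * T)) in e1 *.
  have -> : E * (expR (lam * t) * W) * X = (E * expR (lam * t) * X) * W by ring.
  apply: (ler_wpM2r (nrm_ge0 _ _ _)).
  by apply: ler_pM => //; rewrite ?expR_ge0 ?nrm_ge0.
have chi_psi (t : R) : t <= T -> psi (1 - c * t) = 0.
  move=> tT; rewrite /psi chi0 ?mul0r//; right.
  have : c * t <= c * T by apply: ler_wpM2l tT; exact: ltW.
  lra.
have := transport_test sol cf T0' cpsi.
have -> : mom c u psi T = \int[leb]_(x in `[0, 1]) (chi x * wgt delta (u T) x).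
  by apply: eq_intg => x _; rewrite /psi subrK /wgt mulrA.
have hm := pair 0 (u 0); rewrite lexx T0' [lam * 0]mulr0 expR0 mul1r in hm.
have {}hm := hm isT (su 0 (lexx 0)).
have is_ := itgb_src c cf T cpsi.
have hs : `|\int[leb]_(t in `[0, T]) src c f psi t| <= expR (- (lam * T)) * I * X.
  apply: le_trans (normr_intg is_) _.
  have iI := itgb_nrm_wgt delta lam T cf.
  rewrite /I -(intgZ _ iI) mulrC -(intgZ _ (itgbZ _ iI)).
  apply: le_intg; [exact: itgb_norm|by apply: itgbZ; exact: itgbZ|].
  move=> t ht; rewrite [X * _]mulrC; have /andP[t0 _] := ht.
  exact: (pair _ _ ht (sf t t0)).
pose psi' s := psi (- (c / m) * s).
have cpsi' : continuous psi' by rewrite /psi'; cont.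
have mn : m != 0 by exact: lt0r_neq0.
have cmn : c / m != 0 by rewrite lt0r_neq0// divr_gt0.
have izp : itgb 0 T (fun t => psi' (m * t) * z t).
  by apply: itgbM_continuous (iz T0); cont.
have hb : \int[leb]_(t in `[0, T]) bdr c z1 y1 psi t =
    - q * \int[leb]_(t in `[0, T]) (psi' (m * t) * z t).
  rewrite -(intgZ _ izp).
  have iby : itgb 0 T (fun t => - (psi (0 - c * t) * z1 t)).
    by apply: itgbN; apply: itgbM_continuous (weak_transport_itgb0 sol T0); cont.
  transitivity (\int[leb]_(t in `[0, T]) - (psi (0 - c * t) * z1 t)).
    by apply: eq_intg => t /andP[_ tT]; rewrite /bdr chi_psi// mul0r add0r.
  apply: (ae_eq_intg iby (itgbZ _ izp)).
  move: inflow; apply: filterS; first exact: (ae_filter_ringOfSetsType leb).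
  move=> t ht t0; rewrite (ht t0) /psi'.
  have -> : - (c / m) * (m * t) = 0 - c * t by field.
  by ring.
(* The trace integral, read along the characteristics of [state], is an integral
   of its initial value; the term at time [T] vanishes with [chi]. *)
have hz : m * \int[leb]_(t in `[0, T]) (psi' (m * t) * z t) =
    \int[leb]_(x in `[0, 1]) (psi' x * state 0 x).
  have := stE cpsi' T0.
  rewrite (@eq_intg _ _ _ (fun x => psi' (x + m * T) * state T x) (fun=> 0)); last first.
    move=> x /andP[x0 _]; rewrite /psi' /psi chi0 ?mul0r//; left.
    have -> : - (c / m) * (x + m * T) + c * T = - ((c / m) * x) by field.
    by rewrite oppr_le0 mulr_ge0// divr_ge0 ?ltW.
  rewrite (intg_cst _ ler01) mul0r sub0r mulNr => /oppr_inj <-.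
  by apply: eq_intg => x _; rewrite mulr0 addr0.
have hz' : `|\int[leb]_(x in `[0, 1]) (psi' x * state 0 x)| <=
    expR (- (lam * T)) * ((Num.sqrt (c / m))^-1 * expR (lam / m)) * B * X.
  have sp : sqi 0 1 psi' by exact: sqi_continuous.
  apply: le_trans (cauchy_schwarz sp (sst (lexx 0))) _.
  rewrite -/B -[leRHS]mulrA [B * X]mulrC mulrA; apply: (ler_wpM2r B0).
  pose a := c * T.
  have cca : continuous (fun x => chi (a + - (c / m) * x)) by cont.
  have sca : sqi 0 1 (fun x => expR (lam / m - lam * T) * chi (a + - (c / m) * x)).
    by apply: sqi_continuous; cont.
  have cmn' : - (c / m) != 0 by rewrite oppr_eq0.
  have cm0 : 0 <= c / m by apply: divr_ge0; exact: ltW.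
  have := nrm_affine a cmn' cchi chi0; rewrite normrN (ger0_norm cm0) => h2.
  apply: (@le_trans _ _ (expR (lam / m - lam * T) * ((Num.sqrt (c / m))^-1 * X))).
    apply: le_trans (ler_wpM2l (expR_ge0 _) h2).
    rewrite -[X in X * nrm _ _ _]ger0_norm ?expR_ge0// -(nrmZ _ (sqi_continuous 0 1 cca)).
    apply: le_nrm => // x /andP[x0 x1]; rewrite /psi' /psi (addrC _ (c * T)) -/a.
    have [h|h] := leP (a + - (c / m) * x) 0.
      by rewrite chi0 ?mul0r ?mulr0//; left.
    rewrite normrM [leRHS]normrM mulrC; apply: ler_wpM2r => //.
    rewrite !ger0_norm ?expR_ge0// ler_expR.
    have cE : a + - (c / m) * x = c * (T - x / m) by rewrite /a; field.
    rewrite cE in h *; have Tx : 0 < T - x / m by rewrite pmulr_rgt0 in h.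
    have l1 : lam * (T - x / m) <= delta * c * (T - x / m).
      by apply: ler_wpM2r => //; exact: ltW.
    have l2 : lam * (x / m) <= lam * (1 / m).
      by apply: ler_wpM2l => //; apply: ler_wpM2r => //; rewrite invr_ge0 ltW.
    rewrite mulrA; move: l1 l2; rewrite mul1r !mulrBr; lra.
  rewrite expRD [expR (- _)]lock le_eqVlt -lock; apply/orP; left; apply/eqP; ring.
move=> e.
have {}e : \int[leb]_(x in `[0, 1]) (chi x * wgt delta (u T) x) =
    \int[leb]_(x in `[0, 1]) (psi (x - c * 0) * u 0 x)
    + \int[leb]_(t in `[0, T]) src c f psi t
    + c * q / m * \int[leb]_(x in `[0, 1]) (psi' x * state 0 x).
  rewrite -hz; move/eqP: e; rewrite subr_eq hb => /eqP ->; rewrite /mom.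
  move: (Rintegral _ _ _) (Rintegral _ _ _) (Rintegral _ _ _) => i1 i2 i3.
  by field.
rewrite e; apply: le_trans (ler_normD _ _) _.
rewrite mulrDr mulrDl; apply: lerD.
  apply: le_trans (ler_normD _ _) _.
  by rewrite mulrDr mulrDl; apply: lerD.
rewrite normrM; apply: le_trans (ler_wpM2l (normr_ge0 _) hz') _.
rewrite !normrM normfV (ger0_norm (ltW c0)) (ger0_norm (ltW m0)).
rewrite le_eqVlt /inflow_gain; apply/orP; left; apply/eqP.
by rewrite -/X; ring.
Qed.

End Rightward.
End Decay.

(** * Volterra operators in weighted norms *)
Section Volterra.
Context {R : realType}.
Implicit Types (v : R -> R) (delta : R).

Lemma nrm_cst (C : R) : nrm 0 1 (fun=> C) = `|C|.
Proof. by rewrite /nrm (intg_cst _ ler01) subr0 mulr1 sqrtr_sqr. Qed.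

Lemma nrm_wgt_le delta v : 0 <= delta -> sqi 0 1 v ->
  nrm 0 1 (wgt delta v) <= nrm 0 1 v.
Proof.
move=> d0 sv; apply: le_nrm => //; first exact: sqi_wgt.
move=> x /andP[x0 _]; rewrite /wgt normrM ger0_norm ?expR_ge0// ler_piMl//.
by rewrite -expR0 ler_expR oppr_le0 mulr_ge0.
Qed.

Lemma nrm_le_wgt delta v : 0 <= delta -> sqi 0 1 v ->
  nrm 0 1 v <= expR delta * nrm 0 1 (wgt delta v).
Proof.
move=> d0 sv; rewrite -[X in X * _]ger0_norm ?expR_ge0// -(nrmZ _ (sqi_wgt delta sv)).
apply: le_nrm => //; first by apply: sqiZ; exact: sqi_wgt.
move=> x /andP[x0 x1]; rewrite /wgt mulrA -expRD normrM ger0_norm ?expR_ge0//.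
rewrite ler_peMl// -expR0 ler_expR subr_ge0.
by rewrite -[leRHS]mulr1; apply: ler_wpM2l.
Qed.

Definition volterra (k : R -> R -> R) v x :=
  \int[leb]_(xi in `[0, x]) (k x xi * v xi).

Variables (k : R -> R -> R) (M : R).
Hypothesis ck : continuous (fun p : R * R => k p.1 p.2).
Hypothesis kM : forall x y : R, 0 <= x <= 1 -> 0 <= y <= 1 -> `|k x y| <= M.

Let M0 : 0 <= M.
Proof.
have h : (fun x : R => 0 <= x <= 1) 0 by rewrite lexx ler01.
exact: le_trans (normr_ge0 _) (kM h h).
Qed.

Lemma measurable_volterra v : itgb 0 1 v -> measurable_fun `[0 : R, 1] (volterra k v).
Proof.
move=> iv; have [_ h _] := fubini_triangle_up ler01 ck iv.
apply: itgb_measurable; apply: eq_itgb h => x _.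
by apply: eq_intg => y _; rewrite mulrC.
Qed.

(** Conjugation by the weight multiplies the kernel by
    [expR (- (delta * (x - xi)))], whose [L^2] norm in [xi <= x] is at most
    [1 / Num.sqrt (2 * delta)]: the larger [delta], the smaller the operator. *)
Lemma volterra_bound delta v (x : R) : 0 < delta -> sqi 0 1 v -> 0 <= x <= 1 ->
  `|wgt delta (volterra k v) x| <= M / Num.sqrt (2 * delta) * nrm 0 1 (wgt delta v).
Proof.
move=> d0 sv hx; have /andP[x0 x1] := hx.
have sv' : sqi 0 x (wgt delta v) := sqi_sub (lexx 0) x1 (sqi_wgt delta sv).
have iv : itgb 0 x v := sqi_itgb (sqi_sub (lexx 0) x1 sv).
have ckx : continuous (k x) := cont_slice (t := x) ck.
pose a xi := expR (- (delta * (x - xi))) * k x xi.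
have ca : continuous a by rewrite /a; cont.
have -> : wgt delta (volterra k v) x = \int[leb]_(xi in `[0, x]) (a xi * wgt delta v xi).
  rewrite /wgt /volterra -(intgZ _ (itgbM_continuous ckx iv)).
  apply: eq_intg => xi _; rewrite /a.
  have -> : expR (- (delta * x)) = expR (- (delta * (x - xi))) * expR (- (delta * xi)).
    by rewrite -expRD; congr expR; ring.
  by ring.
apply: le_trans (cauchy_schwarz (sqi_continuous 0 x ca) sv') _.
apply: ler_pM; [exact: nrm_ge0|exact: nrm_ge0| |]; last first.
  apply: ler_wsqrtr; apply: le_intg_sub => //.
  - exact: sqi_sqr (sqi_wgt delta sv).
  - by move=> y _; exact: sqr_ge0.
have d2 : 0 < 2 * delta by rewrite mulr_gt0.
have dn : 2 * delta != 0 by exact: lt0r_neq0.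
have cE : continuous (fun xi : R => expR (- (2 * delta * x) + 2 * delta * xi)) by cont.
have dF := is_derive_affine (- (2 * delta * x)) (2 * delta) (fun y : R => is_derive_expR y).
have cdF : continuous (fun xi : R => 2 * delta * expR (- (2 * delta * x) + 2 * delta * xi)) by cont.
rewrite -[M]ger0_norm// -sqrtr_sqr -sqrtrV ?(ltW d2)// -sqrtrM ?sqr_ge0//.
apply: ler_wsqrtr.
apply: (@le_trans _ _ (\int[leb]_(xi in `[0, x])
   (M ^+ 2 / (2 * delta) * (2 * delta * expR (- (2 * delta * x) + 2 * delta * xi))))).
  apply: le_intg.
  - by apply: itgb_continuous; cont.
  - by apply: itgb_continuous; cont.
  move=> xi /andP[xi0 xix].
  rewrite mulrA divfK// /a exprMn mulrC.
  have -> : expR (- (delta * (x - xi))) ^+ 2 = expR (- (2 * delta * x) + 2 * delta * xi).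
    by rewrite expr2 -expRD; congr expR; ring.
  apply: ler_wpM2r; first exact: expR_ge0.
  rewrite -[leLHS]ger0_norm ?sqr_ge0// normrX lerXn2r ?nnegrE//.
  by apply: kM => //; rewrite xi0 (le_trans xix).
rewrite (intgZ _ (itgb_continuous _ _ cdF)) (intg_primitive x0 cdF dF).
rewrite ler_piMr//; first by rewrite divr_ge0 ?sqr_ge0// ltW.
by rewrite addNr expR0 mulr0 addr0 gerBl expR_ge0.
Qed.

Lemma sqi_volterra v : sqi 0 1 v -> sqi 0 1 (volterra k v).
Proof.
move=> sv; have mv := measurable_volterra (sqi_itgb sv).
have sw : sqi 0 1 (wgt 1 (volterra k v)).
  apply: sqi_bounded; last by move=> x hx; exact: volterra_bound ltr01 sv hx.
  apply: measurable_funM => //; apply: continuous_measurable => //; cont.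
have := sqi_wgt (- 1) sw.
rewrite (_ : wgt (-1) (wgt 1 (volterra k v)) = volterra k v)//.
apply/funext => x; rewrite /wgt mulrA -expRD mulN1r opprK mul1r subrr expR0.
by rewrite mul1r.
Qed.

Lemma nrm_wgt_volterra delta v : 0 < delta -> sqi 0 1 v ->
  nrm 0 1 (wgt delta (volterra k v)) <= M / Num.sqrt (2 * delta) * nrm 0 1 (wgt delta v).
Proof.
move=> d0 sv; set C := leRHS.
have C0 : 0 <= C by rewrite /C mulr_ge0 ?nrm_ge0// divr_ge0 ?sqrtr_ge0.
rewrite -[C]ger0_norm// -nrm_cst; apply: le_nrm.
- by apply: sqi_wgt; exact: sqi_volterra.
- exact: (sqi_continuous 0 1 (@cont_cst _ _ C)).
- by move=> x hx; rewrite [leRHS]ger0_norm//; exact: volterra_bound.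
Qed.

(** The case [delta = 2^-1] of the weighted bound, for which the constant in front of
    [M] is [1]. *)
Lemma nrm_volterra v : sqi 0 1 v ->
  nrm 0 1 (volterra k v) <= expR 2^-1 * M * nrm 0 1 v.
Proof.
move=> sv; have h0 : 0 < 2^-1 :> R by rewrite invr_gt0.
apply: le_trans (nrm_le_wgt (ltW h0) (sqi_volterra sv)) _.
rewrite -mulrA; apply: ler_wpM2l; first exact: expR_ge0.
apply: le_trans (nrm_wgt_volterra h0 sv) _.
rewrite divff// sqrtr1 divr1; apply: ler_wpM2l => //.
exact: nrm_wgt_le (ltW h0) sv.
Qed.

End Volterra.

Section BacksteppingBounds.
Context {R : realType}.
Variables (k1 k2 k3 : R -> R -> R) (M : R).
Hypotheses (ck1 : continuous (fun p : R * R => k1 p.1 p.2))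
  (ck2 : continuous (fun p : R * R => k2 p.1 p.2))
  (ck3 : continuous (fun p : R * R => k3 p.1 p.2)).
Hypotheses (kM1 : forall x y : R, 0 <= x <= 1 -> 0 <= y <= 1 -> `|k1 x y| <= M)
  (kM2 : forall x y : R, 0 <= x <= 1 -> 0 <= y <= 1 -> `|k2 x y| <= M)
  (kM3 : forall x y : R, 0 <= x <= 1 -> 0 <= y <= 1 -> `|k3 x y| <= M).
Variables v1 v2 v3 : R -> R.
Hypotheses (s1 : sqi 0 1 v1) (s2 : sqi 0 1 v2) (s3 : sqi 0 1 v3).

Let b := backstepping k1 k2 k3 v1 v2 v3.
Let V1 := volterra k1 v1.
Let V2 := volterra k2 v2.
Let V3 := volterra k3 v3.
Let sV1 : sqi 0 1 V1 := sqi_volterra ck1 kM1 s1.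
Let sV2 : sqi 0 1 V2 := sqi_volterra ck2 kM2 s2.
Let sV3 : sqi 0 1 V3 := sqi_volterra ck3 kM3 s3.

Lemma backsteppingE (x : R) : 0 <= x <= 1 -> b x = v3 x - V1 x - V2 x - V3 x.
Proof.
move=> /andP[x0 x1].
have h (k : R -> R -> R) (v : R -> R) : continuous (fun p : R * R => k p.1 p.2) ->
    sqi 0 1 v -> itgb 0 x (fun xi => k x xi * v xi).
  move=> ck sv; apply: itgbM_continuous (cont_slice (t := x) ck) _.
  exact: sqi_itgb (sqi_sub (lexx 0) x1 sv).
have i1 := h _ _ ck1 s1; have i2 := h _ _ ck2 s2; have i3 := h _ _ ck3 s3.
rewrite /b /backstepping (intgD (itgbD i1 i2) i3) (intgD i1 i2) /V1 /V2 /V3 /volterra.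
by move: (Rintegral _ _ _) (Rintegral _ _ _) (Rintegral _ _ _) => *; ring.
Qed.

Lemma sqi_backstepping : sqi 0 1 b.
Proof.
have s : sqi 0 1 (fun x => v3 x - V1 x - V2 x - V3 x).
  by apply: sqiB sV3; apply: sqiB sV2; exact: sqiB s3 sV1.
case: s => ms is_; split.
  apply: eq_measurable_fun ms => x; rewrite inE/= in_itv/= => hx.
  by rewrite backsteppingE.
by apply: eq_itgb is_ => x hx; rewrite backsteppingE.
Qed.

Lemma nrm_backstepping_le : nrm 0 1 b <=
  (1 + expR 2^-1 * M) * (nrm 0 1 v1 + nrm 0 1 v2 + nrm 0 1 v3).
Proof.
have h1 := nrm_volterra ck1 kM1 s1; have h2 := nrm_volterra ck2 kM2 s2.
have h3 := nrm_volterra ck3 kM3 s3.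
rewrite (eq_nrm backsteppingE).
have t3 (a e : R -> R) : sqi 0 1 a -> sqi 0 1 e ->
    nrm 0 1 (fun x => a x - e x) <= nrm 0 1 a + nrm 0 1 e.
  move=> sa se; have := nrmD sa (sqiZ (-1) se); rewrite nrmZ// normrN1 mul1r.
  by under eq_fun do rewrite mulN1r.
have e1 := t3 _ _ s3 sV1.
have e2 := t3 _ _ (sqiB s3 sV1) sV2.
have e3 := t3 _ _ (sqiB (sqiB s3 sV1) sV2) sV3.
have n1 := nrm_ge0 0 1 v1; have n2 := nrm_ge0 0 1 v2.
move: h1 h2 h3 e1 e2 e3 n1 n2; rewrite -/V1 -/V2 -/V3.
move: (nrm _ _ _) (nrm _ _ _) (nrm _ _ _) (nrm _ _ _) (nrm _ _ _) (nrm _ _ _)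
  (nrm _ _ _) (nrm _ _ _) (nrm _ _ _) (expR _ * M).
by move=> *; lra.
Qed.

(** The weighted Volterra operators have norm at most [2^-1], so that the term in
    [v3] under the integral can be absorbed.  The constants do not depend on
    [delta]. *)
Lemma nrm_wgt_of_backstepping (delta : R) : 0 < delta -> M / Num.sqrt (2 * delta) <= 2^-1 ->
  nrm 0 1 (wgt delta v3) <=
  2 * nrm 0 1 b + nrm 0 1 (wgt delta v1) + nrm 0 1 (wgt delta v2).
Proof.
move=> d0 hM; have d0' := ltW d0.
have half (k : R -> R -> R) (v : R -> R) : continuous (fun p : R * R => k p.1 p.2) ->
    (forall x y : R, 0 <= x <= 1 -> 0 <= y <= 1 -> `|k x y| <= M) -> sqi 0 1 v ->
    nrm 0 1 (wgt delta (volterra k v)) <= 2^-1 * nrm 0 1 (wgt delta v).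
  move=> ck kM sv; apply: le_trans (nrm_wgt_volterra ck kM d0 sv) _.
  exact: ler_wpM2r (nrm_ge0 _ _ _) _ _ hM.
have h1 := half _ _ ck1 kM1 s1; have h2 := half _ _ ck2 kM2 s2.
have h3 := half _ _ ck3 kM3 s3.
have sb := sqi_wgt delta sqi_backstepping.
have w1 := sqi_wgt delta sV1; have w2 := sqi_wgt delta sV2; have w3 := sqi_wgt delta sV3.
have e1 := nrmD sb w1; have e2 := nrmD (sqiD sb w1) w2.
have e3 := nrmD (sqiD (sqiD sb w1) w2) w3.
have hb := nrm_wgt_le d0' sqi_backstepping.
have -> : nrm 0 1 (wgt delta v3) =
    nrm 0 1 (fun x => wgt delta b x + wgt delta V1 x + wgt delta V2 x + wgt delta V3 x).
  by apply: eq_nrm => x hx; rewrite /wgt backsteppingE//; ring.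
have e0 : nrm 0 1 (fun x => wgt delta b x + wgt delta V1 x + wgt delta V2 x + wgt delta V3 x)
    = nrm 0 1 (wgt delta v3).
  by apply: eq_nrm => x hx; rewrite /wgt backsteppingE//; ring.
rewrite -e0 in h3.
move: h1 h2 h3 e1 e2 e3 hb; rewrite -/V1 -/V2 -/V3.
move: (nrm _ _ _) (nrm _ _ _) (nrm _ _ _) (nrm _ _ _) (nrm _ _ _) (nrm _ _ _)
  (nrm _ _ _) (nrm _ _ _) (nrm _ _ _) (nrm _ _ _).
by move=> *; lra.
Qed.

End BacksteppingBounds.

(** * Decay of the closed loop *)
Section StateNorm.
Context {R : realType}.
Implicit Types v : R -> R.

Lemma L2normE v : L2norm v = nrm 0 1 v. Proof. by []. Qed.

Lemma state_norm_le v1 v2 v3 :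
  state_norm v1 v2 v3 <= nrm 0 1 v1 + nrm 0 1 v2 + nrm 0 1 v3.
Proof.
have n1 := nrm_ge0 0 1 v1; have n2 := nrm_ge0 0 1 v2; have n3 := nrm_ge0 0 1 v3.
have n0 : 0 <= nrm 0 1 v1 + nrm 0 1 v2 + nrm 0 1 v3 by rewrite !addr_ge0.
rewrite -[leRHS]ger0_norm// -sqrtr_sqr; apply: ler_wsqrtr.
rewrite !L2normE.
move: (nrm _ _ _) (nrm _ _ _) (nrm _ _ _) n1 n2 n3 {n0}.
move=> a b e a0 b0 e0; have p1 := mulr_ge0 a0 b0; have p2 := mulr_ge0 a0 e0.
by have p3 := mulr_ge0 b0 e0; rewrite !expr2; lra.
Qed.

Lemma le_state_norm v1 v2 v3 : [/\ nrm 0 1 v1 <= state_norm v1 v2 v3,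
  nrm 0 1 v2 <= state_norm v1 v2 v3 & nrm 0 1 v3 <= state_norm v1 v2 v3].
Proof.
rewrite /state_norm !L2normE.
have h (a s : R) : 0 <= a -> a ^+ 2 <= s -> a <= Num.sqrt s.
  move=> a0 h; rewrite -[a]ger0_norm// -sqrtr_sqr; exact: ler_wsqrtr.
have n1 := nrm_ge0 0 1 v1; have n2 := nrm_ge0 0 1 v2; have n3 := nrm_ge0 0 1 v3.
have p1 := sqr_ge0 (nrm 0 1 v1); have p2 := sqr_ge0 (nrm 0 1 v2).
have p3 := sqr_ge0 (nrm 0 1 v3).
by split; apply: h => //; lra.
Qed.

End StateNorm.

Lemma coupling_arith (R : realType) (A S x1 x2 x3 xb r1 r2 : R) :
  0 <= A -> 0 <= S -> 0 <= x1 -> 0 <= x2 -> 0 <= xb -> 0 <= r1 -> 0 <= r2 ->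
  r1 + r2 + A <= S -> A * x3 <= A * (2 * xb + x1 + x2) ->
  r1 * x1 + r2 * x2 + A * x3 <= 2 * S * (x1 + x2 + xb).
Proof.
move=> A0 S0 N1 N2 Nb p1 p2 h3 h4.
have q1 : r1 * x1 <= (S - A) * x1 by apply: ler_wpM2r => //; lra.
have q2 : r2 * x2 <= (S - A) * x2 by apply: ler_wpM2r => //; lra.
have q3 : A * xb <= S * xb by apply: ler_wpM2r => //; lra.
have q4 := mulr_ge0 S0 N1; have q5 := mulr_ge0 S0 N2.
lra.
Qed.

Lemma growth_arith (R : realType) (a1 a2 i1 i2 g1 g2 b K : R) : i1 + i2 <= K ->
  (a1 + i1 + g1 * b) + (a2 + i2 + g2 * b) <= (a1 + a2 + (g1 + g2) * b) + K.
Proof. by move=> h; rewrite mulrDl; lra. Qed.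

Lemma weights_arith (R : realType) (a1 a2 a3 b Y B : R) : a1 + a2 <= Y -> b <= B ->
  a3 <= 2 * b + a1 + a2 -> a1 + a2 + a3 <= 2 * (Y + B).
Proof. by move=> *; lra. Qed.

Lemma final_arith (R : realType) (y g B P Q N : R) : y <= 2 * N -> 0 <= N ->
  g + (B + B) <= P * (Q * (3 * N)) -> y + g + B + B <= (3 + P * (Q * 3)) * N.
Proof.
move=> h1 h2 h3; rewrite (_ : (3 + _) * N = 3 * N + P * (Q * (3 * N))); last by ring.
by move: (P * _) h3 => r h3; lra.
Qed.

Section ClosedLoop.
Context {R : realType}.
Variables (c : coeffs R) (q1 q2 : R) (k1 k2 k3 : R -> R -> R).
Let m := mu c.
Hypotheses (mu0 : 0 < mu c) (g10 : 0 < gamma1 c) (g20 : 0 < gamma2 c).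
Hypotheses (ca : continuous (alpha c)) (ct1 : continuous (theta1 c))
  (ct2 : continuous (theta2 c)).
Hypotheses (ck1 : continuous (fun p : R * R => k1 p.1 p.2))
  (ck2 : continuous (fun p : R * R => k2 p.1 p.2))
  (ck3 : continuous (fun p : R * R => k3 p.1 p.2)).
Hypotheses (keq : kernel_equations c k1 k2 k3)
  (kbc : kernel_boundary_conditions c q1 q2 k1 k2 k3).

Section Solution.
Variables (u1 u2 w : R -> R -> R) (z1 z2 z y1 y2 y : R -> R).
Let f1 t x := sigma11 c * u1 t x + sigma12 c * u2 t x + alpha c x * w t x.
Let f2 t x := sigma21 c * u1 t x + sigma22 c * u2 t x + alpha c x * w t x.
Let f3 t x := theta1 c x * u1 t x + theta2 c x * u2 t x.
Hypotheses (sol1 : weak_transport (gamma1 c) u1 f1 z1 y1)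
  (sol2 : weak_transport (gamma2 c) u2 f2 z2 y2)
  (sol3 : weak_transport (- m) w f3 z y).
Hypothesis inflow : {ae leb, forall t : R, 0 < t -> z1 t = q1 * z t /\ z2 t = q2 * z t}.
Hypothesis feedback : {ae leb, forall t : R, 0 < t ->
  y t = \int[leb]_(x in `[0, 1]) (k1 1 x * u1 t x + k2 1 x * u2 t x + k3 1 x * w t x)}.

Variables (M A delta lam : R).
Hypotheses (kM1 : forall x y : R, 0 <= x <= 1 -> 0 <= y <= 1 -> `|k1 x y| <= M)
  (kM2 : forall x y : R, 0 <= x <= 1 -> 0 <= y <= 1 -> `|k2 x y| <= M)
  (kM3 : forall x y : R, 0 <= x <= 1 -> 0 <= y <= 1 -> `|k3 x y| <= M).
Hypothesis alphaA : forall x : R, 0 <= x <= 1 -> `|alpha c x| <= A.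
Hypotheses (d0 : 0 < delta) (dM : M / Num.sqrt (2 * delta) <= 2^-1).
Variable S : R.
Hypotheses (S1 : `|sigma11 c| + `|sigma12 c| + A <= S)
  (S2 : `|sigma21 c| + `|sigma22 c| + A <= S).
Hypothesis lamE : lam = 4 * S + 1.
Hypotheses (lam1 : lam <= delta * gamma1 c) (lam2 : lam <= delta * gamma2 c).

Let cu1 : continuous_in_L2 u1 := weak_transport_L2 sol1.
Let cu2 : continuous_in_L2 u2 := weak_transport_L2 sol2.
Let cw : continuous_in_L2 w := weak_transport_L2 sol3.
Let s1 (t : R) : 0 <= t -> sqi 0 1 (u1 t). Proof. exact: continuous_in_L2_sqi. Qed.
Let s2 (t : R) : 0 <= t -> sqi 0 1 (u2 t). Proof. exact: continuous_in_L2_sqi. Qed.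
Let s3 (t : R) : 0 <= t -> sqi 0 1 (w t). Proof. exact: continuous_in_L2_sqi. Qed.
Let cf1 : continuous_in_L2 f1.
Proof.
apply: continuous_in_L2D; last exact: continuous_in_L2M ca cw.
by apply: continuous_in_L2D; apply: (continuous_in_L2M (@cont_cst _ _ _)).
Qed.
Let cf2 : continuous_in_L2 f2.
Proof.
apply: continuous_in_L2D; last exact: continuous_in_L2M ca cw.
by apply: continuous_in_L2D; apply: (continuous_in_L2M (@cont_cst _ _ _)).
Qed.

Let A0 : 0 <= A.
Proof.
have h : (fun x : R => 0 <= x <= 1) 0 by rewrite lexx ler01.
exact: le_trans (normr_ge0 _) (alphaA h).
Qed.
Let S0 : 0 <= S. Proof. by apply: le_trans S1; rewrite !addr_ge0. Qed.
Let lam0 : 0 <= lam. Proof. by rewrite lamE addr_ge0// mulr_ge0. Qed.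

Let state (t : R) := backstepping k1 k2 k3 (u1 t) (u2 t) (w t).
Let sst (t : R) : 0 <= t -> sqi 0 1 (state t).
Proof. by move=> t0; apply: (sqi_backstepping ck1 ck2 ck3 kM1 kM2 kM3); [exact: s1|exact: s2|exact: s3]. Qed.
Let iz (T : R) : 0 < T -> itgb 0 T z. Proof. exact: (weak_transport_itgb0 sol3). Qed.
Let stE (psi : R -> R) : continuous psi -> forall T : R, 0 < T ->
  \int[leb]_(x in `[0, 1]) (psi (x + m * T) * state T x)
  - \int[leb]_(x in `[0, 1]) (psi (x + m * 0) * state 0 x) =
  - m * \int[leb]_(t in `[0, T]) (psi (m * t) * z t).
Proof.
move=> cpsi T T0.
exact: (backstepping_transport mu0 g10 g20 ca ct1 ct2 ck1 ck2 ck3 keq kbc cpsi sol1 sol2 sol3 inflow feedback).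
Qed.

Let n1 (t : R) := nrm 0 1 (wgt delta (u1 t)).
Let n2 (t : R) := nrm 0 1 (wgt delta (u2 t)).
Let n3 (t : R) := nrm 0 1 (wgt delta (w t)).
Let b (t : R) := nrm 0 1 (state t).
Let B := expR (lam / m) * b 0.

Let b_decay (t : R) : 0 <= t -> b t <= expR (- (lam * t)) * B.
Proof.
move=> t0; apply: (le_trans (state_decay mu0 (@sst) (@stE) lam0 t0)).
rewrite /B mulrA -expRD -/(b 0); apply: ler_wpM2r; first exact: nrm_ge0.
by rewrite le_eqVlt; apply/orP; left; apply/eqP; congr expR; rewrite mulrBr addrC.
Qed.

Let n3_le (t : R) : 0 <= t -> n3 t <= 2 * b t + n1 t + n2 t.
Proof.
move=> t0.
exact: (nrm_wgt_of_backstepping ck1 ck2 ck3 kM1 kM2 kM3 (s1 t0) (s2 t0) (s3 t0) d0 dM).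
Qed.

(** By [n3_le], [w] is traded for the backstepping variable, [u1] and [u2]; the
    constant does not depend on the weight. *)
Let coupling_le (a1 a2 t : R) : 0 <= t -> `|a1| + `|a2| + A <= S ->
  nrm 0 1 (wgt delta (fun x => a1 * u1 t x + a2 * u2 t x + alpha c x * w t x)) <=
  2 * S * (n1 t + n2 t + b t).
Proof.
move=> t0 h3.
have w1 := sqi_wgt delta (s1 t0); have w2 := sqi_wgt delta (s2 t0).
have w3 := sqi_wgt delta (s3 t0).
have e : nrm 0 1 (wgt delta (fun x => a1 * u1 t x + a2 * u2 t x + alpha c x * w t x)) =
  nrm 0 1 (fun x => a1 * wgt delta (u1 t) x + a2 * wgt delta (u2 t) x
                    + alpha c x * wgt delta (w t) x).
  by apply: eq_nrm => x _; rewrite /wgt; ring.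
rewrite e.
have e1 := nrmD (sqiD (sqiZ a1 w1) (sqiZ a2 w2)) (sqiM_continuous ca w3).
have e2 := nrmD (sqiZ a1 w1) (sqiZ a2 w2).
have e3 : nrm 0 1 (fun x => alpha c x * wgt delta (w t) x) <= A * n3 t.
  rewrite -[A]ger0_norm// -(nrmZ _ w3); apply: le_nrm.
  - exact: sqiM_continuous.
  - exact: sqiZ.
  - move=> x hx; rewrite !normrM; apply: ler_wpM2r => //.
    by rewrite [leRHS]ger0_norm//; exact: alphaA.
rewrite (nrmZ _ w1) (nrmZ _ w2) -/(n1 t) -/(n2 t) in e2.
apply: le_trans e1 _; apply: le_trans (lerD e2 e3) _.
have N1 : 0 <= n1 t := nrm_ge0 _ _ _; have N2 : 0 <= n2 t := nrm_ge0 _ _ _.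
have Nb : 0 <= b t := nrm_ge0 _ _ _.
exact: coupling_arith A0 S0 N1 N2 Nb (normr_ge0 a1) (normr_ge0 a2) h3 (ler_wpM2l A0 (n3_le t0)).
Qed.

Let G := inflow_gain m (gamma1 c) q1 lam + inflow_gain m (gamma2 c) q2 lam.

Let inflow1 : {ae leb, forall t : R, 0 < t -> z1 t = q1 * z t}.
Proof.
move: inflow; apply: filterS; first exact: (ae_filter_ringOfSetsType leb).
by move=> t h t0; have [] := h t0.
Qed.
Let inflow2 : {ae leb, forall t : R, 0 < t -> z2 t = q2 * z t}.
Proof.
move: inflow; apply: filterS; first exact: (ae_filter_ringOfSetsType leb).
by move=> t h t0; have [] := h t0.
Qed.

(** Gronwall's lemma for [Y], where the constant [B] in [Y] dominates the
    contribution of the backstepping variable.  Its exponent [4 * S] loses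
    against [lam], and [1] is the rate that remains. *)
Let growth (T : R) : 0 <= T ->
  n1 T + n2 T <= expR (- T) * (n1 0 + n2 0 + G * b 0 + B).
Proof.
pose Y (t : R) := expR (lam * t) * (n1 t + n2 t) + B.
(* Solutions are given for nonnegative times; [Yc] is continuous on the line. *)
pose Yc (t : R) := expR (lam * Num.max t 0) * (n1 (Num.max t 0) + n2 (Num.max t 0)) + B.
have cYc : continuous Yc.
  apply: contD; last exact: cont_cst.
  apply: contM; first by cont.
  by apply: contD; [exact: continuous_nrm_wgt cu1|exact: continuous_nrm_wgt cu2].
have YcE (t : R) : 0 <= t -> Yc t = Y t by move=> t0; rewrite /Yc /Y max_l.
have iY (t : R) : itgb 0 t Y.
  by apply: eq_itgb (itgb_continuous 0 t cYc) => s /andP[s0 _]; rewrite YcE.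
have B0 : 0 <= B by rewrite /B mulr_ge0 ?expR_ge0 ?nrm_ge0.
pose F (f : R -> R -> R) (t : R) := expR (lam * t) * nrm 0 1 (wgt delta (f t)).
have Fle (t : R) : 0 <= t -> F f1 t + F f2 t <= 4 * S * Y t.
  move=> t0.
  have r1 : nrm 0 1 (wgt delta (f1 t)) <= 2 * S * (n1 t + n2 t + b t) := coupling_le t0 S1.
  have r2 : nrm 0 1 (wgt delta (f2 t)) <= 2 * S * (n1 t + n2 t + b t) := coupling_le t0 S2.
  have hb : expR (lam * t) * b t <= B.
    have := ler_wpM2l (expR_ge0 (lam * t)) (b_decay t0).
    by rewrite mulrA -expRD subrr expR0 mul1r.
  rewrite /F -mulrDr.
  apply: (@le_trans _ _ (expR (lam * t) * (4 * S * (n1 t + n2 t + b t)))).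
    apply: ler_wpM2l; first exact: expR_ge0.
    by have := lerD r1 r2; move: (nrm _ _ _) (nrm _ _ _) => i1 i2 h; lra.
  rewrite mulrCA; apply: ler_wpM2l; first by rewrite mulr_ge0.
  by rewrite /Y mulrDr lerD2l.
have key (t : R) : 0 <= t ->
    Yc t <= (n1 0 + n2 0 + G * b 0 + B) + 4 * S * \int[leb]_(s in `[0, t]) Yc s.
  move=> t0; rewrite YcE//.
  rewrite (@eq_intg _ _ _ Yc Y); last by move=> s /andP[s0' _]; exact: YcE.
  have e1 := transport_decay mu0 (@sst) (@iz) (@stE) g10 sol1 cf1 inflow1 lam0 lam1 t0.
  have e2 := transport_decay mu0 (@sst) (@iz) (@stE) g20 sol2 cf2 inflow2 lam0 lam2 t0.
  have i1 := itgb_nrm_wgt delta lam t cf1; have i2 := itgb_nrm_wgt delta lam t cf2.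
  have hI : \int[leb]_(s in `[0, t]) F f1 s + \int[leb]_(s in `[0, t]) F f2 s <=
      4 * S * \int[leb]_(s in `[0, t]) Y s.
    rewrite -(intgD i1 i2) -(intgZ _ (iY t)).
    apply: le_intg; [exact: itgbD i1 i2|exact: itgbZ|].
    by move=> s /andP[s0' _]; exact: Fle.
  have := ler_wpM2l (expR_ge0 (lam * t)) (lerD e1 e2).
  rewrite -mulrDr [X in _ <= X]mulrA -expRD subrr expR0 mul1r => h.
  rewrite /Y [leRHS]addrAC lerD2r; apply: le_trans h _.
  exact: growth_arith hI.
move=> T0.
have S4 : 0 <= 4 * S by rewrite mulr_ge0.
have := gronwall S4 cYc key T0; rewrite YcE// /Y => h.
have e : expR (- T) = expR (- (lam * T)) * expR (4 * S * T).
  by rewrite -expRD lamE; congr expR; ring.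
have h' : expR (lam * T) * (n1 T + n2 T) <=
   (n1 0 + n2 0 + G * b 0 + B) * expR (4 * S * T).
  by apply: le_trans h; rewrite lerDl.
have := ler_wpM2l (expR_ge0 (- (lam * T))) h'.
rewrite mulrA -expRD addNr expR0 mul1r => /le_trans; apply.
by rewrite e mulrCA mulrC.
Qed.

Lemma solution_decay (t : R) : 0 <= t ->
  state_norm (u1 t) (u2 t) (w t) <=
  2 * expR delta * (3 + (G + 2 * expR (lam / m)) * ((1 + expR 2^-1 * M) * 3)) *
  expR (- t) * state_norm (u1 0) (u2 0) (w 0).
Proof.
move=> t0; set N := state_norm (u1 0) (u2 0) (w 0).
have [N1 N2 N3] := le_state_norm (u1 0) (u2 0) (w 0).
rewrite -/N in N1 N2 N3.
have d0' := ltW d0.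
have gain0 (g q : R) : 0 < g -> 0 <= inflow_gain m g q lam.
  move=> g0; rewrite /inflow_gain.
  by rewrite !mulr_ge0 ?invr_ge0 ?sqrtr_ge0 ?expR_ge0 ?(ltW g0) ?(ltW mu0).
have G0 : 0 <= G by rewrite /G addr_ge0 ?gain0.
have b0le : b 0 <= (1 + expR 2^-1 * M) * (3 * N).
  have l0 : (fun x : R => 0 <= x) 0 by exact: lexx.
  apply: le_trans (nrm_backstepping_le ck1 ck2 ck3 kM1 kM2 kM3 (s1 l0) (s2 l0) (s3 l0)) _.
  apply: ler_wpM2l.
    have h : (fun x : R => 0 <= x <= 1) 0 by rewrite lexx ler01.
    rewrite addr_ge0// mulr_ge0 ?expR_ge0//.
    exact: le_trans (normr_ge0 _) (kM1 h h).
  by move: (nrm _ _ _) (nrm _ _ _) (nrm _ _ _) N1 N2 N3 => *; lra.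
have y0le : n1 0 + n2 0 <= 2 * N.
  have l0 : (fun x : R => 0 <= x) 0 by exact: lexx.
  have h1 := le_trans (nrm_wgt_le d0' (s1 l0)) N1.
  have h2 := le_trans (nrm_wgt_le d0' (s2 l0)) N2.
  by rewrite -/(n1 0) in h1; rewrite -/(n2 0) in h2; lra.
have N0 : 0 <= N by exact: sqrtr_ge0.
have hy := growth t0.
have hb : b t <= expR (- t) * B.
  apply: le_trans (b_decay t0) _; apply: ler_wpM2r.
    by rewrite /B mulr_ge0 ?expR_ge0 ?nrm_ge0.
  rewrite ler_expR lerN2 -[leLHS]mul1r; apply: ler_wpM2r => //.
  by rewrite lamE lerDr mulr_ge0.
apply: le_trans (state_norm_le _ _ _) _.
have u1d := nrm_le_wgt d0' (s1 t0); have u2d := nrm_le_wgt d0' (s2 t0).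
have wd := nrm_le_wgt d0' (s3 t0).
have hw := n3_le t0.
apply: (@le_trans _ _ (expR delta * (n1 t + n2 t + n3 t))).
  by rewrite !mulrDr; apply: lerD => //; apply: lerD.
rewrite [2 * expR delta]mulrC -!mulrA; apply: ler_wpM2l; first exact: expR_ge0.
apply: (@le_trans _ _ (2 * (expR (- t) * (n1 0 + n2 0 + G * b 0 + B) + expR (- t) * B))).
  exact: weights_arith hy hb hw.
apply: ler_wpM2l => //; rewrite -mulrDr mulrCA; apply: ler_wpM2l; first exact: expR_ge0.
have h1 : G * b 0 + (B + B) <= (G + 2 * expR (lam / m)) * ((1 + expR 2^-1 * M) * (3 * N)).
  rewrite /B (_ : _ + _ = (G + 2 * expR (lam / m)) * b 0); last by ring.
  by apply: ler_wpM2l b0le; rewrite addr_ge0// mulr_ge0// expR_ge0.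
exact: final_arith y0le N0 h1.
Qed.

End Solution.
End ClosedLoop.

(** * From the triangle to the plane, and stability *)
Section Retraction.
Context {R : realType}.
Implicit Types (k f : R -> R -> R).

Definition retract_triangle (p : R * R) : R * R :=
  (Num.max 0 (Num.min 1 p.1), Num.max 0 (Num.min (Num.max 0 (Num.min 1 p.1)) p.2)).

(** The kernels are only given on the triangle; composing them with a
    retraction makes them continuous on the whole plane. *)
Definition extend k (x xi : R) : R :=
  k (retract_triangle (x, xi)).1 (retract_triangle (x, xi)).2.

Lemma extend_triangle k (x xi : R) : triangle (x, xi) -> extend k x xi = k x xi.
Proof.
move=> [/= h1 [h2 h3]]; have x0 := le_trans h1 h2.
by rewrite /extend /= (min_r h3) (max_r x0) (min_r h2) (max_r h1).
Qed.

Lemma continuous_extend k : continuous_on_triangle k ->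
  continuous (fun p : R * R => extend k p.1 p.2).
Proof.
move=> ck; have cr : continuous retract_triangle.
  by rewrite /retract_triangle; cont.
have rt p : triangle (retract_triangle p).
  rewrite /triangle /retract_triangle/=; set x := Num.max 0 (Num.min 1 p.1).
  have x0 : 0 <= x by rewrite /x le_max lexx.
  split; first by rewrite le_max lexx.
  split; first by rewrite ge_max x0 ge_min lexx.
  by rewrite /x ge_max ler01 ge_min lexx.
move/subspace_continuousP : ck => ck p.
have cp : retract_triangle q @[q --> p] --> within triangle (nbhs (retract_triangle p)).
  move=> A; rewrite /within/= => hA.
  have h : nbhs p (retract_triangle @^-1` (fun x => triangle x -> A x)) := cr p _ hA.
  change (nbhs p (retract_triangle @^-1` A)).
  by apply: filterS h => q hq; exact: hq (rt q).
have := cvg_comp _ _ cp (ck _ (rt p)).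
by case: p {cp}.
Qed.

Lemma affine_ge0 (p q r s : R) : 0 <= p -> 0 <= p + q * s -> 0 <= r <= s ->
  0 <= p + q * r.
Proof.
move=> p0 h /andP[r0 rs]; have [q0|q0] := leP 0 q.
  by rewrite addr_ge0// mulr_ge0.
by apply: le_trans h _; rewrite lerD2l ler_nM2l.
Qed.

(** By convexity the characteristic stays in the triangle between its end
    points, so only values on the triangle matter. *)
Lemma eq_holds_along_characteristics (a b : R) k k' f f' :
  (forall x xi, triangle (x, xi) -> k' x xi = k x xi) ->
  (forall x xi, triangle (x, xi) -> f' x xi = f x xi) ->
  holds_along_characteristics a b k f -> holds_along_characteristics a b k' f'.
Proof.
move=> kk ff h x xi s s0 T1 T2; rewrite !kk// (h x xi s s0 T1 T2).
apply: eq_intg => r hr; rewrite ff//.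
move: T1 T2; rewrite /triangle/= => -[a1 [a2 a3]] [b1 [b2 b3]].
split; first exact: affine_ge0 a1 b1 hr.
split.
  have e (t : R) : x + a * t - (xi + b * t) = (x - xi) + (a - b) * t by ring.
  rewrite -subr_ge0 e; apply: (affine_ge0 (s := s)) hr; first by rewrite subr_ge0.
  by rewrite -e subr_ge0.
have e (t : R) : 1 - (x + a * t) = (1 - x) + (- a) * t by ring.
rewrite -subr_ge0 e; apply: (affine_ge0 (s := s)) hr; first by rewrite subr_ge0.
by rewrite -e subr_ge0.
Qed.

Lemma triangle_diag (x : R) : 0 <= x <= 1 -> triangle (x, x).
Proof. by move=> /andP[x0 x1]; split. Qed.

Lemma triangle_bottom (x : R) : 0 <= x <= 1 -> triangle (x, 0).
Proof. by move=> /andP[x0 x1]; split; [exact: lexx|split]. Qed.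

Lemma triangle_right (xi : R) : 0 <= xi <= 1 -> triangle (1, xi).
Proof. by move=> /andP[x0 x1]; split => //; split => //; exact: lexx. Qed.

Lemma extend_kernel_solution (c : coeffs R) (q1 q2 : R) k1 k2 k3 :
  kernel_solution c q1 q2 k1 k2 k3 ->
  kernel_equations c (extend k1) (extend k2) (extend k3) /\
  kernel_boundary_conditions c q1 q2 (extend k1) (extend k2) (extend k3).
Proof.
move=> [_ _ _ [e1 e2 e3] bc]; split.
  split; [apply: eq_holds_along_characteristics e1|apply: eq_holds_along_characteristics e2
    |apply: eq_holds_along_characteristics e3] => x xi T; rewrite !extend_triangle//.
move=> x hx; have [b1 b2 b3] := bc x hx.
have T1 := triangle_diag hx; have T2 := triangle_bottom hx.
by rewrite !(extend_triangle _ T1) !(extend_triangle _ T2).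
Qed.

Lemma ae_eq_L2norm (v v' : R -> R) : L2 v -> L2 v' ->
  {ae lebesgue_measure, forall x : R, 0 <= x <= 1 -> v x = v' x} ->
  L2norm v = L2norm v'.
Proof.
move=> [_ s] [_ s'] h; congr (Num.sqrt (fine _)); apply: ae_eq_integral => //.
- exact: measurable_int s.
- exact: measurable_int s'.
- move: h; apply: filterS; first exact: (ae_filter_ringOfSetsType leb).
  by move=> x hx /=; rewrite in_itv/= => /hx ->.
Qed.

End Retraction.

(** The kernels enter the constants only through their maximum [M], which is
    finite by compactness of the triangle. *)
Lemma backstepping_stability (R : realType) (c : coeffs R) (q1 q2 rho1 rho2 : R)
    (k1 k2 k3 : R -> R -> R) :
  0 < mu c -> 0 < gamma1 c -> 0 < gamma2 c ->
  continuous (alpha c) -> continuous (theta1 c) -> continuous (theta2 c) ->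
  kernel_solution c q1 q2 k1 k2 k3 ->
  exponentially_stable c q1 q2 rho1 rho2 k1 k2 k3.
Proof.
move=> mu0 g10 g20 ca ct1 ct2 hk.
have [ck1 ck2 ck3 _ _] := hk.
have {}ck1 := continuous_extend ck1; have {}ck2 := continuous_extend ck2.
have {}ck3 := continuous_extend ck3.
have [keq kbc] := extend_kernel_solution hk.
have [M1 hM1] := continuous2_bounded 0 1 0 1 ck1.
have [M2 hM2] := continuous2_bounded 0 1 0 1 ck2.
have [M3 hM3] := continuous2_bounded 0 1 0 1 ck3.
pose M := Num.max M1 (Num.max M2 M3).
have kM1 (x y : R) : 0 <= x <= 1 -> 0 <= y <= 1 -> `|extend k1 x y| <= M.
  by move=> hx hy; rewrite /M le_max hM1.
have kM2 (x y : R) : 0 <= x <= 1 -> 0 <= y <= 1 -> `|extend k2 x y| <= M.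
  by move=> hx hy; rewrite /M !le_max hM2// orbT.
have kM3 (x y : R) : 0 <= x <= 1 -> 0 <= y <= 1 -> `|extend k3 x y| <= M.
  by move=> hx hy; rewrite /M !le_max hM3// !orbT.
have zin : (fun x : R => 0 <= x <= 1) 0 by rewrite lexx ler01.
have M0 : 0 <= M := le_trans (normr_ge0 _) (kM1 0 0 zin zin).
have [A [A0 hA]] := continuous_bounded_itv 0 1 ca.
pose S := `|sigma11 c| + `|sigma12 c| + `|sigma21 c| + `|sigma22 c| + A.
have S0 : 0 <= S by rewrite /S !addr_ge0.
have S1 : `|sigma11 c| + `|sigma12 c| + A <= S.
  by rewrite /S lerD2r -addrA lerDl addr_ge0.
have S2 : `|sigma21 c| + `|sigma22 c| + A <= S.
  by rewrite /S lerD2r -!addrA addrA lerDr addr_ge0.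
(* [4 * S] is the growth rate due to the couplings, [1] the decay rate to be
   obtained. *)
pose lam := 4 * S + 1.
have lam0 : 0 < lam by rewrite /lam ltr_wpDl// mulr_ge0.
(* The first two terms make transport contract at the rate [lam], the last one
   makes the weighted Volterra operators contract by [2^-1]. *)
pose delta := lam / gamma1 c + lam / gamma2 c + 2 * M ^+ 2.
have d1 : 0 < lam / gamma1 c by rewrite divr_gt0.
have d2 : 0 < lam / gamma2 c by rewrite divr_gt0.
have d3 : 0 <= 2 * M ^+ 2 by rewrite mulr_ge0// sqr_ge0.
have delta0 : 0 < delta by rewrite /delta ltr_pwDl// addr_gt0.
have lam1 : lam <= delta * gamma1 c.
  rewrite -ler_pdivrMr// /delta -addrA lerDl addr_ge0// ltW//.
have lam2 : lam <= delta * gamma2 c.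
  rewrite -ler_pdivrMr// /delta addrAC lerDr addr_ge0// ltW//.
have dM : M / Num.sqrt (2 * delta) <= 2^-1.
  have h : 2 * M <= Num.sqrt (2 * delta).
    have M20 : 0 <= 2 * M by rewrite mulr_ge0.
    rewrite -[leLHS]ger0_norm// -sqrtr_sqr; apply: ler_wsqrtr.
    rewrite exprMn expr2 -mulrA; apply: ler_wpM2l => //.
    by rewrite /delta lerDr addr_ge0// ltW.
  have s0 : 0 < Num.sqrt (2 * delta) by rewrite sqrtr_gt0 mulr_gt0.
  by rewrite ler_pdivrMr// mulrC ler_pdivlMr// mulrC.
pose G := inflow_gain (mu c) (gamma1 c) q1 lam + inflow_gain (mu c) (gamma2 c) q2 lam.
have gain0 (g q : R) : 0 < g -> 0 <= inflow_gain (mu c) g q lam.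
  move=> g0; rewrite /inflow_gain.
  by rewrite !mulr_ge0 ?invr_ge0 ?sqrtr_ge0 ?expR_ge0 ?(ltW g0) ?(ltW mu0).
have G0 : 0 <= G by rewrite /G addr_ge0 ?gain0.
pose C := 2 * expR delta * (3 + (G + 2 * expR (lam / mu c)) * ((1 + expR 2^-1 * M) * 3)).
exists C, 1; split => //.
  rewrite /C mulr_gt0 ?mulr_gt0 ?expR_gt0// ltr_pwDl// mulr_ge0//.
    by rewrite addr_ge0// mulr_ge0 ?expR_ge0.
  by rewrite mulr_ge0// addr_ge0// mulr_ge0 ?expR_ge0.
move=> u10 u20 w0 L10 L20 L30 u1 u2 w [U [y1 [y2 [[z1 [z2 [z [y [sols bd ini]]]]] hU]]]] t t0.
have [sol1 sol2 sol3] := sols.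
have inflow : {ae lebesgue_measure, forall t : R, 0 < t -> z1 t = q1 * z t /\ z2 t = q2 * z t}.
  move: bd; apply: filterS; first exact: (ae_filter_ringOfSetsType lebesgue_measure).
  by move=> s h s0; have [] := h s0.
have feedback : {ae lebesgue_measure, forall t : R, 0 < t ->
    y t = \int[leb]_(x in `[0, 1]) (extend k1 1 x * u1 t x + extend k2 1 x * u2 t x
      + extend k3 1 x * w t x)}.
  move: bd hU; apply: filterS2; first exact: (ae_filter_ringOfSetsType lebesgue_measure).
  move=> s h1 h2 s0; have [_ _ ->] := h1 s0; rewrite (h2 s0).
  set I := Rintegral _ _ _; rewrite (_ : _ + _ = I); last by ring.
  apply: eq_intg => x /triangle_right T1.
  by rewrite !(extend_triangle _ T1).
have := solution_decay mu0 g10 g20 ca ct1 ct2 ck1 ck2 ck3 keq kbc sol1 sol2 sol3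
  inflow feedback kM1 kM2 kM3 hA delta0 dM S1 S2 (erefl lam) lam1 lam2 t0.
have L1 := weak_transport_L2 sol1; have L2' := weak_transport_L2 sol2.
have L3 := weak_transport_L2 sol3.
have z0 : (fun x : R => 0 <= x) 0 by exact: lexx.
have E1 : L2norm (u1 0) = L2norm u10.
  apply: ae_eq_L2norm => //; first exact: L1.1 z0.
  move: ini; apply: filterS; first exact: (ae_filter_ringOfSetsType lebesgue_measure).
  by move=> x h /h[].
have E2 : L2norm (u2 0) = L2norm u20.
  apply: ae_eq_L2norm => //; first exact: L2'.1 z0.
  move: ini; apply: filterS; first exact: (ae_filter_ringOfSetsType lebesgue_measure).
  by move=> x h /h[].
have E3 : L2norm (w 0) = L2norm w0.
  apply: ae_eq_L2norm => //; first exact: L3.1 z0.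
  move: ini; apply: filterS; first exact: (ae_filter_ringOfSetsType lebesgue_measure).
  by move=> x h /h[].
by rewrite /state_norm E1 E2 E3 mulN1r.
Qed.

Theorem theorem1 (R : realType) (g a Cf H V l1 l2 l3 q1 q2 rho1 rho2 : R)
    (k1 k2 k3 : R -> R -> R)
    (hg : 0 < g) (ha : 0 < a) (hCf : 0 < Cf) (hH : 0 < H) (hV : 0 < V)
    (hFr : froude g H V < 1 \/ 1 < froude g H V)
    (hl1 : eigenvalue (sve_matrix g a H V) l1)
    (hl2 : eigenvalue (sve_matrix g a H V) l2)
    (hl3 : eigenvalue (sve_matrix g a H V) l3)
    (hl10 : l1 < 0) (hl02 : 0 < l2) (hl23 : l2 < l3)
    (hk : kernel_solution (sve_coeffs Cf H V l1 l2 l3) q1 q2 k1 k2 k3) :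
  exponentially_stable (sve_coeffs Cf H V l1 l2 l3) q1 q2 rho1 rho2 k1 k2 k3.
Proof.
apply: backstepping_stability hk => /=.
- by rewrite oppr_gt0.
- exact: hl02.
- exact: lt_trans hl02 hl23.
- by cont.
- by cont.
- by cont.
Qed.
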